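(* For every $\varepsilon>0$ there exists a set $F\subset D$ which consists of a finite number of line segments and such that there exists a set $\mathcal{A}\subset\mathcal{V}$ with $\mathbf{\Lambda}(\mathcal{V}\setminus\mathcal{A})\leq\varepsilon$, satisfying the following conditions. (i) For all $(\mathbf{v},\mathbf{w})\in\mathcal{A}$, the line $L_{\mathbf{v},\mathbf{w}}$ intersects $F$. (ii) For all $(\mathbf{v},\mathbf{w})\in\mathcal{A}$, we have $\mathcal{T}_F(\mathbf{v},\mathbf{w})=(\mathbf{v},\mathbf{w}_1)$ for some $\mathbf{w}_1$ satisfying $|\mathbf{w}-\mathbf{w}_1|\leq\varepsilon$.
   Context: Identify $\mathbb{R}^2$ with $\mathbb{C}$. $D=\{x\in\mathbb{R}^2:|x|\leq 1\}$ is the closed unit disc. Directed lines. $\mathcal{W}$ is the set of all pairs $(\mathbf{v},\mathbf{w})$ with $\mathbf{v},\mathbf{w}\in\mathbb{R}^2$, $\mathbf{v}\perp\mathbf{w}$, $|\mathbf{v}|=1$, with the topology inherited from $\mathbb{R}^4$. For $(\mathbf{v},\mathbf{w})\in\mathcal{W}$, $\Gamma_{\mathbf{v},\mathbf{w}}(t)=t\mathbf{v}+\mathbf{w}$, $t\in\mathbb{R}$, and $L_{\mathbf{v},\mathbf{w}}=\Gamma_{\mathbf{v},\mathbf{w}}(\mathbb{R})$. $\mathbf{\Lambda}$ is the measure on $\mathcal{W}$ uniquely defined by $$\mathbf{\Lambda}(\{(\mathbf{v},\mathbf{w}):\mathbf{w}=re^{i\theta},\mathbf{v}=e^{i(\theta+\pi/2)},\theta\in[\theta_1,\theta_2],r\in[r_1,r_2]\})=\mathbf{\Lambda}(\{(\mathbf{v},\mathbf{w}):\mathbf{w}=re^{i\theta},\mathbf{v}=e^{i(\theta-\pi/2)},\theta\in[\theta_1,\theta_2],r\in[r_1,r_2]\})=(\theta_2-\theta_1)(r_2-r_1)$$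 for $0\le r_1\le r_2$ and $[\theta_1,\theta_2]\subset[0,2\pi)$. $\mathcal{V}$ is the set of all $(\mathbf{v},\mathbf{w})\in\mathcal{W}$ with $\mathbf{w}\in D$, so that $\mathbf{\Lambda}(\mathcal{V})=4\pi$. Light rays. Line segments in $F$ are regarded as (two-sided) mirrors. A light ray is a continuous piecewise affine map $R:\mathbb{R}\to\mathbb{R}^2$ such that $\mathbb{R}$ is partitioned into finitely many intervals on each of which $R(t)=(t-t_1)\mathbf{v}+\mathbf{w}$ for some $(\mathbf{v},\mathbf{w})\in\mathcal{W}$ and $t_1\in\mathbb{R}$ depending on the interval; it moves at unit speed along straight lines and reflects from mirrors according to the classical law of specular reflection (angle of reflection equals angle of incidence). $R$ comes from direction $\Gamma_{\mathbf{v}_1,\mathbf{w}_1}$ if $R(t)=(t-t_1)\mathbf{v}_1+\mathbf{w}_1$ on the interval extending to $-\infty$, and escapes in direction $\Gamma_{\mathbf{v}_2,\mathbf{w}_2}$ if $R(t)=(t-t_2)\mathbf{v}_2+\mathbf{w}_2$ on the interval extending to $+\infty$. If $F$ is a finite union of line segments and the light ray coming from direction $\Gamma_{\mathbf{v}_1,\mathbf{w}_1}$ escapes in direction $\Gamma_{\mathbf{v}_2,\mathbf{w}_2}$ after reflecting in the mirrors comprising $F$, we write $\mathcal{T}_F(\mathbf{v}_1,\mathbf{w}_1)=(\mathbf{v}_2,\mathbf{w}_2)$ (the path is not uniquely defined for rays that hit endpoints of mirrors). *)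

(* Defs.v *)
From HB Require Import structures.
From mathcomp Require Import all_boot all_order all_algebra.
From mathcomp Require Import all_classical all_reals all_analysis.
From mathcomp Require Import measurable_realfun ring lra.

Set Implicit Arguments.
Unset Strict Implicit.
Unset Printing Implicit Defensive.

Import Order.TTheory GRing.Theory Num.Theory.
Import numFieldNormedType.Exports.

Local Open Scope classical_set_scope.
Local Open Scope ring_scope.

Section Plane.
Context {R : realType}.
Local Notation pt := (R * R)%type.

(* The library norm on [R * R] is the sup norm, hence [enorm]. *)
Definition dot (x y : pt) : R := x.1 * y.1 + x.2 * y.2.
Definition enorm (x : pt) : R := Num.sqrt (dot x x).

Definition disc : set pt := [set x | enorm x <= 1].

(* r e^{i a} *)
Definition polar (r a : R) : pt := (r * cos a, r * sin a).

(* The set W; a pair [(v, w)] stands for the parametrized line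
   t |-> t v + w. *)
Definition directed_lines : set (pt * pt) :=
  [set d | dot d.1 d.2 = 0 /\ enorm d.1 = 1].

(* The set V of the lines that meet the disc. *)
Definition disc_lines : set (pt * pt) :=
  [set d | directed_lines d /\ disc d.2].

Definition Gamma (d : pt * pt) (t : R) : pt := t *: d.1 + d.2.
Definition line (d : pt * pt) : set pt := range (Gamma d).

End Plane.

Section LineMeasure.
Context {R : realType}.
Local Notation pt := (R * R)%type.
Local Notation angles_radii := (measurableTypeR R * measurableTypeR R)%type.

(* The two lines with foot w = r e^{i a}, with v = e^{i (a + pi/2)} and
   v = e^{i (a - pi/2)}; the argument is [(a, r)]. *)
Definition ccw_line (p : angles_radii) : pt * pt :=
  (polar 1 (p.1 + pi / 2), polar p.2 p.1).
Definition cw_line (p : angles_radii) : pt * pt :=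
  (polar 1 (p.1 - pi / 2), polar p.2 p.1).

Definition polar_domain : set angles_radii :=
  `[0, pi *+ 2[ `*` `[0, +oo[.

(* The measure da dr, transported to directed lines by both
   parametrizations.  Its defining values are given by [Lambda_ccw_box] and
   [Lambda_cw_box] below. *)
Definition Lambda (A : set (pt * pt)) : \bar R :=
  ((lebesgue_measure \x lebesgue_measure)%E
      (polar_domain `&` ccw_line @^-1` A) +
   (lebesgue_measure \x lebesgue_measure)%E
      (polar_domain `&` cw_line @^-1` A))%E.

Local Notation mu2 := (@lebesgue_measure R \x @lebesgue_measure R)%E.

Lemma measurable_polar_domain : measurable polar_domain.
Proof. by apply: measurableX; exact: measurable_itv. Qed.

Lemma measurable_polar (f g : angles_radii -> R) :
  measurable_fun setT f -> measurable_fun setT g ->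
  measurable_fun setT (fun p => polar (f p) (g p)).
Proof.
move=> mf mg.
have mcos := continuous_measurable_fun (@continuous_cos R).
have msin := continuous_measurable_fun (@continuous_sin R).
by apply: measurable_fun_pair; apply: measurable_funM => //;
  exact: measurableT_comp.
Qed.

Let mfst : measurable_fun [set: angles_radii] (fun p => p.1 : R).
Proof. exact: measurable_fst. Qed.

Let msnd : measurable_fun [set: angles_radii] (fun p => p.2 : R).
Proof. exact: measurable_snd. Qed.

Lemma measurable_ccw_line : measurable_fun [set: angles_radii] ccw_line.
Proof.
by apply: measurable_fun_pair; apply: measurable_polar => //;
  apply: measurable_funD.
Qed.

Lemma measurable_cw_line : measurable_fun [set: angles_radii] cw_line.
Proof.
by apply: measurable_fun_pair; apply: measurable_polar => //;
  apply: measurable_funD.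
Qed.

Let mD := measurable_polar_domain.

Let LambdaE A : Lambda A =
  (pushforward (mrestr mu2 mD) ccw_line A +
   pushforward (mrestr mu2 mD) cw_line A)%E.
Proof. by rewrite /Lambda /pushforward /mrestr !(setIC _ polar_domain). Qed.

Let pushforward_mu2 (f : angles_radii -> pt * pt) :
  measurable_fun setT f ->
  {m : {measure set (pt * pt) -> \bar R} |
    forall A, m A = pushforward (mrestr mu2 mD) f A}.
Proof.
move=> mf.
by unshelve eexists; [exact: [the measure _ _ of pushforward (mrestr mu2 mD) f]|].
Qed.

Let Lambda_measure_add : {m : {measure set (pt * pt) -> \bar R} |
  forall A, m A = Lambda A}.
Proof.
have [m1 m1E] := pushforward_mu2 measurable_ccw_line.
have [m2 m2E] := pushforward_mu2 measurable_cw_line.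
by exists (measure_add m1 m2) => A;
  rewrite LambdaE -m1E -m2E; exact: measure_addE.
Qed.

Let Lambda0 : Lambda set0 = 0%E.
Proof. by have [m <-] := Lambda_measure_add; exact: measure0. Qed.

Let Lambda_ge0 A : (0 <= Lambda A)%E.
Proof. by have [m <-] := Lambda_measure_add; exact: measure_ge0. Qed.

Let Lambda_semi_sigma_additive : semi_sigma_additive Lambda.
Proof.
have [m mE] := Lambda_measure_add.
rewrite (_ : Lambda = m); first exact: measure_semi_sigma_additive.
by apply/funext => A; rewrite mE.
Qed.

HB.instance Definition _ := isMeasure.Build _ _ _ Lambda
  Lambda0 Lambda_ge0 Lambda_semi_sigma_additive.

Lemma cos_lt1 (x : R) : 0 < x < pi *+ 2 -> cos x < 1.
Proof.
move=> /andP[x0 x2]; have -> : x = (x / 2) *+ 2 by lra.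
have s0 : 0 < sin (x / 2) by apply: sin_gt0_pi; lra.
rewrite cos_mulr2n cos2sin2; nra.
Qed.

Lemma cos_sin_inj (a b : R) : 0 <= a < pi *+ 2 -> 0 <= b < pi *+ 2 ->
  cos a = cos b -> sin a = sin b -> a = b.
Proof.
move=> a2 b2 cab sab; apply: contrapT => /eqP; rewrite neq_lt => ab.
have d1 : cos (a - b) = 1 by rewrite cosB cab sab -!expr2 cos2Dsin2.
have d2 : cos (b - a) = 1 by rewrite cosB cab sab -!expr2 cos2Dsin2.
case/orP: ab => ab.
  by have := @cos_lt1 (b - a); rewrite d2 ltxx => H; suff: false by []; apply: H; lra.
by have := @cos_lt1 (a - b); rewrite d1 ltxx => H; suff: false by []; apply: H; lra.
Qed.

Lemma ccw_lineE (p : angles_radii) :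
  ccw_line p = ((- sin p.1, cos p.1), (p.2 * cos p.1, p.2 * sin p.1)).
Proof. by rewrite /ccw_line /polar !mul1r cosDpihalf sinDpihalf. Qed.

Lemma cw_lineE (p : angles_radii) :
  cw_line p = ((sin p.1, - cos p.1), (p.2 * cos p.1, p.2 * sin p.1)).
Proof. by rewrite /cw_line /polar !mul1r cosBpihalf sinBpihalf. Qed.

Let polar_radius_inj (a r s : R) :
  r * cos a = s * cos a -> r * sin a = s * sin a -> r = s.
Proof.
have E x : x = cos a * (x * cos a) + sin a * (x * sin a).
  by rewrite -[LHS]mulr1 -(cos2Dsin2 a); ring.
by move=> rc rs; rewrite [LHS]E [RHS]E rc rs.
Qed.

Let polar_domainP (p : angles_radii) :
  polar_domain p <-> 0 <= (p.1 : R) < pi *+ 2 /\ 0 <= (p.2 : R).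
Proof.
rewrite /polar_domain /= !in_itv /= andbT; split => [[? ?]|[? ?]]; split => //.
Qed.

Lemma ccw_line_inj : {in polar_domain &, injective ccw_line}.
Proof.
move=> [a r] [b s] /set_mem/polar_domainP[/= a2 r0] /set_mem/polar_domainP[/= b2 s0].
rewrite !ccw_lineE /= => -[/oppr_inj sab cab rc rs].
have ab := cos_sin_inj a2 b2 cab sab.
by rewrite -ab in rc rs; rewrite (polar_radius_inj rc rs) ab.
Qed.

Lemma cw_line_inj : {in polar_domain &, injective cw_line}.
Proof.
move=> [a r] [b s] /set_mem/polar_domainP[/= a2 r0] /set_mem/polar_domainP[/= b2 s0].
rewrite !cw_lineE /= => -[sab /oppr_inj cab rc rs].
have ab := cos_sin_inj a2 b2 cab sab.
by rewrite -ab in rc rs; rewrite (polar_radius_inj rc rs) ab.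
Qed.

Lemma ccw_cw_line (p q : angles_radii) : polar_domain p -> polar_domain q ->
  ccw_line p = cw_line q -> p.2 = 0 /\ q.2 = 0.
Proof.
move: p q => [a r] [b s] /polar_domainP[/= a2 r0] /polar_domainP[/= b2 s0].
rewrite ccw_lineE cw_lineE /= => -[sab cab rc rs].
have : r = - s.
  by apply: (@polar_radius_inj a); [rewrite rc cab | rewrite rs -sab]; ring.
by move=> rs0; split; lra.
Qed.

Let mu2_null (A : set angles_radii) : A `<=` [set p | p.2 = 0] -> mu2 A = 0%E.
Proof.
move=> A0; rewrite /product_measure1; apply: integral0_eq => x _ /=.
have : xsection A x `<=` [set 0 : R] by move=> y /xsectionP/A0.
move=> /subset_set1[] ->; first by rewrite measure0.
exact: lebesgue_measure_set1.
Qed.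

Definition polar_box (a1 a2 r1 r2 : R) : set angles_radii :=
  `[a1, a2] `*` `[r1, r2].

Let mu2_box (a1 a2 r1 r2 : R) : a1 <= a2 -> r1 <= r2 ->
  mu2 (polar_box a1 a2 r1 r2) = ((a2 - a1) * (r2 - r1))%:E.
Proof.
move=> a12 r12.
have itvE (x y : R) : x <= y -> lebesgue_measure `[x, y]%classic = (y - x)%:E.
  rewrite lebesgue_measure_itv /= lte_fin => xy.
  by case: ltP => // yx; rewrite (_ : y = x) ?subrr//; apply/le_anti; rewrite xy yx.
rewrite product_measure1E; [|exact: measurable_itv|exact: measurable_itv].
by rewrite /= !itvE// EFinM.
Qed.

Let polar_box_domain (a1 a2 r1 r2 : R) : 0 <= a1 -> a2 < pi *+ 2 -> 0 <= r1 ->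
  polar_box a1 a2 r1 r2 `<=` polar_domain.
Proof.
move=> a10 a22 r10 [a r] /= [/=]; rewrite !in_itv /= => /andP[? ?] /andP[? ?].
by apply/polar_domainP => /=; split; [apply/andP; split|]; lra.
Qed.

Lemma Lambda_ccw_box (a1 a2 r1 r2 : R) : 0 <= a1 -> a1 <= a2 ->
  a2 < pi *+ 2 -> 0 <= r1 -> r1 <= r2 ->
  Lambda (ccw_line @` polar_box a1 a2 r1 r2) = ((a2 - a1) * (r2 - r1))%:E.
Proof.
move=> a10 a12 a22 r10 r12.
have BD := polar_box_domain a10 a22 r10 (r2 := r2).
rewrite /Lambda [X in (_ + X)%E](_ : _ = 0%E) ?adde0; last first.
  by apply: mu2_null => p [Dp [q /BD Dq /(ccw_cw_line Dq Dp)[]]].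
rewrite -mu2_box//; congr (mu2 _); apply/seteqP; split.
  move=> p [Dp [q Bq qp]]; rewrite -(ccw_line_inj _ _ qp) ?inE//.
  exact: BD.
by move=> p Bp; split; [exact: BD | exists p].
Qed.

Lemma Lambda_cw_box (a1 a2 r1 r2 : R) : 0 <= a1 -> a1 <= a2 ->
  a2 < pi *+ 2 -> 0 <= r1 -> r1 <= r2 ->
  Lambda (cw_line @` polar_box a1 a2 r1 r2) = ((a2 - a1) * (r2 - r1))%:E.
Proof.
move=> a10 a12 a22 r10 r12.
have BD := polar_box_domain a10 a22 r10 (r2 := r2).
rewrite /Lambda [X in (X + _)%E](_ : _ = 0%E) ?add0e; last first.
  by apply: mu2_null => p [Dp [q /BD Dq /esym/(ccw_cw_line Dp Dq)[]]].
rewrite -mu2_box//; congr (mu2 _); apply/seteqP; split.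
  move=> p [Dp [q Bq qp]]; rewrite -(cw_line_inj _ _ qp) ?inE//.
  exact: BD.
by move=> p Bp; split; [exact: BD | exists p].
Qed.

Lemma enorm_polar (r a : R) : 0 <= r -> enorm (polar r a) = r.
Proof.
move=> r0; rewrite /enorm /dot /= (_ : _ + _ = r ^+ 2) ?sqrtr_sqr ?ger0_norm//.
by rewrite -[RHS]mulr1 -(cos2Dsin2 a); ring.
Qed.

Lemma directed_lines_ccw (p : angles_radii) : directed_lines (ccw_line p).
Proof.
split; last by rewrite /ccw_line /= enorm_polar.
by rewrite ccw_lineE /dot /=; ring.
Qed.

Lemma directed_lines_cw (p : angles_radii) : directed_lines (cw_line p).
Proof.
split; last by rewrite /cw_line /= enorm_polar.
by rewrite cw_lineE /dot /=; ring.
Qed.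

Lemma Lambda_disc_lines : Lambda disc_lines = (4 * pi)%:E.
Proof.
have DE : `[0, pi *+ 2[ `*` `[0, 1] =
    polar_domain `&` [set p : angles_radii | (p.2 : R) <= 1].
  apply/seteqP; split => -[a r] /=; rewrite /polar_domain /= !in_itv /= andbT.
    by move=> [aI /andP[r0 r1]].
  by move=> [[aI r0] r1]; split=> //; rewrite r0.
have E (f : angles_radii -> pt * pt) :
    (forall p, directed_lines (f p)) -> (forall p, (f p).2 = polar p.2 p.1) ->
    mu2 (polar_domain `&` f @^-1` disc_lines) = (2 * pi)%:E.
  move=> fW fw; rewrite (_ : _ `&` _ = `[0, pi *+ 2[ `*` `[0, 1]); last first.
    rewrite DE; apply/seteqP; split => p [Dp] /=.
      by move=> [_]; rewrite /disc /= fw enorm_polar //; have /polar_domainP[] := Dp.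
    move=> p1; split=> //; split; first exact: fW.
    by rewrite /disc /= fw enorm_polar //; have /polar_domainP[] := Dp.
  rewrite product_measure1E; [|exact: measurable_itv|exact: measurable_itv].
  rewrite /= !lebesgue_measure_itv /= !lte_fin ltr01 mulr2n addr_gt0 ?pi_gt0 //.
  by rewrite -EFinM; congr EFin; ring.
rewrite /Lambda !E; first by rewrite -EFinD; congr EFin; ring.
- exact: directed_lines_cw.
- by [].
- exact: directed_lines_ccw.
- by [].
Qed.

End LineMeasure.

Section LightRays.
Context {R : realType}.
Local Notation pt := (R * R)%type.

(* A mirror is given by its two endpoints; [mirror_union M] is the set F. *)
Definition segment (m : pt * pt) : set pt :=
  [set (1 - s) *: m.1 + s *: m.2 | s in `[0, 1]].
Definition mirror_union (M : seq (pt * pt)) : set pt :=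
  \bigcup_(m in [set` M]) segment m.
Definition endpoint (M : seq (pt * pt)) (x : pt) : Prop :=
  exists2 m, m \in M & x = m.1 \/ x = m.2.

(* [g] runs along the directed line [d] at unit speed during [I]. *)
Definition runs_along (g : R -> pt) (d : pt * pt) (I : set R) : Prop :=
  exists t1, forall t, I t -> g t = Gamma d (t - t1).

Definition piecewise_affine (g : R -> pt) : Prop :=
  exists P : seq (interval R),
    (forall t, exists! i, i \in P /\ t \in i) /\
    (forall i, i \in P ->
       exists2 d, directed_lines d & runs_along g d [set` i]).

(* [u] is the velocity of [g] just before, resp. just after, time [t]. *)
Definition incoming (g : R -> pt) (t : R) (u : pt) : Prop :=
  \forall s \near t^'-, g s = g t + (s - t) *: u.
Definition outgoing (g : R -> pt) (t : R) (u : pt) : Prop :=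
  \forall s \near t^'+, g s = g t + (s - t) *: u.

(* Specular reflection: the component of the velocity along the mirror is
   kept, the component normal to it changes sign. *)
Definition specular (m : pt * pt) (u u' : pt) : Prop :=
  let e := m.2 - m.1 in
  let n := (- e.2, e.1) in
  dot u' e = dot u e /\ dot u' n = - dot u n.

(* Nothing is imposed at the endpoints of the mirrors, where the law of
   reflection does not apply.  At a common interior point of several mirrors
   the law must hold for each of them, which is possible only if they are
   parallel. *)
Definition reflects (M : seq (pt * pt)) (g : R -> pt) : Prop :=
  forall t, ~ endpoint M (g t) ->
    exists u u', [/\ incoming g t u, outgoing g t u',
      (~ mirror_union M (g t) -> u' = u) &
      (forall m, m \in M -> segment m (g t) -> specular m u u')].

Definition light_ray (M : seq (pt * pt)) (g : R -> pt) : Prop :=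
  [/\ continuous g, piecewise_affine g & reflects M g].

Definition comes_from (g : R -> pt) (d : pt * pt) : Prop :=
  exists T : R, runs_along g d `]-oo, T].
Definition escapes_in (g : R -> pt) (d : pt * pt) : Prop :=
  exists T : R, runs_along g d `[T, +oo[.

(* T_F(d) = d', as the graph of a partial function (see
   [transformation_functional]): T_F is left undefined at the lines whose
   light ray hits an endpoint of a mirror, since the path is then not
   unique. *)
Definition transformation (M : seq (pt * pt)) (d d' : pt * pt) : Prop :=
  [/\ directed_lines d, directed_lines d' &
    exists g, [/\ light_ray M g, forall t, ~ endpoint M (g t),
      comes_from g d & escapes_in g d']].

Let specular_inj (m : pt * pt) (u u1 u2 : pt) : m.1 != m.2 ->
  specular m u u1 -> specular m u u2 -> u1 = u2.
Proof.
move: m u u1 u2 => [[a b] [c d]] [u v] [u1 v1] [u2 v2] /eqP ab [e1 n1] [e2 n2].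
rewrite /dot /= in e1 n1 e2 n2.
have e0 : (c - a) * (c - a) + (d - b) * (d - b) != 0.
  apply: contra_notN ab; rewrite -!expr2 paddr_eq0 ?sqr_ge0// !sqrf_eq0.
  by rewrite !subr_eq0 => /andP[/eqP-> /eqP->].
have H1 : (u1 - u2) * ((c - a) * (c - a) + (d - b) * (d - b)) = 0.
  transitivity ((c - a) * ((u1 * (c - a) + v1 * (d - b)) - (u2 * (c - a) + v2 * (d - b)))
   - (d - b) * ((u1 * - (d - b) + v1 * (c - a)) - (u2 * - (d - b) + v2 * (c - a)))).
   ring.
  rewrite e1 e2 n1 n2; ring.
have H2 : (v1 - v2) * ((c - a) * (c - a) + (d - b) * (d - b)) = 0.
  transitivity ((d - b) * ((u1 * (c - a) + v1 * (d - b)) - (u2 * (c - a) + v2 * (d - b)))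
   + (c - a) * ((u1 * - (d - b) + v1 * (c - a)) - (u2 * - (d - b) + v2 * (c - a)))).
   ring.
  rewrite e1 e2 n1 n2; ring.
move/eqP: H1; move/eqP: H2; rewrite !mulf_eq0 !(negPf e0) !orbF !subr_eq0.
by move=> /eqP-> /eqP->.
Qed.

Let reflected_inj (M : seq (pt * pt)) (x u u1 u2 : pt) : ~ endpoint M x ->
  (~ mirror_union M x -> u1 = u) ->
  (forall m, m \in M -> segment m x -> specular m u u1) ->
  (~ mirror_union M x -> u2 = u) ->
  (forall m, m \in M -> segment m x -> specular m u u2) -> u1 = u2.
Proof.
move=> xM n1 s1 n2 s2; have [[m mM mx]|xF] := pselect (mirror_union M x).
  apply: specular_inj (s1 _ mM mx) (s2 _ mM mx).
  apply: contra_notN xM => /eqP m12; exists m => //.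
  by case: mx => s _ <-; left; rewrite -m12 -scalerDl subrK scale1r.
by rewrite n1 ?n2.
Qed.

Let reflects_eq (M : seq (pt * pt)) (g h : R -> pt) (T : R) :
  continuous g -> reflects M g -> (forall t, ~ endpoint M (g t)) ->
  continuous h -> reflects M h ->
  (forall t, t <= T -> g t = h t) -> forall t, g t = h t.
Proof.
move=> cg lg gM ch lh ghT t; apply: contrapT => ght.
pose S := [set x : R | forall t, t <= x -> g t = h t].
have ubS : ubound S t.
  by move=> x Sx; rewrite leNgt; apply/negP => tx; apply: ght; apply: Sx; exact: ltW.
have hS : has_sup S by split; [exists T | exists t].
set s := sup S.
have ghs r : r < s -> g r = h r.
  by move=> /(sup_gt hS.1)[x Sx rx]; apply: Sx; exact: ltW.
have near_gh : \forall r \near s^'-, g r = h r.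
  by near=> r; apply: ghs; near: r; exact: nbhs_left_lt.
have gs : g s = h s.
  have cl (f : R -> pt) : continuous f -> f r @[r --> s^'-] --> f s.
    by move=> cf; apply: cvg_at_left_filter; exact: cf.
  apply: (@cvg_unique _ (@norm_hausdorff _ _) _ _ _ _ (cl _ cg)).
  by apply: cvg_trans (cl _ ch); apply: near_eq_cvg; near=> r; apply/esym; near: r.
have [u [u' [gu gu' gn gm]]] := lg s (gM s).
have [|v [v' [hv hv' hn hm]]] := lh s; first by rewrite -gs.
have uv : u = v.
  have [r [rs [gr [hr ghr]]]] :
      exists r, [/\ r < s, g r = g s + (r - s) *: u,
        h r = h s + (r - s) *: v & g r = h r].
    near s^'- => r; exists r; split; near: r => //.
    exact: nbhs_left_lt.
  move: ghr; rewrite gr hr gs => /addrI/scalerI; apply.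
  by rewrite subr_eq0 lt_eqF.
subst v.
have u'v' : u' = v'.
  by apply: (reflected_inj (gM s) gn gm); rewrite gs.
subst v'.
have [e /= e0 He] : \forall r \near s^'+, g r = h r.
  near=> r; rewrite (_ : g r = g s + (r - s) *: u'); last by near: r.
  by rewrite gs; apply/esym; near: r.
have : S (s + e / 2).
  move=> r rs; have [/ghs//|] := ltP r s.
  rewrite le_eqVlt => /predU1P[<-//|sr]; apply: He => //=.
  by rewrite ltr0_norm; lra.
by move=> /(ub_le_sup hS.2); rewrite -/s; lra.
Unshelve. all: by end_near.
Qed.

Let reflects_shift (M : seq (pt * pt)) (g : R -> pt) (c : R) :
  reflects M g -> reflects M (fun t => g (t + c)).
Proof.
move=> lg t /lg[u [u' [[e /= e0 He] [f /= f0 Hf] n m]]].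
have bE s : `|t + c - (s + c)| = `|t - s| by congr `|_|; lra.
have sE s : s + c - (t + c) = s - t by lra.
exists u, u'; split => //.
  by exists e => //= s ts st; rewrite He ?sE//= ?bE// ltrD2r.
by exists f => //= s ts st; rewrite Hf ?sE//= ?bE// ltrD2r.
Qed.

Let directed_line_inj (d1 d2 : pt * pt) (t1 t2 T : R) :
  directed_lines d1 -> directed_lines d2 ->
  (forall t, T <= t -> Gamma d1 (t - t1) = Gamma d2 (t - t2)) -> d1 = d2.
Proof.
move: d1 d2 => [[a b] [c d]] [[a0 b0] [c0 d0]] [].
move=> q1 n1 [q2 n2] H; rewrite /enorm /dot /= in q1 n1 q2 n2.
have m2 : a0 * a0 + b0 * b0 = 1.
  move: n2 => /(congr1 (fun x => x ^+ 2)); rewrite sqr_sqrtr ?expr1n//.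
  by rewrite -!expr2 addr_ge0 ?sqr_ge0.
have [/= hc hd] := H T (lexx _).
have T1 : T <= T + 1 by lra.
have [/= hc1 hd1] := H (T + 1) T1.
rewrite /GRing.scale /= in hc hd hc1 hd1.
have aa : a = a0 by lra.
have bb : b = b0 by lra.
subst a0 b0.
have cc : c0 = c + (t2 - t1) * a by lra.
have dd : d0 = d + (t2 - t1) * b by lra.
have t12 : t2 - t1 = 0.
  transitivity ((t2 - t1) * (a * a + b * b)); first by rewrite m2 mulr1.
  transitivity ((a * c0 + b * d0) - (a * c + b * d)); first by rewrite cc dd; ring.
  by rewrite q1 q2 subrr.
by rewrite cc dd t12 !mul0r !addr0.
Qed.

Lemma transformation_functional (M : seq (pt * pt)) (d d1 d2 : pt * pt) :
  transformation M d d1 -> transformation M d d2 -> d1 = d2.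
Proof.
move=> [_ W1 [g [[cg _ lg] gM [T [t gT]] [U1 [u1 gU]]]]].
move=> [_ W2 [h [[ch _ lh] hM [S [s hS]] [U2 [u2 hU]]]]].
pose k r := h (r + (s - t)).
have gk : forall r, g r = k r.
  apply: (@reflects_eq M g k (Num.min T (S - (s - t)))) => //.
  - move=> x; apply: (@continuous_comp _ _ _ (fun r => r + (s - t)) h); last exact: ch.
    by apply: continuousD; [exact: cvg_id | exact: cvg_cst].
  - exact: reflects_shift.
  - move=> r; rewrite le_min => /andP[rT rS].
    rewrite /k gT ?hS /= ?in_itv //=; first by congr (Gamma d _); lra.
    lra.
apply: (@directed_line_inj d1 d2 u1 (u2 - (s - t)) (Num.max U1 (U2 - (s - t)))) => //.
move=> r; rewrite ge_max => /andP[rU1 rU2].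
rewrite -gU ?gk /k /= ?in_itv /= ?andbT// hU /= ?in_itv /= ?andbT; last lra.
by congr (Gamma d2 _); lra.
Qed.

End LightRays.

(* Main.v *)
Require Import Defs.
From HB Require Import structures.
From mathcomp Require Import all_boot all_order all_algebra.
From mathcomp Require Import all_classical all_reals all_analysis.
From mathcomp Require Import measurable_realfun ring lra zify.

(* A ray of direction proportional to (t, 1), t small, is blocked by a comb:
   small parallel mirrors at 45 degrees, put end over end, each of width and
   height g.  It is reflected by two consecutive teeth, after which it has the
   same direction and has moved sideways by g (1 + t), unless it meets a tooth
   too close to its ends.

   Combs that are invisible from other directions are obtained from a digital
   sundial.  Starting from a slat of length 2, cut the slats into many pieces and
   turn the pieces successively towards s_0, s_1, ..., s_n, in such a way that
   the projections of s_i along all directions |t| <= delta increase with i,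
   whereas every direction |t| >= T is nearly parallel to some s_i.  The final
   slats still meet every line of slope |t| <= delta through the initial slat,
   but their shadow in any direction |t| >= T has arbitrarily small measure.  The
   total length of the final slats is bounded in terms of delta / (T - delta).
   A tiny comb is placed on each slat.

   Superpose n copies of this, rotated by the angles (2 j + 1) x with
   x = pi / (2 n), T = tan x and delta = tan ((1 - 1 / m) x), so that
   delta / (T - delta) <= m.  Up to a proportion 1 / m of them, all directions
   belong to the cone of one copy, and the directions in the cone of one copy
   are outside the cones of slope T of all other copies.  Shifting all combs
   simultaneously by g k / J, k < J, a given line meets a given comb too close to
   the ends of a tooth for at most two values of k; hence for some k such lines
   have measure O(1 / J), where J depends on m but not on n. *)

Set Implicit Arguments.
Unset Strict Implicit.
Unset Printing Implicit Defensive.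

Import Order.TTheory GRing.Theory Num.Theory.
Import numFieldNormedType.Exports.

Local Open Scope classical_set_scope.
Local Open Scope ring_scope.

(** The shape of the proof is dictated by a circularity among the constants. Two clean reflections
    are guaranteed only for slopes small compared with the margin 1 / J kept at the ends of a tooth,
    so delta, and with it n, depends on J. Conversely, J has to beat the loss at the ends of the
    teeth, which is summed over n copies.

    The way out is that a copy only deals with lines in a window of angles of width proportional to
    x, and 2 n x = pi: the loss of all copies together is proportional to the total length of the
    slats of one copy, divided by J. This length is bounded before n is known, since the fans have a
    length governed by delta / (T - delta). It would be infinite for delta = T; giving up a
    proportion 1 / m of the directions bounds it by m for every n.

    The other scales come later, each small in terms of the previous ones: the number of slats and
    the thickness rho around them which lines of foreign directions avoid, then the gaps between
    heights, then the width g of a tooth, which makes the sum of all displacements negligible even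
    against rho. *)

Section Coordinates.
Context {R : realType}.
Local Notation pt := (R * R)%type.

Lemma fst_addE (x y : pt) : (x + y).1 = x.1 + y.1. Proof. by []. Qed.
Lemma snd_addE (x y : pt) : (x + y).2 = x.2 + y.2. Proof. by []. Qed.
Lemma fst_oppE (x : pt) : (- x).1 = - x.1. Proof. by []. Qed.
Lemma snd_oppE (x : pt) : (- x).2 = - x.2. Proof. by []. Qed.
Lemma fst_scaleE (a : R) (x : pt) : (a *: x).1 = a * x.1. Proof. by []. Qed.
Lemma snd_scaleE (a : R) (x : pt) : (a *: x).2 = a * x.2. Proof. by []. Qed.

Definition coordE :=
  (fst_addE, snd_addE, fst_oppE, snd_oppE, fst_scaleE, snd_scaleE).

Lemma pt_eq (x y : pt) : x.1 = y.1 -> x.2 = y.2 -> x = y.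
Proof. by case: x y => [? ?] [? ?] /= -> ->. Qed.

End Coordinates.

(** * Light rays built leg by leg *)

Section Polylines.
Context {R : realType}.
Local Notation pt := (R * R)%type.
Implicit Types (M : seq (pt * pt)) (d : pt * pt) (x y u v : pt) (c t tau : R).

(** The second component is the foot of the perpendicular from the origin; [x] is reached at the
    parameter [dot x u]. *)
Definition line_through x u : pt * pt := (u, x - dot x u *: u).

Definition reflects_at M (g : R -> pt) t : Prop :=
  exists u u', [/\ incoming g t u, outgoing g t u',
    (~ mirror_union M (g t) -> u' = u) &
    (forall m, m \in M -> segment m (g t) -> specular m u u')].

Lemma directed_line_through x u : enorm u = 1 -> directed_lines (line_through x u).
Proof.
move=> u1; split => //=; move: (u1); rewrite /enorm => /(congr1 (fun z => z ^+ 2)).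
case: x u u1 => [x1 x2] [u1 u2] _; rewrite /dot /= sqr_sqrtr; last first.
  by rewrite -!expr2 addr_ge0 ?sqr_ge0.
rewrite expr1n /GRing.scale /= => E.
transitivity ((u1 * x1 + u2 * x2) - (x1 * u1 + x2 * u2) * (u1 * u1 + u2 * u2)).
  by ring.
by rewrite E; ring.
Qed.

Lemma Gamma_line_through x u t : Gamma (line_through x u) (t + dot x u) = x + t *: u.
Proof.
have -> s : Gamma (line_through x u) s = s *: u + (x - dot x u *: u) by [].
by apply: pt_eq; rewrite !coordE; ring.
Qed.

Lemma endpoint_mirror_union M x : endpoint M x -> mirror_union M x.
Proof.
move=> [m mM mx]; exists m => //; case: mx => ->.
  by exists 0 => //=; rewrite ?in_itv /= ?lexx ?ler01 // subr0 scale1r scale0r addr0.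
by exists 1 => //=; rewrite ?in_itv /= ?lexx ?ler01 // subrr scale1r scale0r add0r.
Qed.

(* A light ray that comes from [d] and reaches [x] with velocity [u] at time [c];
   after that time the mirrors are ignored. *)
Definition ray_to M d c x u : Prop := exists (g : R -> pt) (P : seq (interval R)),
  [/\ continuous g, forall t, c <= t -> g t = x + (t - c) *: u, comes_from g d,
      forall t, t <= c -> ~ endpoint M (g t) /\ reflects_at M g t &
      [/\ forall t, t <= c -> exists! i, i \in P /\ t \in i,
          forall i, i \in P -> forall t, t \in i -> t <= c &
          forall i, i \in P -> exists2 d', directed_lines d' & runs_along g d' [set` i]]].

(** A ramp that vanishes up to time [c] adds [w] to the velocity afterwards. Legs are appended in
    this way, so that continuity needs no gluing argument. *)
Lemma continuous_bend (g : R -> pt) c (w : pt) : continuous g ->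
  continuous (fun t => g t + Num.max 0 (t - c) *: w).
Proof.
move=> cg t; apply: cvgD; first exact: cg.
apply: cvgZr_tmp; apply: (@continuous_max _ _ (fun=> 0) (fun s => s - c)).
  exact: cvg_cst.
by apply: cvgB; [exact: cvg_id | exact: cvg_cst].
Qed.

Lemma ray_to_line M d c : directed_lines d ->
  (forall t, t <= c -> ~ mirror_union M (Gamma d t)) ->
  ray_to M d c (Gamma d c) d.1.
Proof.
move=> Wd free; exists (Gamma d), [:: `]-oo, c]]; split.
- move=> t; rewrite /Gamma; apply: cvgD; last exact: cvg_cst.
  by apply: cvgZr_tmp; exact: cvg_id.
- by move=> t _; rewrite /Gamma addrAC -scalerDl; congr (_ *: _ + _); lra.
- by exists c, 0 => t _; rewrite subr0.
- move=> t tc; split; first by move/endpoint_mirror_union; exact: free.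
  exists d.1, d.1; split=> //.
  + by near=> s; rewrite /Gamma addrAC -scalerDl; congr (_ *: _ + _); lra.
  + by near=> s; rewrite /Gamma addrAC -scalerDl; congr (_ *: _ + _); lra.
  + by move=> m mM mt; case: (free _ tc); exists m.
- split.
  + move=> t tc; exists `]-oo, c]; split; first by rewrite inE eqxx in_itv /= tc.
    by move=> i [/[!inE] /eqP-> _].
  + by move=> i /[!inE] /eqP-> t; rewrite in_itv.
  + by move=> i _; exists d => //; exists 0 => t _; rewrite subr0.
Unshelve. all: by end_near.
Qed.

Lemma ray_to_step M d c x u tau u' : ray_to M d c x u -> 0 < tau -> enorm u = 1 ->
  (forall s, 0 < s < tau -> ~ mirror_union M (x + s *: u)) ->
  ~ endpoint M (x + tau *: u) ->
  (~ mirror_union M (x + tau *: u) -> u' = u) ->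
  (forall m, m \in M -> segment m (x + tau *: u) -> specular m u u') ->
  ray_to M d (c + tau) (x + tau *: u) u'.
Proof.
move=> [g [P [cg gx [T [t1 gT]] gM [P1 P2 P3]]]] tau0 u1 free nend nref spec.
pose h t := g t + Num.max 0 (t - (c + tau)) *: (u' - u).
have hg t : t <= c + tau -> h t = g t.
  by move=> tc; rewrite /h max_l ?scale0r ?addr0//; lra.
have hx t : c + tau <= t -> h t = x + tau *: u + (t - (c + tau)) *: u'.
  move=> tc; rewrite /h max_r; last lra.
  rewrite gx; last lra.
  by apply: pt_eq; rewrite !coordE; ring.
have gxc t : c <= t -> g t = g c + (t - c) *: u.
  by move=> ct; rewrite (gx t)// (gx c)// subrr scale0r addr0.
exists h, (rcons P `]c, c + tau]); split.
- exact: continuous_bend.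
- exact: hx.
- exists (Num.min T c), t1 => t /=; rewrite in_itv /= le_min => /andP[tT tc].
  by rewrite hg ?gT//=; lra.
- move=> t tct; rewrite hg//; have [tc|ct] := leP t c.
    have [nend' [v [v' [hi ho hn hm]]]] := gM t tc; split => //.
    exists v, v'; rewrite hg//; split=> //.
      near=> s; rewrite !hg//; first by near: s.
      by apply: (@le_trans _ _ t) => //; near: s; exact: nbhs_left_le.
    near=> s; rewrite !hg//; first by near: s.
    by near: s; apply: nbhs_right_le; lra.
  have gt : g t = x + (t - c) *: u by rewrite gx// ltW.
  have [tlt|] := ltP t (c + tau).
    have fr : ~ mirror_union M (g t) by rewrite gt; apply: free; lra.
    split; first by move/endpoint_mirror_union.
    exists u, u; rewrite hg//; split=> //.
    + near=> s; have cs : c < s by near: s; exact: nbhs_left_gt.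
      rewrite !hg; last first.
      * by apply: (@le_trans _ _ t) => //; near: s; exact: nbhs_left_le.
      * exact: ltW.
      * by rewrite gt gx ?ltW// -addrA -scalerDl; congr (_ + _ *: _); lra.
    + near=> s; have ts : t < s by near: s; exact: nbhs_right_gt.
      rewrite !hg//; last by near: s; exact: nbhs_right_le.
      by rewrite gt gx; [rewrite -addrA -scalerDl; congr (_ + _ *: _); lra|lra].
    + by move=> m mM mt; case: fr; exists m.
  move=> tge; have te : t = c + tau by lra.
  have gte : g t = x + tau *: u by rewrite gt te; congr (_ + _ *: _); lra.
  rewrite gte; split=> //; exists u, u'; rewrite hg// gte; split=> //.
  + near=> s; have cs : c < s by near: s; exact: nbhs_left_gt.
    have st : s <= t by near: s; exact: nbhs_left_le.
    rewrite !hg; [|lra|lra].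
    by rewrite gte gx ?ltW// -addrA -scalerDl; congr (_ + _ *: _); lra.
  + near=> s; have ts : t < s by near: s; exact: nbhs_right_gt.
    by rewrite hx; [rewrite hg// gte te|lra].
- split.
  + move=> t tct; have [tc|ct] := leP t c.
      have [i [[iP ti] iu]] := P1 t tc; exists i; split.
        by rewrite mem_rcons inE iP orbT.
      move=> j [/[!mem_rcons] /[!in_cons] /predU1P[->|jP] tj]; last by apply: iu.
      by move: tj; rewrite in_itv /= => /andP[/lt_le_trans/(_ tc)]; rewrite ltxx.
    exists `]c, c + tau]; split.
      by rewrite mem_rcons inE eqxx in_itv /= ct tct.
    move=> j [/[!mem_rcons] /[!in_cons] /predU1P[->//|jP] tj].
    by have := lt_le_trans ct (P2 _ jP _ tj); rewrite ltxx.
  + move=> i /[!mem_rcons] /[!in_cons] /predU1P[->|iP] t.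
      by rewrite in_itv /= => /andP[].
    by move=> /(P2 _ iP) tc; apply: (le_trans tc); rewrite lerDl ltW.
  + move=> i /[!mem_rcons] /[!in_cons] /predU1P[->|iP].
      exists (line_through x u); first exact: directed_line_through.
      exists (c - dot x u) => t /=; rewrite in_itv /= => /andP[ct tct].
      rewrite hg// gx ?ltW// -Gamma_line_through; congr Gamma; lra.
    have [d' Wd' [t' gt']] := P3 _ iP; exists d' => //; exists t' => t /= ti.
    by rewrite hg ?gt'//; apply: le_trans (P2 _ iP _ ti) _; rewrite lerDl ltW.
Unshelve. all: by end_near.
Qed.

Lemma ray_to_escape M d c x u : ray_to M d c x u -> directed_lines d -> enorm u = 1 ->
  (forall s, 0 < s -> ~ mirror_union M (x + s *: u)) ->
  transformation M d (line_through x u).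
Proof.
move=> [g [P [cg gx gd gM [P1 P2 P3]]]] Wd u1 free.
have frg t : c < t -> ~ mirror_union M (g t).
  by move=> ct; rewrite gx ?ltW//; apply: free; lra.
split=> //; first exact: directed_line_through.
exists g; split=> //.
- split=> //.
  + exists (rcons P `]c, +oo[); split.
    * move=> t; have [tc|ct] := leP t c.
        have [i [[iP ti] iu]] := P1 t tc; exists i; split.
          by rewrite mem_rcons inE iP orbT.
        move=> j [/[!mem_rcons] /[!in_cons] /predU1P[->|jP] tj]; last by apply: iu.
        by move: tj; rewrite in_itv /= => /andP[/lt_le_trans/(_ tc)]; rewrite ltxx.
      exists `]c, +oo[; split; first by rewrite mem_rcons inE eqxx in_itv /= ct.
      move=> j [/[!mem_rcons] /[!in_cons] /predU1P[->//|jP] tj].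
      by have := lt_le_trans ct (P2 _ jP _ tj); rewrite ltxx.
    * move=> i /[!mem_rcons] /[!in_cons] /predU1P[->|iP]; last exact: P3.
      exists (line_through x u); first exact: directed_line_through.
      exists (c - dot x u) => t /=; rewrite in_itv /= => /andP[ct _].
      rewrite gx ?ltW// -Gamma_line_through; congr Gamma; lra.
  + move=> t _; have [tc|ct] := leP t c; first by have [_] := gM t tc.
    have gt : g t = x + (t - c) *: u by rewrite gx// ltW.
    exists u, u; split => //.
    * near=> s; have cs : c < s by near: s; exact: nbhs_left_gt.
      by rewrite gt gx ?ltW// -addrA -scalerDl; congr (_ + _ *: _); lra.
    * near=> s; have ts : t < s by near: s; exact: nbhs_right_gt.
      by rewrite gt gx; [rewrite -addrA -scalerDl; congr (_ + _ *: _); lra|lra].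
    * by move=> m mM mt; case: (frg t ct); exists m.
- move=> t; have [tc|ct] := leP t c; first by have [] := gM t tc.
  by move/endpoint_mirror_union; exact: frg.
- exists c, (c - dot x u) => t /=; rewrite in_itv /= andbT => ct.
  rewrite gx// -Gamma_line_through; congr Gamma; lra.
Unshelve. all: by end_near.
Qed.

End Polylines.

(** * Invariance of light rays under rotations *)

Section Rotation.
Context {R : realType}.
Local Notation pt := (R * R)%type.
Implicit Types (M : seq (pt * pt)) (d : pt * pt) (x y u v : pt) (a b s t : R).

Definition rotate a x : pt :=
  (x.1 * cos a - x.2 * sin a, x.1 * sin a + x.2 * cos a).
Definition rotate2 a d : pt * pt := (rotate a d.1, rotate a d.2).

Lemma fst_rotateE a x : (rotate a x).1 = x.1 * cos a - x.2 * sin a. Proof. by []. Qed.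
Lemma snd_rotateE a x : (rotate a x).2 = x.1 * sin a + x.2 * cos a. Proof. by []. Qed.
Definition rotateE := (fst_rotateE, snd_rotateE, @coordE R).

Lemma rotateD a x y : rotate a (x + y) = rotate a x + rotate a y.
Proof. by apply: pt_eq; rewrite !rotateE; ring. Qed.

Lemma rotateZ a s x : rotate a (s *: x) = s *: rotate a x.
Proof. by apply: pt_eq; rewrite !rotateE; ring. Qed.

Lemma rotateN a x : rotate a (- x) = - rotate a x.
Proof. by apply: pt_eq; rewrite !rotateE; ring. Qed.

Lemma rotate_rotate a b x : rotate a (rotate b x) = rotate (a + b) x.
Proof. by apply: pt_eq; rewrite !rotateE sinD cosD; ring. Qed.

Lemma rotate0 x : rotate 0 x = x.
Proof. by apply: pt_eq; rewrite !rotateE cos0 sin0; ring. Qed.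

Lemma rotateK a : cancel (rotate a) (rotate (- a)).
Proof. by move=> x; rewrite rotate_rotate addNr rotate0. Qed.

Lemma dot_rotate a x y : dot (rotate a x) (rotate a y) = dot x y.
Proof.
rewrite /dot !rotateE.
transitivity ((x.1 * y.1 + x.2 * y.2) * (cos a ^+ 2 + sin a ^+ 2)); first by ring.
by rewrite cos2Dsin2 mulr1.
Qed.

Lemma enorm_rotate a x : enorm (rotate a x) = enorm x.
Proof. by rewrite /enorm dot_rotate. Qed.

Lemma continuous_rotate a : continuous (rotate a).
Proof.
have fstc : continuous (fst : pt -> R) by move=> z; exact: cvg_fst.
have sndc : continuous (snd : pt -> R) by move=> z; exact: cvg_snd.
move=> x; apply: (@cvg_pair _ _ _ _ (nbhs (x.1 * cos a - x.2 * sin a))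
  (nbhs (x.1 * sin a + x.2 * cos a))) => /=.
  by apply: cvgB; apply: cvgM; [exact: fstc|exact: cvg_cst|exact: sndc|exact: cvg_cst].
by apply: cvgD; apply: cvgM; [exact: fstc|exact: cvg_cst|exact: sndc|exact: cvg_cst].
Qed.

Lemma segment_rotate a m x : segment (rotate2 a m) (rotate a x) <-> segment m x.
Proof.
split=> -[s s01 E]; exists s => //; last by rewrite -E rotateD !rotateZ.
by apply: (can_inj (rotateK a)); rewrite -E rotateD !rotateZ.
Qed.

Lemma mirror_union_rotate a M x :
  mirror_union (map (rotate2 a) M) (rotate a x) <-> mirror_union M x.
Proof.
split=> -[m mM mx].
  by have /mapP[m' m'M mE] := mM; exists m' => //; apply/(@segment_rotate a); rewrite -mE.
by exists (rotate2 a m); [apply/mapP; exists m | apply/segment_rotate].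
Qed.

Lemma endpoint_rotate a M x : endpoint (map (rotate2 a) M) (rotate a x) -> endpoint M x.
Proof.
move=> [_ /mapP[m mM ->] mx]; exists m => //.
by case: mx => /(can_inj (rotateK a)) ->; [left|right].
Qed.

Lemma specular_rotate a m u v : specular m u v -> specular (rotate2 a m) (rotate a u) (rotate a v).
Proof.
have eE : (rotate2 a m).2 - (rotate2 a m).1 = rotate a (m.2 - m.1) by rewrite rotateD rotateN.
rewrite /specular eE !dot_rotate => -[-> E]; split=> //.
have nE (w : pt) : dot (rotate a w) (- (rotate a (m.2 - m.1)).2, (rotate a (m.2 - m.1)).1) =
    dot w (- (m.2 - m.1).2, (m.2 - m.1).1).
  have -> : (- (rotate a (m.2 - m.1)).2, (rotate a (m.2 - m.1)).1) =
      rotate a (- (m.2 - m.1).2, (m.2 - m.1).1).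
    by apply: pt_eq; rewrite !rotateE /=; ring.
  by rewrite dot_rotate.
by rewrite !nE.
Qed.

Lemma directed_lines_rotate a d : directed_lines d -> directed_lines (rotate2 a d).
Proof. by rewrite /directed_lines /= dot_rotate enorm_rotate. Qed.

Lemma runs_along_rotate a (g : R -> pt) d (I : set R) :
  runs_along g d I -> runs_along (rotate a \o g) (rotate2 a d) I.
Proof. by move=> [t1 H]; exists t1 => t It /=; rewrite H// /Gamma rotateD rotateZ. Qed.

Lemma transformation_rotate a M d d' : transformation M d d' ->
  transformation (map (rotate2 a) M) (rotate2 a d) (rotate2 a d').
Proof.
move=> [Wd Wd' [g [[cg [P [P1 P2]] rg] eg [T gT] [T' gT']]]].
split; [exact: directed_lines_rotate | exact: directed_lines_rotate |].
exists (rotate a \o g); split.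
- split.
  + by move=> t; apply: continuous_comp; [exact: cg | exact: continuous_rotate].
  + exists P; split=> // i iP; have [d0 W0 r0] := P2 i iP.
    exists (rotate2 a d0); [exact: directed_lines_rotate | exact: runs_along_rotate].
  + move=> t _; have [u [u' [hi ho hn hm]]] := rg t (eg t).
    exists (rotate a u), (rotate a u'); split.
    * by near=> s; rewrite /= -rotateZ -rotateD; congr (rotate a _); near: s.
    * by near=> s; rewrite /= -rotateZ -rotateD; congr (rotate a _); near: s.
    * by move=> nM; rewrite hn// => gM; apply: nM; apply/mirror_union_rotate.
    * move=> m /mapP[m' m'M ->] /segment_rotate mt.
      by apply: specular_rotate; exact: hm.
- by move=> t /endpoint_rotate; exact: eg.
- by exists T; exact: runs_along_rotate.
- by exists T'; exact: runs_along_rotate.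
Unshelve. all: by end_near.
Qed.

End Rotation.

(** * Inequalities for a ray between two consecutive teeth *)

Section ToothNumerics.
Context {R : realType}.

Lemma slope_bounds (t : R) (J : nat) : (0 < J)%N -> 2 * `|t| * J%:R < 1 ->
  [/\ t < 1, 0 < J%:R^-1 :> R, 2 * t < J%:R^-1, - (2 * t) < J%:R^-1 &
  J%:R^-1 <= 1 :> R].
Proof.
move=> J0 tJ; have J1 : 1 <= J%:R :> R by rewrite ler1n.
have Ji : 0 < J%:R^-1 :> R by rewrite invr_gt0; lra.
have h : 2 * `|t| < J%:R^-1 by rewrite -[ltRHS]mul1r ltr_pdivlMr//; lra.
have Ji1 : J%:R^-1 <= 1 :> R by rewrite invf_le1; lra.
have := ler_norm t; have := ler_norm (- t); rewrite normrN => h1 h2.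
by split => //; lra.
Qed.

(** Here [f] is the place, in units of [g], where the line reaches the base beyond the foot of tooth
    [k], and [a] is the margin [1 / J]. Solving for the intersections gives the relative heights
    [s1] on tooth [k] and [s2] on tooth [k.+1]; both lie strictly between 0 and 1 because the margin
    exceeds [2 |t|]. *)
Lemma tooth_params (t f a r s1 s2 : R) :
  2 * t < a -> - (2 * t) < a -> a <= 1 -> a <= f <= 1 - a -> 0 < r ->
  (1 - t) * r = 1 -> s1 = f * r -> s2 = (f + t) * r ->
  [/\ 0 < s1 < 1, 0 < s2 < 1, f = (1 - t) * s1, f + t = (1 - t) * s2 &
      s2 = s1 + t * r /\ 1 + s2 = s1 + r].
Proof.
move=> at1 at2 a1 /andP[fa fb] r0 rE s1E s2E.
have u1 : 0 < 1 - t by lra.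
have fE : f = (1 - t) * s1 by rewrite s1E mulrCA rE mulr1.
have ftE : f + t = (1 - t) * s2 by rewrite s2E mulrCA rE mulr1.
have s12 : s2 = s1 + t * r by rewrite s1E s2E mulrDl.
have s10 : 0 < s1 by rewrite s1E mulr_gt0//; lra.
have s20 : 0 < s2 by rewrite s2E mulr_gt0//; lra.
have s11 : s1 < 1 by rewrite -(ltr_pM2l u1) -fE; lra.
have s21 : s2 < 1 by rewrite -(ltr_pM2l u1) -ftE; lra.
split=> //; first by rewrite s10.
  by rewrite s20.
by split=> //; rewrite s12 addrCA; congr (_ + _); rewrite -{1}rE mulrBl mul1r subrK.
Qed.

(** Between the two reflections the height above the base is the convex combination of [s1 * g] and
    [s2 * g] with weight [(1 - t) * s / g], hence stays within the comb. The second bound places the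
    ray strictly between the lines of the two teeth. *)
Lemma between_teeth (t r g s s1 s2 : R) : 0 < r -> (1 - t) * r = 1 -> s2 = s1 + t * r ->
  0 < s1 < 1 -> 0 < s2 < 1 -> 0 < s < g * r ->
  0 < s1 * g + s * t < g /\ 0 < (1 - t) * s < g.
Proof.
move=> r0 rE s12 /andP[s10 s11] /andP[s20 s21] /andP[s0 sg].
have u1 : 0 < 1 - t by rewrite -(pmulr_lgt0 _ r0) rE.
have us : (1 - t) * s < g.
  have : (1 - t) * s < (1 - t) * (g * r) by rewrite ltr_pM2l.
  by rewrite mulrCA rE mulr1.
have us0 : 0 < (1 - t) * s by rewrite mulr_gt0.
split; last by rewrite us us0.
have -> : s1 * g + s * t = s1 * (g - (1 - t) * s) + s2 * ((1 - t) * s).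
  transitivity (s1 * g + (((1 - t) * r) * s) * t); first by rewrite rE mul1r.
  by rewrite s12; ring.
have a0 : 0 < g - (1 - t) * s by rewrite subr_gt0.
have h1 : 0 < s1 * (g - (1 - t) * s) by rewrite mulr_gt0.
have h2 : 0 < s2 * ((1 - t) * s) by rewrite mulr_gt0.
have h3 : s1 * (g - (1 - t) * s) < g - (1 - t) * s by rewrite gtr_pMl.
have h4 : s2 * ((1 - t) * s) < (1 - t) * s by rewrite gtr_pMl.
by clear -h1 h2 h3 h4; lra.
Qed.

(** After the second reflection the ray turns back towards the line of tooth [k]. Up to the top of
    the comb it covers at most [g - (a + 2 * t) * g] of the gap [g], with [f] in the role of [a];
    the margin of [2 |t|] is needed for this. *)
Lemma above_tooth (t g s s2 a : R) : t < 1 -> 0 < g -> 0 < a + 2 * t -> a + t = (1 - t) * s2 ->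
  0 < s -> s2 * g + s <= g -> 0 < (1 - t) * s < g.
Proof.
move=> t1 g0 at0 ftE s0 sg.
have u1 : 0 < 1 - t by lra.
rewrite mulr_gt0//=.
have us : (1 - t) * s <= (1 - t) * (g - s2 * g) by rewrite ler_pM2l//; lra.
have us2 : (1 - t) * (g - s2 * g) = g - (a + 2 * t) * g.
  by rewrite mulrBr mulrA -ftE; ring.
have fg : 0 < (a + 2 * t) * g by rewrite mulr_gt0.
lra.
Qed.

End ToothNumerics.

(** * Combs of mirrors *)

Section Comb.
Context {R : realType}.
Local Notation pt := (R * R)%type.
Implicit Types (M : seq (pt * pt)) (d : pt * pt) (q z : pt) (k : nat).

(** On tooth [k] the form [(x - q.1) - (y - q.2)] is constant, equal to [k * g]. Inside the strip of
    a comb the teeth are avoided by keeping this form away from the multiples of [g]. *)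
Definition tooth (g : R) q k : pt * pt :=
  ((q.1 + k%:R * g, q.2), (q.1 + (k%:R + 1) * g, q.2 + g)).

Definition comb (g : R) (Nc : nat) (L : seq pt) : seq (pt * pt) :=
  [seq tooth g q k | q <- L, k <- iota 0 Nc].

Lemma mem_comb g Nc L m : m \in comb g Nc L <->
  exists q k, [/\ q \in L, (k < Nc)%N & m = tooth g q k].
Proof.
split; first by move=> /allpairsP[[q k] /= [qL]]; rewrite mem_iota => kN ->; exists q, k.
by move=> [q [k [qL kN ->]]]; apply/allpairsP; exists (q, k); split; rewrite //= mem_iota.
Qed.

Lemma segment_tooth g q k z : segment (tooth g q k) z <->
  exists2 s, 0 <= s <= 1 & z = (q.1 + (k%:R + s) * g, q.2 + s * g).
Proof.
split=> [[s /=]|[s s01 ->]].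
  rewrite in_itv /= => s01 <-; exists s => //.
  by apply: pt_eq; rewrite !coordE /=; ring.
exists s; rewrite //= ?in_itv //=.
by apply: pt_eq; rewrite !coordE /=; ring.
Qed.

Definition outside (g : R) q z : Prop := z.2 < q.2 \/ q.2 + g < z.2.

(* The rays of interest are almost parallel to the second axis: the line
   [x = p + t y] has slope [t] and intercept [p]. *)
Definition intercept (t : R) z : R := z.1 - t * z.2.

(* A line of slope [t] and x-intercept [p] reaches the base of the comb [q] at
   [q.1 + z * g].  It passes beside the comb in the first case; in the second
   one it is reflected exactly twice, by the teeth [k] and [k.+1]. *)
Fixpoint passes (g t : R) (Nc J : nat) (p : R) (L : seq pt) : Prop :=
  if L is q :: L' then
    let z := (p + t * q.2 - q.1) / g in
    ((z < 0 \/ Nc%:R + 1 < z) /\ passes g t Nc J p L') \/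
    (exists k f, [/\ z = k%:R + f, (k.+1 < Nc)%N, J%:R^-1 <= f <= 1 - J%:R^-1 &
       passes g t Nc J (p + g * (1 + t)) L'])
  else True.

Section Crossing.
Variables (M : seq (pt * pt)) (L : seq pt) (d : pt * pt).
Variables (g t p0 D : R) (Nc J : nat).
Hypothesis g0 : 0 < g.
Hypothesis J0 : (0 < J)%N.
Hypothesis tJ : 2 * `|t| * J%:R < 1.
Hypothesis ML : forall q k, q \in L -> (k < Nc)%N -> tooth g q k \in M.
(** The mirrors of the other copies enter only through the second alternative: they keep away from
    the lines of slope [t] with intercept within [D] of [p0], among which the ray stays in spite of
    its displacements. *)
Hypothesis LM : forall m, m \in M ->
  (exists q k, [/\ q \in L, (k < Nc)%N & m = tooth g q k]) \/
  (forall z, segment m z -> D < `|intercept t z - p0|).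

Let nu : R := (Num.sqrt (1 + t ^+ 2))^-1.
Let u : pt := nu *: (t, 1).
Let u' : pt := nu *: (1, t).

Let sq0 : 0 < 1 + t ^+ 2.
Proof. by rewrite ltr_pwDl// sqr_ge0. Qed.

Let nu0 : 0 < nu.
Proof. by rewrite invr_gt0 sqrtr_gt0. Qed.

Let nu2 : nu ^+ 2 * (1 + t ^+ 2) = 1.
Proof. by rewrite exprVn sqr_sqrtr ?ltW// mulVf// gt_eqF. Qed.

Lemma dot_slope_dir : dot u u = 1.
Proof. by rewrite /dot /u !coordE /= -[RHS]nu2; ring. Qed.

Lemma enorm_slope_dir : enorm u = 1.
Proof. by rewrite /enorm dot_slope_dir sqrtr1. Qed.

Lemma enorm_swapped_dir : enorm u' = 1.
Proof. by rewrite /enorm (_ : dot u' u' = 1) ?sqrtr1// /dot /u' !coordE /= -[RHS]nu2; ring. Qed.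

Let ts := slope_bounds J0 tJ.

Lemma free_point z : `|intercept t z - p0| <= D ->
  (forall q, q \in L -> outside g q z \/
     forall k, (k < Nc)%N -> z.1 - q.1 - (z.2 - q.2) != k%:R * g) ->
  ~ mirror_union M z.
Proof.
move=> zD zL [m mM mz]; have [[q [k [qL kN mE]]]|H] := LM mM; last first.
  by have := lt_le_trans (H z mz) zD; rewrite ltxx.
move: mz; rewrite mE => /segment_tooth[s /andP[s0 s1] zE].
case: (zL q qL) => [|/(_ k kN)].
  have /andP[sg0 sg1] : 0 <= s * g <= g by rewrite mulr_ge0 ?ger_pMl// ltW.
  by rewrite /outside zE /= gtrDl ltrD2l !ltNge sg0 sg1 => -[].
by rewrite zE /= => /eqP; apply; ring.
Qed.

Lemma hit_tooth q k s z : q \in L -> (k < Nc)%N -> 0 < s < 1 ->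
  z = (q.1 + (k%:R + s) * g, q.2 + s * g) -> `|intercept t z - p0| <= D ->
  (forall q', q' \in L -> q' = q \/ outside g q' z) ->
  [/\ forall m, m \in M -> segment m z -> m = tooth g q k, mirror_union M z &
      ~ endpoint M z].
Proof.
move=> qL kN s01 zE zD zL.
have uniq_m m : m \in M -> segment m z -> m = tooth g q k.
  move=> mM mz; have [[q' [k' [qL' kN' mE]]]|H] := LM mM; last first.
    by have := lt_le_trans (H z mz) zD; rewrite ltxx.
  move: mz; rewrite mE => /segment_tooth[s' s01' zE'].
  have /andP[sg0 sg1] : 0 <= s' * g <= g.
    by case/andP: s01' => ? ?; rewrite mulr_ge0 ?ger_pMl// ltW.
  case: (zL _ qL') => [qq|]; last by rewrite /outside zE' /= gtrDl ltrD2l !ltNge sg0 sg1 => -[].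
  subst q'; move: zE'; rewrite zE => -[/addrI e1 /addrI e2].
  have ss : s = s' by apply: (mulIf (lt0r_neq0 g0)).
  subst s'; have kk : k%:R = k'%:R :> R.
    by move/(mulIf (lt0r_neq0 g0)): e1 => /addIr.
  by move/eqP: kk; rewrite eqr_nat => /eqP->.
split => //.
  exists (tooth g q k); first exact: ML.
  by apply/segment_tooth; exists s => //; case/andP: s01 => ? ?; rewrite !ltW.
move=> [m mM mz].
have /(uniq_m _ mM) mE : segment m z.
  case: mz => ->; [exists 0|exists 1] => //=; rewrite ?in_itv /= ?lexx ?ler01//.
    by rewrite subr0 scale1r scale0r addr0.
  by rewrite subrr scale1r scale0r add0r.
have /andP[sg0 sg1] : 0 < s * g < g by case/andP: s01 => ? ?; rewrite mulr_gt0 ?gtr_pMl.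
move: mz; rewrite mE zE /tooth /= => -[] [_].
  by move=> /(canRL (addKr _)); rewrite addNr => E; rewrite E ltxx in sg0.
by move=> /addrI E; rewrite E ltxx in sg1.
Qed.

(* The teeth bisect the axes, so that a reflection swaps the coordinates of the
   velocity. *)
Lemma specular_tooth q k : specular (tooth g q k) u u' /\ specular (tooth g q k) u' u.
Proof.
by split; split; rewrite /dot /tooth /u /u' !coordE /=; ring.
Qed.

Lemma ray_to_advance c x v (w : pt) sigma : v = nu *: w -> enorm v = 1 -> 0 < sigma ->
  ray_to M d c x v ->
  (forall s, 0 < s <= sigma -> ~ mirror_union M (x + s *: w)) ->
  exists c', ray_to M d c' (x + sigma *: w) v.
Proof.
move=> vE v1 s0 rx free; exists (c + sigma / nu).
have E s : x + (s / nu) *: v = x + s *: w.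
  by rewrite vE scalerA divfK// gt_eqF.
rewrite -(E sigma); have fe : ~ mirror_union M (x + (sigma / nu) *: v).
  by rewrite E; apply: free; rewrite s0 lexx.
apply: ray_to_step => //.
- exact: divr_gt0.
- move=> s /andP[s1 s2]; have -> : s = (s * nu) / nu by rewrite mulfK// gt_eqF.
  by rewrite E; apply: free; rewrite mulr_gt0//= -ler_pdivlMr// ltW.
- by move/endpoint_mirror_union.
- by move=> m mM mx; case: fe; exists m.
Qed.

Lemma ray_to_reflect c x v v' (w : pt) sigma q k s : v = nu *: w -> enorm v = 1 ->
  0 < sigma -> ray_to M d c x v ->
  (forall s, 0 < s < sigma -> ~ mirror_union M (x + s *: w)) ->
  q \in L -> (k < Nc)%N -> 0 < s < 1 ->
  x + sigma *: w = (q.1 + (k%:R + s) * g, q.2 + s * g) ->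
  `|intercept t (x + sigma *: w) - p0| <= D ->
  (forall q', q' \in L -> q' = q \/ outside g q' (x + sigma *: w)) ->
  specular (tooth g q k) v v' ->
  exists c', ray_to M d c' (x + sigma *: w) v'.
Proof.
move=> vE v1 s0 rx free qL kN s01 xE xD xL sp; exists (c + sigma / nu).
have [um mz nez] := hit_tooth qL kN s01 xE xD xL.
have E r : x + (r / nu) *: v = x + r *: w.
  by rewrite vE scalerA divfK// gt_eqF.
rewrite -(E sigma); apply: (ray_to_step rx) => //.
- exact: divr_gt0.
- move=> r /andP[r1 r2]; have -> : r = (r * nu) / nu by rewrite mulfK// gt_eqF.
  by rewrite E; apply: free; rewrite mulr_gt0//= -ltr_pdivlMr.
- by rewrite E.
- by rewrite E.
- by move=> m mM; rewrite E => /(um _ mM) ->.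
Qed.

Let tooth_gap k k' (xi : R) : k%:R * g < xi < (k%:R + 1) * g -> xi != k'%:R * g.
Proof.
move=> /andP[h1 h2]; apply/eqP => E; move: h1 h2; rewrite E !ltr_pM2r// natr1 !ltr_nat.
by rewrite ltnS => h1 h2; move: (leq_trans h1 h2); rewrite ltnn.
Qed.

Let outside_zone q q' (y : R) z : q.2 + 4 * g < q'.2 \/ q'.2 + g < y ->
  z.2 < q.2 + 4 * g -> y <= z.2 -> outside g q' z.
Proof.
rewrite /outside => -[h|h] h1 h2; [left|right].
  exact: lt_trans h.
exact: lt_le_trans h2.
Qed.

Lemma free_in_zone q z : `|intercept t z - p0| <= D ->
  (forall q', q' \in L -> q' = q \/ outside g q' z) ->
  outside g q z \/
    (exists k, k%:R * g < z.1 - q.1 - (z.2 - q.2) < (k%:R + 1) * g) ->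
  ~ mirror_union M z.
Proof.
move=> zD zq qz; apply: free_point => // q' /zq[->|]; last by left.
by case: qz => [|[k kz]]; [left|right=> k' _; exact: tooth_gap kz].
Qed.

Lemma pass_beside q (p y0 c : R) : q \in L -> y0 < q.2 ->
  (forall q', q' \in L -> q' = q \/ (q.2 + 4 * g < q'.2 \/ q'.2 + g < y0)) ->
  `|p - p0| <= D ->
  (p + t * q.2 - q.1) / g < 0 \/ Nc%:R + 1 < (p + t * q.2 - q.1) / g ->
  ray_to M d c (p + t * y0, y0) u ->
  exists c', ray_to M d c' (p + t * (q.2 + 2 * g), q.2 + 2 * g) u.
Proof.
move=> qL yq qsep pD zout rx.
have [t1 Ji Jt Jt' Ji1] := ts.
have tg : t * g < g by rewrite gtr_pMl.
have tg' : - g <= 2 * (t * g).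
  have -> : 2 * (t * g) = (2 * t) * g by ring.
  rewrite -mulN1r ler_wpM2r ?ltW//; lra.
have E s : (p + t * y0, y0) + s *: (t, 1) = (p + t * (y0 + s), y0 + s) :> pt.
  by apply: pt_eq; rewrite !coordE /=; ring.
have s0 : 0 < q.2 + 2 * g - y0 by lra.
have [|c' rc'] := @ray_to_advance c _ u (t, 1) _ erefl enorm_slope_dir s0 rx.
  move=> s /andP[s1 s2]; rewrite E; apply: free_point.
    by rewrite /intercept /= (_ : p + _ - _ = p)//; ring.
  move=> q' qL'; have [->|qq'] := qsep _ qL'; last first.
    by left; apply: outside_zone qq' _ _ => /=; lra.
  case: (ltP (y0 + s) q.2) => [h|h1]; first by left; left.
  case: (ltP (q.2 + g) (y0 + s)) => [h|h2]; first by left; right.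
  right=> k kN /=; apply/eqP => Ek.
  pose e := y0 + s - q.2; have e0 : 0 <= e by rewrite /e; lra.
  have eg : e <= g by rewrite /e; lra.
  have te : t * e <= e by rewrite ler_piMl// ltW.
  have te' : - (1 / 2) * e <= t * e by rewrite ler_wpM2r//; lra.
  have Ez : p + t * q.2 - q.1 = (p + t * q.2 - q.1) / g * g by rewrite divfK ?gt_eqF.
  have Ek' : (p + t * q.2 - q.1) / g * g + t * e - e = k%:R * g.
    by rewrite -Ez -Ek /e; ring.
  have kg : 0 <= k%:R * g by rewrite mulr_ge0 ?ler0n ?ltW.
  case: zout => zl.
    have : (p + t * q.2 - q.1) / g * g < 0 by rewrite nmulr_rlt0.
    lra.
  have : (Nc%:R + 1) * g < (p + t * q.2 - q.1) / g * g by rewrite ltr_pM2r.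
  have : (k%:R + 1) * g <= Nc%:R * g by rewrite ler_pM2r// natr1 ler_nat.
  rewrite !mulrDl; lra.
by exists c'; move: rc'; rewrite E; congr (ray_to _ _ _ (_, _) _); [congr (_ + _ * _)|]; ring.
Qed.

End Crossing.
End Comb.

Section TwoReflections.
Context {R : realType}.
Local Notation pt := (R * R)%type.
Implicit Types (q z : pt) (k : nat).
Variables (M : seq (pt * pt)) (L : seq pt) (d : pt * pt).
Variables (g t p0 D : R) (Nc J : nat).
Hypothesis g0 : 0 < g.
Hypothesis J0 : (0 < J)%N.
Hypothesis tJ : 2 * `|t| * J%:R < 1.
Hypothesis ML : forall q k, q \in L -> (k < Nc)%N -> tooth g q k \in M.
Hypothesis LM : forall m, m \in M ->
  (exists q k, [/\ q \in L, (k < Nc)%N & m = tooth g q k]) \/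
  (forall z, segment m z -> D < `|intercept t z - p0|).

Let nu : R := (Num.sqrt (1 + t ^+ 2))^-1.
Let u : pt := nu *: (t, 1).
Let u' : pt := nu *: (1, t).

Let LMf := @free_in_zone R M L g t p0 D Nc g0 LM.

Section OneComb.
Variables (q : pt) (p y0 f : R) (k : nat).
Hypothesis qL : q \in L.
Hypothesis yq : y0 < q.2.
Hypothesis qsep : forall q', q' \in L ->
  q' = q \/ (q.2 + 4 * g < q'.2 \/ q'.2 + g < y0).
Hypothesis pD : `|p - p0| + 2 * g <= D.
Hypothesis pE : p + t * q.2 = q.1 + (k%:R + f) * g.
Hypothesis kN : (k.+1 < Nc)%N.
Variables (r s1 s2 : R).
Hypothesis r0 : 0 < r.
Hypothesis rE : (1 - t) * r = 1.
Hypothesis s1E : s1 = f * r.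
Hypothesis s2E : s2 = (f + t) * r.
Hypothesis f01 : J%:R^-1 <= f <= 1 - J%:R^-1.

(** [X1] and [X2] are the points of reflection on teeth [k] and [k.+1]; the three legs run along
    [(t, 1)], [(1, t)] and [(t, 1)]. *)
Let X0 : pt := (p + t * y0, y0).
Let X1 : pt := (q.1 + (k%:R + s1) * g, q.2 + s1 * g).
Let X2 : pt := (q.1 + (k.+1%:R + s2) * g, q.2 + s2 * g).

Let ts := slope_bounds J0 tJ.

Let params : [/\ 0 < s1 < 1, 0 < s2 < 1, f = (1 - t) * s1, f + t = (1 - t) * s2 &
      s2 = s1 + t * r /\ 1 + s2 = s1 + r].
Proof. by have [t1 Ji Jt Jt' Ji1] := ts; exact: tooth_params Jt Jt' Ji1 f01 r0 rE s1E s2E. Qed.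

Let in_zone z : y0 <= z.2 -> z.2 < q.2 + 2 * g ->
  forall q', q' \in L -> q' = q \/ outside g q' z.
Proof.
move=> yz zq q' qL'; have [->|[h|h]] := qsep qL'; first by left.
  by right; left; apply: lt_trans h; apply: (lt_le_trans zq); rewrite lerD2l ler_pM2r//; lra.
by right; right; exact: lt_le_trans yz.
Qed.

Let zone_y a : 0 <= a <= g -> y0 <= q.2 + a /\ q.2 + a < q.2 + 2 * g.
Proof. by move=> /andP[a0 ag]; have := yq; have := g0; split; lra. Qed.

Let sg s : 0 < s < 1 -> 0 < s * g < g.
Proof. by move=> /andP[s0 s1']; rewrite mulr_gt0 ?gtr_pMl. Qed.

Let near0 z : intercept t z = p -> `|intercept t z - p0| <= D.
Proof. by move=> ->; have := pD; have := g0; lra. Qed.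

Let near1 z e : intercept t z = p + e -> 0 <= e <= 2 * g -> `|intercept t z - p0| <= D.
Proof.
move=> -> /andP[e0 eg]; apply: le_trans pD; rewrite addrAC.
by apply: le_trans (ler_normD _ _) _; rewrite lerD2l ger0_norm.
Qed.

Let shift01 : 0 <= g * (1 + t) <= 2 * g.
Proof.
have [t1 _ _ Jt' Ji1] := ts; have h : 0 <= 1 + t by lra.
apply/andP; split; first by rewrite mulr_ge0// ltW.
by rewrite mulrC ler_pM2r//; lra.
Qed.

Let leg1E s : X0 + s *: (t, 1) = (p + t * (y0 + s), y0 + s).
Proof. by apply: pt_eq; rewrite !coordE /=; ring. Qed.

Let X1p : intercept t X1 = p.
Proof.
have [_ _ fE _ _] := params.
transitivity (q.1 + (k%:R + (1 - t) * s1) * g - t * q.2).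
  by rewrite /intercept /X1 /=; ring.
by rewrite -fE -pE; ring.
Qed.

Let X1E : X0 + (q.2 + s1 * g - y0) *: (t, 1) = X1.
Proof.
have [_ _ fE _ _] := params.
rewrite leg1E; apply: pt_eq => /=; last by ring.
transitivity (p + t * q.2 + t * s1 * g); first by ring.
by rewrite pE {1}fE; ring.
Qed.

Let X2E : X1 + (g * r) *: (1, t) = X2.
Proof.
have [_ _ _ _ [s12 r12]] := params.
apply: pt_eq; rewrite !coordE /=; last by rewrite s12; ring.
transitivity (q.1 + (k%:R + (s1 + r)) * g); first by ring.
by rewrite -r12 -natr1; ring.
Qed.

(** Along [(1, t)] the intercept grows at the rate [1 - t ^+ 2], and the leg has parameter length
    [g * r] with [(1 - t) * r = 1]; hence the displacement [g * (1 + t)]. *)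
Let X2p : intercept t X2 = p + g * (1 + t).
Proof.
rewrite -X2E /intercept !coordE /=.
transitivity (intercept t X1 + g * (1 + t) * ((1 - t) * r)).
  by rewrite /intercept /X1 /=; ring.
by rewrite X1p rE mulr1.
Qed.

Let X3E : X2 + (2 * g - s2 * g) *: (t, 1) =
  (p + g * (1 + t) + t * (q.2 + 2 * g), q.2 + 2 * g).
Proof.
have [_ _ _ ftE _] := params.
apply: pt_eq; rewrite !coordE /=; last by ring.
transitivity (q.1 + (k%:R + 1 + ((1 - t) * s2 + 2 * t)) * g).
  by rewrite -natr1; ring.
rewrite -ftE; transitivity (p + t * q.2 + (1 + 3 * t) * g); last by ring.
by rewrite pE; ring.
Qed.

Let free_leg1 s : 0 < s < q.2 + s1 * g - y0 -> ~ mirror_union M (X0 + s *: (t, 1)).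
Proof.
have [s101 _ fE _ _] := params; have /andP[sg0 sg1] := sg s101.
have [t1 Ji _ _ _] := ts.
have u1 : 0 < 1 - t by lra.
move=> /andP[sa sb]; rewrite leg1E; apply: (LMf (q := q)).
- by apply: near0; rewrite /intercept /=; ring.
- by apply: in_zone => /=; lra.
case: (ltP (y0 + s) q.2) => [h|h1]; first by left; left.
right; exists k; pose e := y0 + s - q.2; have e0 : 0 <= e by rewrite /e subr_ge0.
have -> : (p + t * (y0 + s), y0 + s).1 - q.1 - ((p + t * (y0 + s), y0 + s).2 - q.2)
    = k%:R * g + (f * g - (1 - t) * e).
  transitivity (p + t * q.2 - q.1 - (1 - t) * e); first by rewrite /e /=; ring.
  by rewrite pE; ring.
have ue : 0 <= (1 - t) * e by rewrite mulr_ge0// ltW.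
have eb : (1 - t) * e < f * g by rewrite fE -mulrA ltr_pM2l// /e; lra.
have fg : f * g < g by case/andP: f01 => _ f1; rewrite gtr_pMl//; lra.
by rewrite mulrDl; apply/andP; split; lra.
Qed.

Let free_leg2 s : 0 < s < g * r -> ~ mirror_union M (X1 + s *: (1, t)).
Proof.
move=> sb; have [s101 s201 _ _ [s12 _]] := params.
have [yb kb] := between_teeth r0 rE s12 s101 s201 sb.
have [_ _ _ Jt' Ji1] := ts.
have Es : X1 + s *: (1, t) = (q.1 + (k%:R + s1) * g + s, q.2 + (s1 * g + s * t)).
  by apply: pt_eq; rewrite !coordE /=; ring.
case/andP: (kb) => kb0 kb1; case/andP: (yb) => yb0 yb1.
have [z1 z2] : y0 <= q.2 + (s1 * g + s * t) /\ q.2 + (s1 * g + s * t) < q.2 + 2 * g.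
  by apply: zone_y; rewrite !ltW.
rewrite Es; apply: (LMf (q := q)).
- apply: (@near1 _ ((1 - t) * s * (1 + t))).
    by rewrite -X1p /intercept /X1 /=; ring.
  have t0 : 0 < 1 + t by lra.
  case/andP: shift01 => _ sh; apply/andP; split; first by rewrite mulr_ge0// ltW.
  by apply: le_trans sh; rewrite ler_pM2r// ltW.
- exact: in_zone.
- right; exists k.
  have -> : (q.1 + (k%:R + s1) * g + s, q.2 + (s1 * g + s * t)).1 - q.1 -
      ((q.1 + (k%:R + s1) * g + s, q.2 + (s1 * g + s * t)).2 - q.2) =
        k%:R * g + (1 - t) * s by rewrite /=; ring.
  by rewrite mulrDl; apply/andP; split; lra.
Qed.

Let free_leg3 s : 0 < s <= 2 * g - s2 * g -> ~ mirror_union M (X2 + s *: (t, 1)).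
Proof.
move=> /andP[sa sb]; have [_ s201 _ ftE _] := params.
have /andP[sg0 sg1] := sg s201.
have [t1 _ _ Jt' _] := ts.
have Es : X2 + s *: (t, 1) = (q.1 + (k.+1%:R + s2) * g + s * t, q.2 + (s2 * g + s)).
  by apply: pt_eq; rewrite !coordE /=; ring.
rewrite Es; case: (ltP (q.2 + g) (q.2 + (s2 * g + s))) => [h|h2].
  apply: (free_point g0 LM).
    by apply: (@near1 _ (g * (1 + t))) => //; rewrite -X2p /intercept /X2 /=; ring.
  move=> q' qL'; left; have [->|[h'|h']] := qsep qL'; first by right.
    by left; rewrite /=; apply: le_lt_trans h'; rewrite lerD2l; have := g0; lra.
  by right; rewrite /=; apply: (lt_trans h'); apply: (lt_trans yq); have := g0; lra.
have [z1 z2] : y0 <= q.2 + (s2 * g + s) /\ q.2 + (s2 * g + s) < q.2 + 2 * g.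
  by apply: zone_y; apply/andP; split; lra.
apply: (LMf (q := q)).
- by apply: (@near1 _ (g * (1 + t))) => //; rewrite -X2p /intercept /X2 /=; ring.
- exact: in_zone.
right; exists k.
have -> : (q.1 + (k.+1%:R + s2) * g + s * t, q.2 + (s2 * g + s)).1 - q.1 -
    ((q.1 + (k.+1%:R + s2) * g + s * t, q.2 + (s2 * g + s)).2 - q.2) =
      (k%:R + 1) * g - (1 - t) * s by rewrite /= -natr1; ring.
have ft0 : 0 < f + 2 * t by case/andP: f01 => f1 _; lra.
have sgs : s2 * g + s <= g by lra.
have /andP[h3 h4] := above_tooth t1 g0 ft0 ftE sa sgs.
by rewrite mulrDl; apply/andP; split; lra.
Qed.

(** The first reflection point still lies on the incoming line. This is the source of condition (i),
    which concerns the straight line and not the light ray. *)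
Lemma hits_at_intercept : exists2 z, mirror_union M z & intercept t z = p.
Proof.
have [s101 _ _ _ _] := params; exists X1 => //.
exists (tooth g q k); first by apply: ML => //; exact: ltnW.
by apply/segment_tooth; exists s1 => //; case/andP: s101 => *; rewrite !ltW.
Qed.

Lemma pass_through c : ray_to M d c X0 u -> exists c',
  ray_to M d c' (p + g * (1 + t) + t * (q.2 + 2 * g), q.2 + 2 * g) u.
Proof.
move=> rx; have [s101 s201 _ _ [s12 _]] := params.
have /andP[sg0 sg1] := sg s101; have /andP[sg0' sg1'] := sg s201.
have kN' : (k < Nc)%N by exact: ltnW.
have zX1 q' : q' \in L -> q' = q \/ outside g q' X1.
  by have [z1 z2] := @zone_y (s1 * g) ltac:(by rewrite !ltW); exact: in_zone.
have zX2 q' : q' \in L -> q' = q \/ outside g q' X2.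
  by have [z1 z2] := @zone_y (s2 * g) ltac:(by rewrite !ltW); exact: in_zone.
have [c1 rx1] : exists c', ray_to M d c' X1 u'.
  rewrite -X1E; apply: (ray_to_reflect g0 ML LM erefl (enorm_slope_dir t) _ rx
    free_leg1 qL kN' s101 X1E); rewrite ?X1E.
  - by rewrite subr_gt0; apply: (lt_trans yq); rewrite ltrDl.
  - exact: near0.
  - exact: zX1.
  - by have [] := specular_tooth g t q k.
have [c2 rx2] : exists c', ray_to M d c' X2 u.
  rewrite -X2E; apply: (ray_to_reflect g0 ML LM erefl (enorm_swapped_dir t) _ rx1
    free_leg2 qL kN s201 X2E); rewrite ?X2E.
  - exact: mulr_gt0.
  - exact: near1 X2p _.
  - exact: zX2.
  - by have [] := specular_tooth g t q k.+1.
rewrite -X3E; apply: (ray_to_advance erefl (enorm_slope_dir t) _ rx2 free_leg3).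
by rewrite subr_gt0; apply: (lt_trans sg1'); rewrite ltr_pMl// ltr1n.
Qed.

End OneComb.
End TwoReflections.

Section CombPath.
Context {R : realType}.
Local Notation pt := (R * R)%type.
Implicit Types (q z : pt) (k : nat).

Definition slope_dir (t : R) : pt := (Num.sqrt (1 + t ^+ 2))^-1 *: (t, 1).

Lemma line_through_intercept (t p y : R) :
  line_through (p + t * y, y) (slope_dir t) = line_through (p, 0) (slope_dir t).
Proof.
have d1 := dot_slope_dir t; rewrite -/(slope_dir t) in d1.
have s0 : Num.sqrt (1 + t ^+ 2) != 0 by rewrite gt_eqF// sqrtr_gt0 ltr_pwDl// sqr_ge0.
have E : (p + t * y, y) = (p, 0) + (y * Num.sqrt (1 + t ^+ 2)) *: slope_dir t :> pt.
  rewrite /slope_dir scalerA mulfK//; apply: pt_eq; rewrite !coordE /=; ring.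
rewrite /line_through E; congr pair.
set a := y * _; set v := slope_dir t in d1 *.
have -> : dot ((p, 0) + a *: v) v = dot (p, 0) v + a.
  by rewrite -[X in _ = _ + X]mulr1 -d1 /dot !coordE; ring.
by rewrite scalerDl opprD addrACA subrr addr0.
Qed.

Lemma pairwise_cons_in (T : eqType) (r : rel T) x s y :
  pairwise r (x :: s) -> y \in s -> r x y.
Proof. by move=> /= /andP[/allP h _] /h. Qed.

Section Path.
Variables (M : seq (pt * pt)) (L : seq pt).
Variables (g t p0 D : R) (Nc J : nat).
Hypothesis g0 : 0 < g.
Hypothesis J0 : (0 < J)%N.
Hypothesis tJ : 2 * `|t| * J%:R < 1.
Hypothesis Lsep : pairwise (fun q q' => q.2 + 4 * g < q'.2) L.
Hypothesis ML : forall q k, q \in L -> (k < Nc)%N -> tooth g q k \in M.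
Hypothesis LM : forall m, m \in M ->
  (exists q k, [/\ q \in L, (k < Nc)%N & m = tooth g q k]) \/
  (forall z, segment m z -> D < `|intercept t z - p0|).

Let u := slope_dir t.

Let t1 : `|t| < 1 / 2.
Proof.
have J1 : 1 <= J%:R :> R by rewrite ler1n.
have h : 2 * `|t| * 1 <= 2 * `|t| * J%:R by apply: ler_wpM2l => //; exact: mulr_ge0.
by move: tJ h; lra.
Qed.

(** Induction on the combs still ahead, which are met in the order of their heights. The distance
    hypothesis is a budget: every comb may consume [2 * g] of it, so that the displaced ray never
    comes near the mirrors of other copies. *)
Let comb_path_suffix d L' p y0 c : {subset L' <= L} -> 
  pairwise (fun q q' : pt => q.2 + 4 * g < q'.2) L' -> (forall q, q \in L' -> y0 < q.2) ->
  (forall q, q \in L -> q \in L' \/ q.2 + g < y0) -> directed_lines d ->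
  `|p - p0| + 2 * g * (size L')%:R <= D ->
  passes g t Nc J p L' -> ray_to M d c (p + t * y0, y0) u ->
  exists2 p', transformation M d (line_through (p', 0) u) &
              `|p' - p| <= 2 * g * (size L')%:R.
Proof.
elim: L' p y0 c => [|q L' IH] p y0 c sub sep above below Wd pD /= hp rx.
  exists p; last by rewrite subrr normr0 mulr0.
  rewrite -(line_through_intercept t p y0); apply: (ray_to_escape rx) => //.
    exact: enorm_slope_dir.
  move=> s s0; apply: (free_point g0 LM); last first.
    move=> q qL; left; have [//|h] := below q qL; right; rewrite /u /slope_dir !coordE /=.
    apply: (lt_trans h); rewrite ltrDl mulr1 mulr_gt0// invr_gt0.
    by rewrite sqrtr_gt0 ltr_pwDl// sqr_ge0.
  rewrite (_ : intercept t _ = p); first by move: pD; rewrite /= mulr0 addr0.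
  by rewrite /intercept /u /slope_dir !coordE /=; ring.
have qL : q \in L by apply: sub; rewrite mem_head.
have sepq q' : q' \in L' -> q.2 + 4 * g < q'.2 by exact: pairwise_cons_in sep.
have yq : y0 < q.2 by apply: above; rewrite mem_head.
have qsep q' : q' \in L -> q' = q \/ (q.2 + 4 * g < q'.2 \/ q'.2 + g < y0).
  move=> /below[|]; last by right; right.
  by rewrite in_cons => /predU1P[->|/sepq]; [left|right; left].
have sub' : {subset L' <= L} by move=> q' qL'; apply: sub; rewrite in_cons qL' orbT.
have sep' : pairwise (fun q q' : pt => q.2 + 4 * g < q'.2) L' by move: sep => /= /andP[].
have above' q' : q' \in L' -> q.2 + 2 * g < q'.2.
  by move=> /sepq; apply: lt_trans; rewrite ltrD2l ltr_pM2r// ltr_nat.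
have below' q' : q' \in L -> q' \in L' \/ q'.2 + g < q.2 + 2 * g.
  move=> /below[|h]; last first.
    by right; apply: (lt_trans h); apply: (lt_trans yq); rewrite ltrDl mulr_gt0.
  rewrite in_cons => /predU1P[->|]; last by left.
  by right; rewrite ltrD2l ltr_pMl// ltr1n.
have sE : 2 * g * (size L').+1%:R = 2 * g + 2 * g * (size L')%:R by rewrite -natr1; ring.
have pD' : `|p - p0| + 2 * g + 2 * g * (size L')%:R <= D.
  by move: pD; rewrite [size _]/= sE addrA.
have sL : 0 <= 2 * g * (size L')%:R by rewrite !mulr_ge0// ltW.
rewrite sE; move: g0 => g0'.
case: hp => [[zo hp]|[k [f [zE kN f01 hp]]]].
  have pD1 : `|p - p0| <= D by lra.
  have [c' rc'] := pass_beside g0 J0 tJ LM qL yq qsep pD1 zo rx.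
  have [|p' Tp' pp'] := IH p _ _ sub' sep' above' below' Wd _ hp rc'; first lra.
  by exists p' => //; lra.
have pE : p + t * q.2 = q.1 + (k%:R + f) * g by rewrite -zE divfK ?gt_eqF//; ring.
have pD2 : `|p - p0| + 2 * g <= D by lra.
have t1' : 0 < 1 - t by have := ler_norm t; have := t1; lra.
have [c' rc'] := pass_through g0 J0 tJ ML LM qL yq qsep pD2 pE kN
   (r := (1 - t)^-1) ltac:(by rewrite invr_gt0) ltac:(by rewrite mulfV ?gt_eqF)
   erefl erefl f01 rx.
have step : `|g * (1 + t)| <= 2 * g.
  have := t1; rewrite ltr_norml => /andP[? ?].
  by rewrite normrM gtr0_norm// mulrC ler_pM2r// ler_norml; apply/andP; split; lra.
have [|p' Tp' pp'] := IH _ _ _ sub' sep' above' below' Wd _ hp rc'.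
  apply: le_trans pD'; rewrite lerD2r.
  have -> : p + g * (1 + t) - p0 = (p - p0) + g * (1 + t) by ring.
  by apply: le_trans (ler_normD _ _) _; rewrite lerD2l.
exists p' => //; have -> : p' - p = g * (1 + t) + (p' - (p + g * (1 + t))) by ring.
by apply: le_trans (ler_normD _ _) _; apply: lerD.
Qed.

Lemma comb_path p : `|p - p0| + 2 * g * (size L)%:R <= D -> passes g t Nc J p L ->
  exists2 p', transformation M (line_through (p, 0) u) (line_through (p', 0) u) &
              `|p' - p| <= 2 * g * (size L)%:R.
Proof.
move=> pD hp; set d := line_through (p, 0) u.
have u1 : enorm u = 1 := enorm_slope_dir t.
(* A height below every comb, as the first comb is the lowest one. *)
pose y0 := if L is q :: _ then q.2 - 1 else 0.
have y0L q : q \in L -> y0 < q.2.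
  rewrite /y0; case: L Lsep => // q' L' sep; rewrite in_cons => /predU1P[->|].
    by rewrite ltrBlDr ltrDl.
  move=> /(pairwise_cons_in sep); apply: le_lt_trans.
  by rewrite lerD2l (@le_trans _ _ 0)// ?lerN10// mulr_ge0// ltW.
have dE : d = line_through (p + t * y0, y0) u by rewrite line_through_intercept.
have Wd : directed_lines d by exact: directed_line_through.
have free s : s <= 0 -> ~ mirror_union M ((p + t * y0, y0) + s *: u).
  move=> s0; apply: (free_point g0 LM).
    rewrite (_ : intercept t _ = p).
      by apply: le_trans pD; rewrite lerDl !mulr_ge0// ltW.
    by rewrite /intercept /u /slope_dir !coordE /=; ring.
  move=> q qL; left; left; rewrite /u /slope_dir !coordE /=; apply: le_lt_trans (y0L q qL).
  rewrite gerDl mulr1 mulr_le0_ge0// invr_ge0.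
have rx : ray_to M d (dot (p + t * y0, y0) u) (p + t * y0, y0) u.
  have {2}-> : (p + t * y0, y0) = Gamma d (dot (p + t * y0, y0) u).
    by rewrite dE -[X in Gamma _ X]add0r Gamma_line_through scale0r addr0.
  apply: ray_to_line => // s sc.
  rewrite dE -[s](subrK (dot (p + t * y0, y0) u)) Gamma_line_through.
  by apply: free; rewrite subr_le0.
apply: (comb_path_suffix (fun q qL => qL) Lsep y0L _ Wd pD hp rx).
by move=> q; left.
Qed.

(** The first comb that is not passed on the side is met before any displacement, so its first
    reflection point lies on the original line. Such a comb exists, since the crossing of [q] is not
    a passage on the side. *)
Lemma crossed_comb_hit p L' : {subset L' <= L} -> passes g t Nc J p L' ->
  (exists2 q, q \in L' & 0 <= (p + t * q.2 - q.1) / g <= Nc%:R + 1) ->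
  line (line_through (p, 0) u) `&` mirror_union M !=set0.
Proof.
move=> sub hp [q qL' zq]; suff [z zM zp] : exists2 z, mirror_union M z & intercept t z = p.
  exists z; split=> //; exists (dot z u) => //.
  rewrite -(line_through_intercept t p z.2).
  have -> : (p + t * z.2, z.2) = z by apply: pt_eq => //=; rewrite -zp /intercept; ring.
  by rewrite -[dot z u]add0r Gamma_line_through scale0r addr0.
elim: L' sub hp qL' => //= q' L' IH sub hp qL'.
have q'L : q' \in L by apply: sub; rewrite mem_head.
have sub' : {subset L' <= L} by move=> q1 q1L; apply: sub; rewrite in_cons q1L orbT.
case: hp => [[zo hp]|[k [f [zE kN f01 hp]]]].
  apply: IH => //; move: qL'; rewrite in_cons => /predU1P[qq|//].
  by move: zq; rewrite qq; case: zo => h /andP[]; rewrite leNgt ?h// => _; rewrite leNgt h.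
have pE : p + t * q'.2 = q'.1 + (k%:R + f) * g by rewrite -zE divfK ?gt_eqF//; ring.
have t1' : 0 < 1 - t by have := ler_norm t; have := t1; lra.
apply: (hits_at_intercept J0 tJ ML q'L pE kN
   (r := (1 - t)^-1) _ _ erefl erefl f01).
  by rewrite invr_gt0.
by rewrite mulfV ?gt_eqF.
Qed.

End Path.
End CombPath.

(** * The digital sundial *)

Section Sundial.
Context {R : realType}.
Local Notation pt := (R * R)%type.
Local Notation mu := (@lebesgue_measure R).
Implicit Types (B : seq pt) (b s z : pt) (N K : nat) (t c rho eta lam : R).

Definition near_points (C : seq R) (lam : R) : set R :=
  [set r | exists2 c, c \in C & `|c - r| <= lam].

Lemma near_points_cons c C lam :
  near_points (c :: C) lam = `[c - lam, c + lam] `|` near_points C lam.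
Proof.
apply/seteqP; split=> r /=.
  move=> [c' /[!in_cons] /predU1P[->|c'C] h]; last by right; exists c'.
  by left; rewrite in_itv /= -ler_distlC.
move=> [|[c' c'C h]]; last by exists c' => //; rewrite in_cons c'C orbT.
by rewrite in_itv /= -ler_distlC => h; exists c => //; rewrite mem_head.
Qed.

Lemma near_points_nil lam : near_points [::] lam = set0.
Proof. by apply/seteqP; split=> r // -[]. Qed.

Lemma measurable_near_points C lam : measurable (near_points C lam).
Proof.
elim: C => [|c C IH]; first by rewrite near_points_nil.
by rewrite near_points_cons; apply: measurableU.
Qed.

Lemma measure_near_points C lam : 0 <= lam ->
  (mu (near_points C lam) <= (2 * lam * (size C)%:R)%:E)%E.
Proof.
move=> lam0; elim: C => [|c C IH].
  by rewrite near_points_nil measure0 /= mulr0.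
rewrite near_points_cons; apply: le_trans.
  by apply: measureU2; [exact: measurable_itv | exact: measurable_near_points].
have -> : 2 * lam * (size (c :: C))%:R = 2 * lam + 2 * lam * (size C)%:R.
  by rewrite /= -natr1; ring.
rewrite EFinD leeD//.
rewrite /= lebesgue_measure_itv /= lte_fin; case: ifP => _; last by rewrite lee_fin mulr_ge0.
by rewrite -EFinD lee_fin; lra.
Qed.

Definition norm1 z : R := `|z.1| + `|z.2|.

Lemma norm1_ge0 z : 0 <= norm1 z.
Proof. by rewrite addr_ge0. Qed.

Lemma norm1D z z' : norm1 (z + z') <= norm1 z + norm1 z'.
Proof.
by rewrite /norm1 !coordE addrACA lerD// ler_normD.
Qed.

Lemma norm1Z a z : norm1 (a *: z) = `|a| * norm1 z.
Proof. by rewrite /norm1 !coordE !normrM mulrDr. Qed.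

Lemma dot_norm1 z v : `|v.1| <= 1 -> `|v.2| <= 1 -> `|dot z v| <= norm1 z.
Proof.
move=> v1 v2; apply: le_trans (ler_normD _ _) _; rewrite !normrM.
by apply: lerD; rewrite ler_piMr.
Qed.

(* The slats of [(B, N, s)] are the segments from [b] to [b + s / N], [b \in B];
   some slat projects onto [c] along the lines of slope [t]. *)
Definition covers t B N s c :=
  exists2 b, b \in B & intercept t b <= c <= intercept t b + intercept t s / N%:R.

Definition refine B N s K : seq pt :=
  [seq b + (k%:R / (K%:R * N%:R)) *: s | b <- B, k <- iota 0 K].

Lemma size_refine B N s K : size (refine B N s K) = (size B * K)%N.
Proof. by rewrite size_allpairs size_iota. Qed.

Lemma mem_refine B N s K b : (0 < K)%N -> (0 < N)%N -> b \in refine B N s K ->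
  exists2 b0, b0 \in B & exists2 a, 0 <= a <= N%:R^-1 & b = b0 + a *: s.
Proof.
move=> K0 N0 /allpairsP[[b0 k] /= [b0B]]; rewrite mem_iota add0n => /andP[_ kK] ->.
exists b0 => //; exists (k%:R / (K%:R * N%:R)) => //.
rewrite mulr_ge0 ?invr_ge0 ?mulr_ge0//= invfM mulrA ler_piMl ?invr_ge0//.
by rewrite ler_pdivrMr ?ltr0n// mul1r ler_nat ltnW.
Qed.

Lemma subdivide K (l y : R) : 0 <= y <= K%:R * l -> (0 < K)%N ->
  exists2 k, (k < K)%N & k%:R * l <= y <= (k%:R + 1) * l.
Proof.
elim: K => // K IH /andP[y0 yK] _; case: K IH yK => [|K] IH yK.
  by exists 0%N => //; rewrite mul0r add0r y0.
have [yl|yl] := leP y (K.+1%:R * l).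
  by have [||k kK kl] := IH => //; [rewrite y0|exists k => //; exact: ltnW].
by exists K.+1 => //; rewrite (ltW yl)/= natr1.
Qed.

Lemma covers_refine t B N s K c : (0 < K)%N -> (0 < N)%N ->
  covers t B N s c -> covers t (refine B N s K) (N * K) s c.
Proof.
move=> K0 N0 [b bB /andP[bc cb]].
pose l := intercept t s / N%:R / K%:R.
have KK : K%:R != 0 :> R by rewrite pnatr_eq0 -lt0n.
have NN : N%:R != 0 :> R by rewrite pnatr_eq0 -lt0n.
have [|k kK /andP[kl lk]] := @subdivide K l (c - intercept t b) _ K0.
  by rewrite subr_ge0 bc /= mulrC divfK//; lra.
exists (b + (k%:R / (K%:R * N%:R)) *: s).
  by apply/allpairsP; exists (b, k); split; rewrite //= mem_iota.
have -> : intercept t (b + (k%:R / (K%:R * N%:R)) *: s) = intercept t b + k%:R * l.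
  by rewrite /intercept /l /intercept !coordE; field; rewrite KK NN.
have -> : intercept t s / (N * K)%:R = l by rewrite natrM /l; field; rewrite KK NN.
by apply/andP; split; lra.
Qed.

Definition shadow B rho (v : pt) : set R := near_points [seq dot b v | b <- B] rho.

(** The new slats that stem from one old slat start on it up to [rho1]. Their thickened shadow lies
    in one interval of length [|dot s v| / N + 2 * rho1], centred at the projection of the middle of
    the old slat; there are [N] such intervals. *)
Lemma shadow_refine B N s (B' : seq pt) rho rho1 v : (0 < N)%N -> size B = N -> 0 <= rho1 ->
  `|v.1| <= 1 -> `|v.2| <= 1 ->
  (forall b', b' \in B' -> exists2 b0, b0 \in B & exists2 a,
     0 <= a <= N%:R^-1 & norm1 (b' - (b0 + a *: s)) + rho <= rho1) ->
  (mu (shadow B' rho v) <= (`|dot s v| + 2 * rho1 * N%:R)%:E)%E.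
Proof.
move=> N0 BN r0 v1 v2 H.
have Np : 0 < N%:R :> R by rewrite ltr0n.
pose lam := `|dot s v| / N%:R / 2 + rho1.
have lam0 : 0 <= lam by rewrite /lam addr_ge0// !divr_ge0.
pose C := [seq dot b v + dot s v / N%:R / 2 | b <- B].
have -> : `|dot s v| + 2 * rho1 * N%:R = 2 * lam * (size C)%:R.
  by rewrite size_map BN /lam; field; rewrite gt_eqF.
apply: le_trans (measure_near_points C lam0); apply: le_measure; rewrite ?inE;
  [exact: measurable_near_points|exact: measurable_near_points|].
move=> r [_ /mapP[b' b'B ->] hr].
have [b0 b0B [a /andP[a0 aN] hb]] := H b' b'B.
exists (dot b0 v + dot s v / N%:R / 2); first by apply/mapP; exists b0.
have -> : dot b0 v + dot s v / N%:R / 2 - r =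
    (dot b' v - r) - dot (b' - (b0 + a *: s)) v + (N%:R^-1 / 2 - a) * dot s v.
  by rewrite /dot !coordE; field; rewrite gt_eqF.
have h1 := dot_norm1 (b' - (b0 + a *: s)) v1 v2.
have h2 : `|(N%:R^-1 / 2 - a) * dot s v| <= `|dot s v| / N%:R / 2.
  rewrite normrM mulrC -mulrA ler_wpM2l// ler_norml; apply/andP; split; lra.
apply: le_trans (ler_normD _ _) _; rewrite /lam addrC; apply: lerD => //.
apply: le_trans (ler_normB _ _) _; apply: le_trans hb; rewrite addrC.
exact: lerD.
Qed.

(* Each slat along [s 0] is cut into [K] pieces, which are turned towards [s 1].
   The shadow of the new slats in a direction that is nearly parallel to [s 0] is
   small, and remains so if all later slats stay close enough to them. *)
Lemma sundial_refine (delta eta : R) n (s : nat -> pt) B N rho :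
  0 < eta -> (0 < N)%N -> size B = N -> 0 < rho -> norm1 (s 0%N) <= N%:R * (rho / 20) ->
  (forall t i, `|t| <= delta -> (i < n)%N ->
     intercept t (s i) <= intercept t (s i.+1)) ->
  exists B' N' rho', [/\ (0 < N')%N, size B' = N', 0 < rho' &
    [/\ norm1 (s n) <= N'%:R * (rho' / 20),
     forall b', b' \in B' -> exists2 b, b \in B & norm1 (b' - b) + rho' <= rho,
     forall t c, `|t| <= delta -> covers t B N (s 0%N) c -> covers t B' N' (s n) c &
     forall v i, (i < n)%N -> `|v.1| <= 1 -> `|v.2| <= 1 ->
       (mu (shadow B' rho' v) <= (`|dot (s i) v| + eta)%:E)%E]].
Proof.
move=> eta0; elim: n s B N rho => [|n IH] s B N rho N0 BN rho0 sN mono.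
  exists B, N, rho; split=> //; split=> // b bB; exists b => //.
  by rewrite subrr /norm1 /= normr0 addr0 add0r.
have Np : 0 < N%:R :> R by rewrite ltr0n.
(* The second term makes the [N] thickenings cost at most [eta]; the first leaves room, within
   [rho], for the length of an old slat, which is at most [rho / 20]. *)
pose rho1 := Num.min (rho / 2) (eta / (2 * N%:R)).
have rho10 : 0 < rho1 by rewrite lt_min !divr_gt0// mulr_gt0.
have rho1a : rho1 <= rho / 2 by rewrite ge_min lexx.
have rho1b : 2 * rho1 * N%:R <= eta.
  rewrite mulrAC -ler_pdivlMl ?mulr_gt0// mulrC.
  by rewrite ge_min lexx orbT.
pose K := (Num.trunc (norm1 (s 1%N) / (N%:R * (rho1 / 20)))).+1.
have sK : norm1 (s 1%N) <= (N * K)%:R * (rho1 / 20).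
  rewrite natrM mulrAC -ler_pdivrMl ?mulr_gt0// ?divr_gt0// mulrC /K.
  by rewrite ltW// truncnS_gt.
have NK0 : (0 < N * K)%N by rewrite muln_gt0 N0.
have rN : size (refine B N (s 0%N) K) = (N * K)%N by rewrite size_refine BN.
have mono1 t i : `|t| <= delta -> (i < n)%N ->
    intercept t (s i.+1) <= intercept t (s i.+2) by move=> td ni; exact: mono.
have [B' [N' [rho' [N'0 B'N rho'0 [H1 H2 H3 H4]]]]] :=
  IH (fun i => s i.+1) _ _ _ NK0 rN rho10 sK mono1.
have near b' : b' \in B' -> exists2 b0, b0 \in B & exists2 a,
     0 <= a <= N%:R^-1 & norm1 (b' - (b0 + a *: s 0%N)) + rho' <= rho1.
  move=> /H2[b /(mem_refine (ltn0Sn _) N0)[b0 b0B [a aN ->]] hb].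
  by exists b0 => //; exists a.
exists B', N', rho'; split=> //; split=> //.
- move=> b' /near[b0 b0B [a /andP[a0 aN] hb]]; exists b0 => //.
  have -> : b' - b0 = (b' - (b0 + a *: s 0%N)) + a *: s 0%N.
    by apply: pt_eq; rewrite !coordE; ring.
  have h1 := norm1D (b' - (b0 + a *: s 0%N)) (a *: s 0%N).
  have h2 : norm1 (a *: s 0%N) <= rho / 20.
    rewrite norm1Z ger0_norm// (le_trans (ler_wpM2l a0 sN))//.
    have r20 : 0 <= rho / 20 by rewrite divr_ge0 ?ltW.
    have aN1 : a * N%:R <= 1 by move: (ler_wpM2r (ltW Np) aN); rewrite mulVf ?gt_eqF.
    by rewrite (mulrA a); exact: ler_piMl r20 aN1.
  lra.
- move=> t c td cov; apply: H3 => //.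
  (* Turning the pieces about their starting points only lengthens their projections, by [mono]. *)
  have [b bB /andP[bc cb]] := covers_refine (ltn0Sn K.-1) N0 cov.
  exists b => //; rewrite bc (le_trans cb)// lerD2l ler_wpM2r ?invr_ge0//.
  exact: mono.
- move=> v [|i] ni v1 v2; last exact: H4.
  apply: le_trans (shadow_refine N0 BN (ltW rho10) v1 v2 near) _.
  by rewrite lee_fin lerD2l.
Qed.

End Sundial.

Section SundialVectors.
Context {R : realType}.
Local Notation pt := (R * R)%type.
Local Notation mu := (@lebesgue_measure R).

Lemma discrete_ivt (f : nat -> R) (e : R) m : 0 <= f 0%N -> f m <= 0 -> 0 <= e ->
  (forall i, (i < m)%N -> `|f i.+1 - f i| <= e) -> exists2 i, (i <= m)%N & `|f i| <= e.
Proof.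
move=> f0 + e0; elim: m => [|m IH] fm step.
  by exists 0%N => //; rewrite (_ : f 0%N = 0) ?normr0//; apply/le_anti; rewrite fm f0.
have [fm0|fm0] := leP (f m) 0.
  have [//||i im fi] := IH; last by exists i => //; exact: leqW.
  by move=> i im; apply: step; exact: leqW.
exists m.+1 => //; rewrite ler0_norm//; have := step m (ltnSn m).
by rewrite ler_norml; lra.
Qed.

Lemma count_steps (x h : R) : 0 <= x -> 0 < h -> exists m : nat, x <= m%:R * h <= x + h.
Proof.
move=> x0 h0; have xh : 0 <= x / h by rewrite divr_ge0// ltW.
exists (Num.trunc (x / h)).+1; apply/andP; split.
  by rewrite -ler_pdivrMr// ltW// truncnS_gt.
rewrite -natr1 mulrDl mul1r lerD2r -ler_pdivlMr//.
by rewrite truncn_le.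
Qed.

(** Along slope [t] the intercept of the [i]-th vector is [w + (delta - t * e) * (i * h)]: the
    horizontal drift [delta] makes it nondecreasing in [i] for all [|t| <= delta], while the vectors
    turn upwards for [e = 1] and downwards for [e = -1]. *)
Definition fan (delta h w e : R) (i : nat) : pt := (w + delta * (i%:R * h), e * (i%:R * h)).

(* The function [i |-> dot (fan delta h w e i) v] changes sign and has steps of
   size at most [2 h]. *)
Lemma fan_hit (delta T h w e : R) m (v : pt) : 0 < delta < T -> delta <= 1 -> 0 < h ->
  0 < w -> `|e| = 1 -> w / (T - delta) <= m%:R * h -> `|v.1| <= 1 -> `|v.2| <= 1 ->
  T * `|v.1| <= `|v.2| -> e * v.1 * v.2 <= 0 ->
  exists2 i, (i <= m)%N & `|dot (fan delta h w e i) v| <= 2 * h.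
Proof.
move=> /andP[d0 dT] d1 h0 w0 e1 wm v1 v2 Tv ev.
wlog v10 : v v1 v2 Tv ev / 0 <= v.1.
  move=> H; have [|v10] := leP 0 v.1; first exact: H.
  have [i im] : exists2 i, (i <= m)%N & `|dot (fan delta h w e i) (- v)| <= 2 * h.
    by apply: H; rewrite /= ?normrN ?mulrN ?mulNr ?opprK ?oppr_ge0// ltW.
  rewrite (_ : dot _ (- v) = - dot (fan delta h w e i) v) ?normrN; first by exists i.
  by rewrite /dot /=; ring.
have v1E : `|v.1| = v.1 by rewrite ger0_norm.
have fE i : dot (fan delta h w e i) v = w * v.1 + i%:R * h * (delta * v.1 + e * v.2).
  by rewrite /dot /fan /=; ring.
have ev2 : v.1 = 0 \/ e * v.2 = - `|v.2|.
  move: v10; rewrite le_eqVlt => /predU1P[<-|v10]; [by left|right].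
  have ev0 : e * v.2 <= 0 by rewrite -(pmulr_rle0 _ v10) mulrCA mulrA.
  by rewrite -[LHS]opprK -(ler0_norm ev0) normrM e1 mul1r.
have [z|ev2'] := ev2.
  by exists 0%N => //; rewrite fE z !mulr0 !mul0r addr0 normr0 mulr_ge0// ltW.
have step : `|delta * v.1 + e * v.2| <= 2.
  apply: le_trans (ler_normD _ _) _; rewrite !normrM e1 mul1r (ger0_norm (ltW d0)).
  have : delta * `|v.1| <= 1 by rewrite mulr_ile1// ltW.
  lra.
apply: (discrete_ivt (f := fun i => dot (fan delta h w e i) v)).
- by rewrite fE !mul0r addr0 mulr_ge0// ltW.
(* At the end of the fan the value is nonpositive: outside the cone it decreases at a rate of at
   least [(T - delta) * v.1], and [m * h] is long enough to use up the initial value [w * v.1]. *)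
- rewrite fE ev2'; move: Tv wm; rewrite v1E ler_pdivrMr ?subr_gt0// => Tv wm.
  have k1 : m%:R * h * (T * v.1) <= m%:R * h * `|v.2|.
    by apply: ler_wpM2l => //; rewrite mulr_ge0// ltW.
  have k2 : w * v.1 <= m%:R * h * (T - delta) * v.1 by apply: ler_wpM2r.
  have E : w * v.1 + m%:R * h * (delta * v.1 - `|v.2|) =
    (w * v.1 - m%:R * h * (T - delta) * v.1) + (m%:R * h * (T * v.1) - m%:R * h * `|v.2|).
    by ring.
  by rewrite E -[leRHS]addr0 lerD// subr_le0.
- by rewrite mulr_ge0// ltW.
move=> i im; rewrite !fE -natr1.
have -> : w * v.1 + (i%:R + 1) * h * (delta * v.1 + e * v.2) -
  (w * v.1 + i%:R * h * (delta * v.1 + e * v.2)) = h * (delta * v.1 + e * v.2) by ring.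
by rewrite normrM (gtr0_norm h0) mulrC ler_pM2r.
Qed.

(* With [r = delta / (T - delta)], bounds the total length of the final slats. *)
Definition slat_total (w0 r : R) : R := (w0 * (1 + 2 * r) + 2) * (1 + 2 * r) + 2.

(* The slats follow a fan on one side, then a fan on the other side, and end up
   horizontal; every direction outside the cone of slope [T] is nearly parallel
   to a member of one of the fans. *)
Lemma sundial (delta T w0 eta rho0 : R) :
  0 < delta < T -> delta <= 1 -> 0 < w0 -> 0 < eta -> 0 < rho0 ->
  exists (B : seq pt) N w rho, [/\ (0 < N)%N, size B = N, 0 < rho & [/\
    0 < w <= slat_total w0 (delta / (T - delta)), w / N%:R <= rho / 20,
    forall b, b \in B -> exists2 a, `|a| <= w0 / 2 & norm1 (b - (a, 0)) + rho <= rho0,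
    forall t c, `|t| <= delta -> `|c| <= w0 / 2 ->
      exists2 b, b \in B & intercept t b <= c <= intercept t b + w / N%:R &
    forall v, `|v.1| <= 1 -> `|v.2| <= 1 -> T * `|v.1| <= `|v.2| ->
      (mu (shadow B rho v) <= eta%:E)%E]].
Proof.
move=> dT d1 w00 eta0 rho00; have /andP[d0 dT'] := dT.
pose h := Num.min (eta / 4) 1.
have h0 : 0 < h by rewrite lt_min ltr01 divr_gt0.
have h1 : h <= 1 by rewrite ge_min lexx orbT.
have heta : h <= eta / 4 by rewrite ge_min lexx.
have mu0 : 0 < T - delta by rewrite subr_gt0.
pose r := delta / (T - delta).
have r0 : 0 < r by exact: divr_gt0.
(* At its end a fan has intercepts up to [w + 2 * delta * (m * h)]. The next vector is horizontal of
   exactly this length, so that no projection decreases at the change of fan. *)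
have next w : 0 < w -> exists m : nat, w / (T - delta) <= m%:R * h /\
    w <= w + 2 * delta * (m%:R * h) <= w * (1 + 2 * r) + 2.
  move=> w0'; have [|m /andP[m1 m2]] := @count_steps (w / (T - delta)) h _ h0.
    by rewrite divr_ge0// ltW.
  exists m; split=> //; apply/andP; split.
    by rewrite lerDl !mulr_ge0// ltW.
  have -> : w * (1 + 2 * r) + 2 = w + (2 * delta * (w / (T - delta)) + 2).
    by rewrite /r; ring.
  rewrite lerD2l; apply: (@le_trans _ _ (2 * delta * (w / (T - delta) + h))).
    by rewrite ler_wpM2l// mulr_ge0// ltW.
  rewrite mulrDr lerD2l -mulrA ler_piMr// mulr_ile1// ltW//.
have [m [m1 /andP[m2 m3]]] := next w0 w00.
set w1 := w0 + _ in m2 m3; have w10 : 0 < w1 by exact: lt_le_trans m2.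
have [m' [m1' /andP[m2' m3']]] := next w1 w10.
set w2 := w1 + _ in m2' m3'; have w20 : 0 < w2 by exact: lt_le_trans m2'.
pose n := (m.+1 + m'.+1)%N.
pose s i := if (i < m.+1)%N then fan delta h w0 1 i
            else if (i < n)%N then fan delta h w1 (-1) (i - m.+1) else (w2, 0).
have sa i : (i <= m)%N -> s i = fan delta h w0 1 i by rewrite /s ltnS => ->.
have sb i : (i <= m')%N -> s (m.+1 + i)%N = fan delta h w1 (-1) i.
  by move=> im; rewrite /s ltnNge leq_addr /= /n ltn_add2l ltnS im addKn.
have sn : s n = (w2, 0) by rewrite /s ltnn ltnNge leq_addr.
have s0 : s 0%N = (w0, 0) by rewrite sa// /fan !mul0r !mulr0 addr0.
have mono t i : `|t| <= delta -> (i < n)%N -> intercept t (s i) <= intercept t (s i.+1).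
  rewrite ler_norml => /andP[t1 t2] ni.
  have stepE w e j : intercept t (fan delta h w e j) = w + (delta - t * e) * (j%:R * h).
    by rewrite /intercept /fan /=; ring.
  have jh j : 0 <= j%:R * h :> R by rewrite mulr_ge0// ltW.
  have inc w e j : `|e| = 1 ->
      intercept t (fan delta h w e j) <= intercept t (fan delta h w e j.+1).
    move=> e1; rewrite !stepE lerD2l ler_wpM2l//; last first.
      by rewrite ler_pM2r// ler_nat.
    rewrite subr_ge0; apply: le_trans (ler_norm _) _.
    by rewrite normrM e1 mulr1 ler_norml t1.
  have last w e j : `|e| = 1 ->
      intercept t (fan delta h w e j) <= w + 2 * delta * (j%:R * h).
    move=> e1; rewrite stepE lerD2l ler_wpM2r//.
    have : `|t * e| <= delta by rewrite normrM e1 mulr1 ler_norml t1.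
    by rewrite ler_norml; lra.
  have [im|im] := ltnP i m; first by rewrite (sa i (ltnW im)) (sa _ im) inc// normr1.
  move: im; rewrite leq_eqVlt => /predU1P[<-|im].
    rewrite sa// -[m.+1]addn0 sb// [leRHS]stepE mul0r mulr0 addr0.
    by apply: last; rewrite normr1.
  have [k ik] : exists k, i = (m.+1 + k)%N by exists (i - m.+1)%N; rewrite subnKC.
  move: ni; rewrite ik /n ltn_add2l ltnS -addnS.
  rewrite leq_eqVlt => /predU1P[->|jm].
    rewrite sb// -[(m.+1 + m'.+1)%N]/n sn {2}/intercept /= mulr0 subr0.
    by apply: last; rewrite normrN normr1.
  by rewrite sb ?sb// 1?ltnW// inc// normrN normr1.
(* The initial slat, from [b0] to its opposite, is cut beforehand to meet the bound on lengths at
   the start of the refinement. *)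
pose K := (Num.trunc (w0 / (rho0 / 20))).+1.
have wK : w0 <= K%:R * (rho0 / 20).
  by rewrite -ler_pdivrMr ?divr_gt0// ltW// truncnS_gt.
pose b0 : pt := (- (w0 / 2), 0).
have := @sundial_refine R delta (eta / 2) n s (refine [:: b0] 1 (w0, 0) K) K rho0.
case=> [||||||B [N [rho [N0 BN rho1 [H1 H2 H3 H4]]]]] //.
- by rewrite divr_gt0.
- by rewrite size_refine mul1n.
- by rewrite s0 /norm1 /= normr0 addr0 gtr0_norm.
exists B, N, w2, rho; split=> //; split.
- rewrite w20 /= (le_trans m3')// /slat_total -/r lerD2r ler_wpM2r//.
  by rewrite addr_ge0// mulr_ge0// ltW.
- move: H1; rewrite sn /norm1 /= normr0 addr0 gtr0_norm// => H1.
  by rewrite ler_pdivrMr ?ltr0n// mulrC.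
- move=> b /H2[b' /(mem_refine (ltn0Sn _) (ltn0Sn _))[b1]].
  rewrite inE => /eqP-> [a]; rewrite invr1 => /andP[a0 a1] -> hb.
  exists (a * w0 - w0 / 2).
    have : a * w0 <= w0 by rewrite ler_piMl// ltW.
    have : 0 <= a * w0 by rewrite mulr_ge0// ltW.
    by rewrite ler_norml => ? ?; apply/andP; split; lra.
  have <- // : b0 + a *: (w0, 0) = (a * w0 - w0 / 2, 0) :> pt.
  by apply: pt_eq; rewrite !coordE /=; ring.
- move=> t c td; rewrite ler_norml => /andP[c1 c2].
  have [|b bB] := H3 t c td.
    rewrite s0 -[X in covers _ _ X]mul1n; apply: covers_refine => //.
    exists b0; rewrite ?mem_head// divr1 /intercept /= !mulr0 !subr0.
    by apply/andP; split; lra.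
  by rewrite sn {3}/intercept /= mulr0 subr0; exists b.
move=> v v1 v2 Tv.
have key i : (i < n)%N -> `|dot (s i) v| <= 2 * h -> (mu (shadow B rho v) <= eta%:E)%E.
  by move=> ni hi; apply: le_trans (H4 v i ni v1 v2) _; rewrite lee_fin; lra.
have [vv|vv] := leP (1 * v.1 * v.2) 0.
  have [i im hi] := fan_hit dT d1 h0 w00 (normr1 _) m1 v1 v2 Tv vv.
  by apply: (key i); rewrite ?sa// /n addSn ltnS (leq_trans im)// leq_addr.
have vv' : -1 * v.1 * v.2 <= 0 by move: vv; rewrite !mulNr oppr_le0 mul1r => /ltW.
have [i im hi] := fan_hit dT d1 h0 w10 (normrN1 _) m1' v1 v2 Tv vv'.
by apply: (key (m.+1 + i)%N); rewrite ?sb// /n ltn_add2l ltnS.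
Qed.

End SundialVectors.

Section Heights.
Context {R : realType}.
Local Notation pt := (R * R)%type.

Lemma avoid (F : seq R) (a b : R) : a < b -> exists2 x, a < x < b & x \notin F.
Proof.
elim: F a b => [|c F IH] a b ab; first by exists ((a + b) / 2) => //; apply/andP; split; lra.
have [/andP[ac cb]|abc] := boolP (a < c < b).
  have [x /andP[ax xc] xF] := IH a c ac; exists x; first by rewrite ax (lt_trans xc).
  by rewrite in_cons negb_or xF lt_eqF.
have [x xab xF] := IH a b ab; exists x => //; rewrite in_cons negb_or xF andbT.
by apply: contraNneq abc => <-.
Qed.

(** Rays are followed through one comb at a time, so no two combs may share a height, although slats
    may. Each height is moved slightly off the finitely many already taken. *)
Lemma distinct_heights (B : seq pt) (w : R) : 0 < w -> exists Q : seq pt,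
  [/\ size Q = size B, pairwise (fun q q' => q.2 < q'.2) Q,
   forall b, b \in B -> exists2 q, q \in Q & q.1 = b.1 /\ `|q.2 - b.2| <= w &
   forall q, q \in Q -> exists2 b, b \in B & q.1 = b.1 /\ `|q.2 - b.2| <= w].
Proof.
move=> w0; suff [Q [sQ uQ BQ QB]] : exists Q : seq pt,
  [/\ size Q = size B, uniq (map snd Q),
   forall b, b \in B -> exists2 q, q \in Q & q.1 = b.1 /\ `|q.2 - b.2| <= w &
   forall q, q \in Q -> exists2 b, b \in B & q.1 = b.1 /\ `|q.2 - b.2| <= w].
  exists (sort (relpre snd <=%R) Q); split.
  - by rewrite size_sort.
  - rewrite -(pairwise_map snd <%R) -sort_map -(sorted_pairwise lt_trans).
    by rewrite sort_lt_sorted.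
  - by move=> b /BQ[q qQ h]; exists q; rewrite ?mem_sort.
  - by move=> q; rewrite mem_sort => /QB.
elim: B => [|b B [Q [sQ uQ BQ QB]]]; first by exists [::].
have [y /andP[by1 by2] yQ] := avoid (map snd Q) (ltr_pwDr w0 (lexx b.2)).
have yw : `|y - b.2| <= w by rewrite ger0_norm; lra.
exists ((b.1, y) :: Q); split; rewrite ?map_cons /= ?sQ ?yQ//.
  move=> b' /[!in_cons] /predU1P[->|/BQ[q qQ h]].
    by exists (b.1, y) => //; rewrite mem_head.
  by exists q => //; rewrite in_cons qQ orbT.
move=> q /[!in_cons] /predU1P[->|/QB[b' b'B h]].
  by exists b => //; rewrite mem_head.
by exists b' => //; rewrite in_cons b'B orbT.
Qed.

Lemma pairwise_gap (Q : seq pt) : pairwise (fun q q' => q.2 < q'.2) Q ->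
  exists2 e, 0 < e & pairwise (fun q q' => q.2 + e < q'.2) Q.
Proof.
elim: Q => [|q Q IH] /=; first by exists 1.
move=> /andP[qQ /IH[e e0 eQ]].
have [e1 e10 e1Q] : exists2 e1, 0 < e1 & all (fun q' => q.2 + e1 < q'.2) Q.
  elim: Q qQ {IH eQ} => [|q' Q IH] /=; first by exists 1.
  move=> /andP[qq' /IH[e1 e10 e1Q]]; exists (Num.min e1 ((q'.2 - q.2) / 2)).
    by rewrite lt_min e10 divr_gt0// subr_gt0.
  apply/andP; split.
    apply: (@le_lt_trans _ _ (q.2 + (q'.2 - q.2) / 2)); last lra.
    by rewrite lerD2l ge_min lexx orbT.
  apply: sub_all e1Q => q1; apply: le_lt_trans.
  by rewrite lerD2l ge_min lexx.
exists (Num.min e e1); first by rewrite lt_min e0.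
apply/andP; split.
  apply: sub_all e1Q => q1; apply: le_lt_trans.
  by rewrite lerD2l ge_min lexx orbT.
apply: sub_pairwise eQ => q1 q2; apply: le_lt_trans.
by rewrite lerD2l ge_min lexx.
Qed.

End Heights.

(** * Counting the shifts for which a line meets a tooth near its ends *)

Section Shifts.
Context {R : realType}.
Local Notation pt := (R * R)%type.
Implicit Types (L : seq pt) (q : pt).

Let int2 (x y : int) : x - 1 < y -> y < x + 1 + 1 -> y = x \/ y = x + 1.
Proof. by lia. Qed.

(* A bad [j] gives an integer [e], congruent to [sgn * j] modulo [J], with
   [|J z - e| < 1], and there are at most two such integers. *)
Lemma bad_phases (z : R) (J Nc : nat) (sgn : int) : (0 < J)%N -> sgn = 1 \/ sgn = -1 ->
  2 < z < Nc%:R - 2 ->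
  (count (fun j : nat => ~~ `[<exists k f, [/\ (z - sgn%:~R * (j%:R / J%:R) = k%:R + f)%R,
     (k.+1 < Nc)%N & (J%:R^-1 <= f <= 1 - J%:R^-1)%R]>]) (iota 0 J) <= 2)%N.
Proof.
move=> J0 sg /andP[z2 zN].
have Jp : 0 < J%:R :> R by rewrite ltr0n.
have sg2 : sgn * sgn = 1 by case: sg => ->.
have sgR : (sgn%:~R : R) = 1 \/ (sgn%:~R : R) = -1 by case: sg => ->; [left|right].
pose a := Num.floor (J%:R * z).
pose r (e : int) := `|((sgn * e)%R %% J)%Z|%N.
rewrite -size_filter.
have fu : uniq [seq j <- iota 0 J | ~~ `[<exists k f,
   [/\ (z - sgn%:~R * (j%:R / J%:R) = k%:R + f)%R,
     (k.+1 < Nc)%N & (J%:R^-1 <= f <= 1 - J%:R^-1)%R]>]] by rewrite filter_uniq// iota_uniq.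
apply: (@uniq_leq_size _ _ [:: r a; r (a + 1)]) fu _.
move=> j; rewrite mem_filter mem_iota add0n => /andP[/asboolPn nj /andP[_ jJ]].
pose z' := z - sgn%:~R * (j%:R / J%:R).
have jJ1 : j%:R / J%:R < 1 :> R by rewrite ltr_pdivrMr// mul1r ltr_nat.
have jJ0 : 0 <= j%:R / J%:R :> R by rewrite divr_ge0.
have [z'1 z'2] : 1 < z' /\ z' < Nc%:R - 1.
  by rewrite /z'; case: sgR => ->; split; lra.
have z'0 : 0 <= z' by lra.
have /andP[k1 k2] := truncn_itv z'0.
set k := Num.trunc z' in k1 k2.
have kN : (k.+1 < Nc)%N.
  by rewrite -(ltr_nat R) -natr1; lra.
have [y hy] : exists y : nat, `|z' - y%:R| < J%:R^-1.
  have [f1|f1] := ltP (z' - k%:R) J%:R^-1.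
    by exists k; rewrite ger0_norm// subr_ge0.
  have [f2|f2] := leP (z' - k%:R) (1 - J%:R^-1).
    by case: nj; exists k, (z' - k%:R); split=> //; [rewrite -/z'; ring|rewrite f1 f2].
  by exists k.+1; move: k2; rewrite -natr1 => k2; rewrite ltr0_norm; lra.
pose e : int := sgn * j%:Z + J%:Z * y%:Z.
have he : `|J%:R * z - e%:~R| < 1.
  have -> : J%:R * z - e%:~R = J%:R * (z' - y%:R).
    rewrite /e /z' intrD !intrM -!pmulrn; field.
    by rewrite gt_eqF.
  by rewrite normrM gtr0_norm// -(ltr_pM2l Jp) in hy *; rewrite mulfV ?gt_eqF in hy.
have /andP[a1 a2] : a%:~R <= J%:R * z < (a + 1)%:~R by exact: floor_itv.
have rj : j = r e.
  rewrite /r /e mulrDr mulrA sg2 mul1r mulrCA mulrA.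
  have -> : (j%:Z + J%:Z * sgn * y%:Z = (sgn * y%:Z) * J%:Z + j%:Z)%R by ring.
  by rewrite modzMDl modz_small// lez_nat leq0n ltz_nat.
have ea : e = a \/ e = a + 1.
  move: he; rewrite ltr_norml => /andP[h1 h2].
  rewrite rmorphD rmorph1 /= in a2.
  by clearbody e; apply: int2; rewrite -(ltr_int R) ?rmorphB ?rmorphD ?rmorph1 /=; lra.
by rewrite !inE rj; case: ea => ->; rewrite eqxx ?orbT.
Qed.

Lemma sub_in_count (T : eqType) (a b : pred T) (s : seq T) :
  {in s, forall x, a x -> b x} -> (count a s <= count b s)%N.
Proof.
move=> ab; rewrite (_ : count a s = count (predI a b) s); last first.
  by apply: eq_in_count => x /ab abx /=; case: (a x) abx => // ->.
by apply: sub_count => x /andP[].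
Qed.

Definition shift (e : R) L : seq pt := [seq (q.1 + e, q.2) | q <- L].

(* The line reaches the base of the comb at [q] in its tooth number [position]. *)
Definition position (g t p : R) q : R := (p + t * q.2 - q.1) / g.

(** Only crossed combs can spoil a shift, each at most two of them. Which combs are crossed depends
    neither on the shift nor on earlier displacements: in units of [g], a shift is less than 1, a
    crossing adds [1 + t <= 2] to all later positions, and the margin contains 2 for each remaining
    comb. *)
Lemma count_bad_shifts (g t p : R) (Nc J : nat) (sgn : int) L :
  0 < g -> `|t| <= 1 -> (0 < J)%N -> sgn = 1 \/ sgn = -1 ->
  (forall q, q \in L -> 2 * (size L)%:R + 2 < `|position g t p q| /\
                        2 * (size L)%:R + 2 < `|position g t p q - Nc%:R|) ->
  (count (fun j : nat => ~~ `[<passes g t Nc J p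
     (shift (sgn%:~R * (j%:R / J%:R) * g)%R L)>]) (iota 0 J) <=
   2 * count (fun q => (0 <= position g t p q <= Nc%:R)%R) L)%N.
Proof.
move=> g0 t1 J0 sg; elim: L p => [|q L IH] p clear /=.
  by rewrite muln0 leqn0 -leqn0 leqNgt -has_count; apply/hasPn => j _; rewrite negbK; apply/asboolP.
have sgR : (sgn%:~R : R) = 1 \/ (sgn%:~R : R) = -1 by case: sg => ->; [left|right].
have Jp : 0 < J%:R :> R by rewrite ltr0n.
have sL : 0 <= (size L)%:R :> R by [].
have sE : 2 * (size (q :: L))%:R + 2 = 2 * (size L)%:R + 4 :> R by rewrite /= -natr1; lra.
have posE j : (p + t * q.2 - (q.1 + sgn%:~R * (j%:R / J%:R) * g)) / g =
    position g t p q - sgn%:~R * (j%:R / J%:R).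
  by rewrite /position opprD addrA mulrBl mulfK// gt_eqF.
have [c1 c2] := clear q (mem_head _ _); rewrite sE in c1 c2.
have [t2 t3] : -1 <= t /\ t <= 1 by move: t1; rewrite ler_norml => /andP[].
case: (boolP (0 <= position g t p q <= Nc%:R)) => [/andP[z0 zN]|zo].
  rewrite mulnDr muln1.
  have zz : 2 < position g t p q < Nc%:R - 2.
    by move: c1 c2; rewrite ger0_norm// ler0_norm ?subr_le0// => c1 c2; apply/andP; split; lra.
  have posS q' : position g t (p + g * (1 + t)) q' = position g t p q' + (1 + t).
    by rewrite /position; field; rewrite gt_eqF.
  have clear' q' : q' \in L -> 2 * (size L)%:R + 2 < `|position g t (p + g * (1 + t)) q'| /\
      2 * (size L)%:R + 2 < `|position g t (p + g * (1 + t)) q' - Nc%:R|.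
    move=> q'L; have [|d1 d2] := clear q'; first by rewrite in_cons q'L orbT.
    rewrite sE in d1 d2; rewrite posS; set z' := position _ _ _ _ in d1 d2 *.
    have n1 := ler_normB (z' + (1 + t)) (1 + t); rewrite addrK in n1.
    have n2 := ler_normB (z' + (1 + t) - Nc%:R) (1 + t).
    rewrite (_ : z' + (1 + t) - Nc%:R - (1 + t) = z' - Nc%:R) in n2; last by ring.
    have n3 : `|1 + t| <= 2 by rewrite ler_norml; apply/andP; split; lra.
    by split; lra.
  have -> : count (fun q' => 0 <= position g t p q' <= Nc%:R) L =
            count (fun q' => 0 <= position g t (p + g * (1 + t)) q' <= Nc%:R) L.
    apply: eq_in_count => q' q'L; rewrite posS.
    have [|d1 d2] := clear q'; first by rewrite in_cons q'L orbT.
    rewrite sE in d1 d2; set z' := position _ _ _ _ in d1 d2 *.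
    move: d1 d2; have [e1|e1] := leP 0 z'; have [e2|e2] := leP z' Nc%:R => /=.
    - rewrite ger0_norm// ler0_norm ?subr_le0// => d1 d2.
      by apply/esym/andP; split; lra.
    - rewrite (ger0_norm e1) gtr0_norm ?subr_gt0// => d1 d2.
      by apply/esym/negbTE; rewrite negb_and -!ltNge; apply/orP; right; lra.
    - rewrite ltr0_norm// => d1 d2.
      by apply/esym/negbTE; rewrite negb_and -!ltNge; apply/orP; left; lra.
    - rewrite ltr0_norm// => d1 d2.
      by apply/esym/negbTE; rewrite negb_and -!ltNge; apply/orP; left; lra.
  apply: leq_trans (leq_add (bad_phases J0 sg zz) (IH _ clear')).
  rewrite -count_predUI; apply: leq_trans (leq_addr _ _); apply: sub_count => j /=.
  rewrite -negb_and; apply: contraNN => /andP[/asboolP[k [f [zE kN fJ]]] /asboolP hp].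
  by apply/asboolP; right; exists k, f; rewrite posE.
rewrite add0n; apply: leq_trans (IH p _); last first.
  move=> q' q'L; have [|d1 d2] := clear q'; first by rewrite in_cons q'L orbT.
  by rewrite sE in d1 d2; split; lra.
set z := position _ _ _ _ in c1 c2 zo posE *.
apply: sub_in_count => j; rewrite mem_iota add0n => /andP[_ jJ] /=.
apply: contraNN => /asboolP hp; apply/asboolP; left; split=> //; rewrite posE.
have jJ1 : j%:R / J%:R < 1 :> R by rewrite ltr_pdivrMr// mul1r ltr_nat.
have jJ0 : 0 <= j%:R / J%:R :> R by rewrite divr_ge0.
move: zo; rewrite negb_and -!ltNge => /orP[z0|zN].
  by left; rewrite ltr0_norm// in c1; case: sgR => ->; lra.
by right; rewrite gtr0_norm ?subr_gt0// in c2; case: sgR => ->; lra.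
Qed.

End Shifts.

(** * Finite unions, multiple coverings and sets of lines in measure *)

Section FiniteCovers.
Context {d : measure_display} {T : measurableType d} {R : realType}.
Variable m : {measure set T -> \bar R}.

Lemma measure_bigcup_seq (I : choiceType) (s : seq I) (F : I -> set T) :
  (forall i, i \in s -> measurable (F i)) ->
  measurable (\bigcup_(i in [set` s]) F i) /\
  (m (\bigcup_(i in [set` s]) F i) <= \sum_(i <- s) m (F i))%E.
Proof.
rewrite bigcup_seq; elim: s => [|i s IH] mF; first by rewrite !big_nil measure0.
have [|mU IHs] := IH; first by move=> k ks; apply: mF; rewrite in_cons ks orbT.
have mi : measurable (F i) by apply: mF; rewrite mem_head.
rewrite !big_cons; split; first exact: measurableU.
by apply: le_trans (measureU2 _ mi mU) _; rewrite leeD2l.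
Qed.

(** Both sums are integrals of counting functions, which the hypothesis compares pointwise. In this
    way a bound on the number of bad phases of each line becomes one on the measure lost in all
    phases together. *)
Lemma measure_multicover (I K : Type) (s : seq I) (r : seq K) (E : I -> set T)
    (F : K -> set T) (a : nat) :
  (forall i, measurable (E i)) -> (forall k, measurable (F k)) ->
  (forall x, (count (fun i => `[<E i x>]) s <= a * count (fun k => `[<F k x>]) r)%N) ->
  (\sum_(i <- s) m (E i) <= a%:R%:E * \sum_(k <- r) m (F k))%E.
Proof.
move=> mE mF EF.
have inG (A : set T) x : (x \in A) = `[<A x>] by apply/idP/asboolP; rewrite inE.
have sumE (J : Type) (s' : seq J) (G : J -> set T) : (forall j, measurable (G j)) ->
    (\sum_(j <- s') m (G j) = \int[m]_x ((count (fun j => `[<G j x>]) s')%:R : R)%:E)%E.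
  move=> mG; transitivity (\sum_(j <- s') \int[m]_x (\1_(G j) x : R)%:E)%E.
    by apply: eq_bigr => j _; rewrite integral_indic// setIT.
  rewrite -ge0_integral_sum//.
  - apply: eq_integral => x _; rewrite -sum1_count natr_sum sumEFin; congr EFin.
    rewrite [RHS]big_mkcond /=; apply: eq_bigr => j _.
    by rewrite indicE inG; case: asboolP.
  - by move=> j; apply/measurable_EFinP; exact: measurable_indic.
have mcount (J : Type) (s' : seq J) (G : J -> set T) : (forall j, measurable (G j)) ->
    measurable_fun setT (fun x => ((count (fun j => `[<G j x>]) s')%:R : R)%:E).
  move=> mG; apply/measurable_EFinP.
  rewrite (_ : (fun _ => _) = (fun x => \sum_(j <- s') \1_(G j) x)).
    by apply: measurable_sum => j; exact: measurable_indic.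
  apply/funext => x; rewrite -sum1_count natr_sum big_mkcond /=; apply: eq_bigr => j _.
  by rewrite indicE inG; case: asboolP.
rewrite !sumE// -ge0_integralZl//; [|exact: mcount].
apply: ge0_le_integral => //.
- exact: mcount.
- by apply: emeasurable_funM => //; exact: mcount.
- by move=> x _; rewrite -EFinM lee_fin -natrM ler_nat.
Qed.

End FiniteCovers.

Section LineSets.
Context {R : realType}.
Local Notation pt := (R * R)%type.
Local Notation mu := (@lebesgue_measure R).
Local Notation angles_radii := (measurableTypeR R * measurableTypeR R)%type.
Local Notation mu2 := (@lebesgue_measure R \x @lebesgue_measure R)%E.

Lemma strip_measure (G : set angles_radii) (C : seq R) (lam c : R) : measurable G ->
  0 <= lam -> 0 <= c -> (forall p, G p -> near_points C lam p.1) ->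
  (forall a, near_points C lam a -> (mu (xsection G a) <= c%:E)%E) ->
  (mu2 G <= (2 * lam * (size C)%:R * c)%:E)%E.
Proof.
move=> mG lam0 c0 GC Gc; have mC := measurable_near_points C lam.
apply: (@le_trans _ _ (\int[mu]_a (c%:E * (\1_(near_points C lam) a : R)%:E))%E).
  apply: ge0_le_integral => //.
  - exact: measurable_fun_xsection.
  - apply: emeasurable_funM => //; apply/measurable_EFinP; exact: measurable_indic.
  - move=> a _ /=; rewrite indicE; have [aC|aC] := pselect (near_points C lam a).
      by rewrite mem_set// mule1; exact: Gc.
    rewrite memNset// mule0 (_ : xsection G a = set0) ?measure0//.
    by apply/seteqP; split=> // r /xsectionP/GC.
rewrite ge0_integralZl_EFin//; last by apply/measurable_EFinP; exact: measurable_indic.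
rewrite integral_indic// setIT [(_ * c)%R]mulrC EFinM.
by apply: lee_wpmul2l; [rewrite lee_fin|exact: measure_near_points].
Qed.

Lemma cw_lineN (p : angles_radii) : cw_line p = (- (ccw_line p).1, (ccw_line p).2).
Proof. by rewrite cw_lineE ccw_lineE; congr pair; apply: pt_eq; rewrite /= ?opprK. Qed.

(** Invariance under reversal lets both parametrizations be treated alike, hence the outer factor 2.
    Each share is bounded by Fubini: the measure of the admissible angles times a bound [c] for the
    radii at a fixed angle. *)
Lemma Lambda_strip (E : set (pt * pt)) (C : seq R) (lam c : R) : measurable E ->
  (forall v w, E (v, w) -> E (- v, w)) -> 0 <= lam -> 0 <= c ->
  (forall a r, 0 <= a < pi *+ 2 -> 0 <= r -> E (ccw_line (a, r)) -> near_points C lam a) ->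
  (forall a, 0 <= a < pi *+ 2 -> exists2 S, measurable S /\ (mu S <= c%:E)%E &
     forall r, 0 <= r -> E (ccw_line (a, r)) -> S r) ->
  (Lambda E <= (2 * (2 * lam * (size C)%:R * c))%:E)%E.
Proof.
move=> mE symE lam0 c0 EC Ec.
have ED p : polar_domain p -> 0 <= p.1 < pi *+ 2 /\ 0 <= p.2.
  by rewrite /polar_domain /= !in_itv /= andbT => -[].
have bound f : measurable_fun [set: angles_radii] f ->
    (forall p, E (f p) -> E (ccw_line p)) ->
    (mu2 (polar_domain `&` f @^-1` E) <= (2 * lam * (size C)%:R * c)%:E)%E.
  move=> mf fE; have mG : measurable (polar_domain `&` f @^-1` E).
    apply: measurableI; first exact: measurable_polar_domain.
    by rewrite -[_ @^-1` _]setTI; exact: mf.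
  apply: strip_measure => //.
    by move=> [a r] [/ED[/= a2 r0] /fE]; exact: EC.
  move=> a _; have [a2|a2] := boolP (0 <= a < pi *+ 2).
    have [S [mS Sc] ES] := Ec a a2; apply: le_trans Sc.
    apply: le_measure; rewrite ?inE//; first exact: measurable_xsection.
    by move=> r /xsectionP[/ED[_ r0] /fE]; exact: ES.
  rewrite (_ : xsection _ a = set0) ?measure0 ?lee_fin//.
  by apply/seteqP; split=> // r /xsectionP[/ED[/= a2']]; rewrite a2' in a2.
rewrite /Lambda mulr2n mulrDl !mul1r EFinD leeD//; apply: bound.
- exact: measurable_ccw_line.
- by [].
- exact: measurable_cw_line.
move=> p; rewrite cw_lineN => /symE; rewrite opprK.
by rewrite -surjective_pairing.
Qed.

Lemma measurable_inv : measurable_fun [set: R] (fun x : R => x^-1).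
Proof.
rewrite -(setvU [set 0 : R]); apply/measurable_funU => //.
  by apply: measurableC.
split; last exact: measurable_fun_set1.
apply: open_continuous_measurable_fun.
  rewrite openC; exact: closed_eq.
by move=> x /set_mem /= /eqP x0; apply: cvgV => //; exact: cvg_id.
Qed.

End LineSets.

(** * Coordinates of lines and measurability *)

Section LineCoordinates.
Context {R : realType}.
Local Notation pt := (R * R)%type.
Implicit Types (d : pt * pt) (v : pt).

Definition normal v : pt := (v.2, - v.1).
Definition offset d : R := dot d.2 (normal d.1).
(** When [d.1.2] is nonzero the line is [x = xcut d + slope d * y]; reversing its direction changes
    neither number. *)
Definition slope d : R := d.1.1 / d.1.2.
Definition xcut d : R := offset d / d.1.2.

Lemma normal_rotate a v : normal (rotate a v) = rotate a (normal v).
Proof. by apply: pt_eq; rewrite /normal !rotateE /=; ring. Qed.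

Lemma offset_rotate a d : offset (rotate2 a d) = offset d.
Proof. by rewrite /offset normal_rotate dot_rotate. Qed.

Lemma directed_dot d : directed_lines d -> d.1.1 * d.1.1 + d.1.2 * d.1.2 = 1.
Proof.
move=> [_]; rewrite /enorm /dot => /(congr1 (fun z => z ^+ 2)).
by rewrite sqr_sqrtr ?expr1n// -!expr2 addr_ge0 ?sqr_ge0.
Qed.

Lemma foot_offset d : directed_lines d -> d.2 = offset d *: normal d.1.
Proof.
move=> Wd; have n1 := directed_dot Wd; have [h1 _] := Wd.
have h2 : d.1.2 * d.2.2 = - (d.1.1 * d.2.1) by rewrite /dot in h1; lra.
have h3 : d.1.1 * d.2.1 = - (d.1.2 * d.2.2) by lra.
apply: pt_eq; rewrite !coordE /offset /dot /normal /=.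
  transitivity (d.2.1 * (d.1.2 * d.1.2) - d.1.1 * (d.1.2 * d.2.2)); last by ring.
  by rewrite h2 -[LHS]mulr1 -n1; ring.
transitivity (- (d.1.2 * (d.1.1 * d.2.1)) + d.2.2 * (d.1.1 * d.1.1)); last by ring.
by rewrite h3 -[LHS]mulr1 -n1; ring.
Qed.

Lemma slope_dirE d : directed_lines d -> 0 < d.1.2 -> slope_dir (slope d) = d.1.
Proof.
move=> Wd b0; have n1 := directed_dot Wd.
have -> : slope_dir (slope d) = d.1.2 *: (slope d, 1).
  congr (_ *: _); rewrite /slope.
  have -> : 1 + (d.1.1 / d.1.2) ^+ 2 = (d.1.2 ^+ 2)^-1.
    rewrite -{1}(mulfV (lt0r_neq0 b0)) -[X in _ = X^-1]mulr1 -[X in _ = (_ * X)^-1]n1.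
    move: n1 => n1'; have e0 : d.1.2 != 0 by rewrite gt_eqF.
    rewrite n1' mulr1; apply: (mulIf (_ : d.1.2 ^+ 2 != 0)); first by rewrite sqrf_eq0.
    rewrite mulVf ?sqrf_eq0// -n1'; field; exact: e0.
  by rewrite sqrtrV ?sqr_ge0// sqrtr_sqr gtr0_norm// invrK.
by apply: pt_eq; rewrite !coordE /= ?mulr1// /slope mulrC divfK// gt_eqF.
Qed.

Lemma line_through_xcut d p : directed_lines d -> 0 < d.1.2 ->
  line_through (p, 0) (slope_dir (slope d)) = (d.1, (p * d.1.2) *: normal d.1).
Proof.
move=> Wd b0; have n1 := directed_dot Wd; rewrite slope_dirE// /line_through; congr pair.
apply: pt_eq; rewrite !coordE /dot /normal /=; last by ring.
by rewrite -[p in LHS]mulr1 -{1}n1; ring.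
Qed.

Lemma line_of_slope d : directed_lines d -> 0 < d.1.2 ->
  d = line_through (xcut d, 0) (slope_dir (slope d)).
Proof.
move=> Wd b0; rewrite line_through_xcut// /xcut divfK ?gt_eqF// -foot_offset//.
by rewrite -surjective_pairing.
Qed.

Lemma enorm_normal v s : dot v v = 1 -> enorm (s *: normal v) = `|s|.
Proof.
move=> v1; rewrite /enorm (_ : dot _ _ = s ^+ 2) ?sqrtr_sqr//.
by rewrite -[RHS]mulr1 -v1 /dot !coordE /=; ring.
Qed.

Lemma xcut_move d p : directed_lines d -> 0 < d.1.2 ->
  enorm (d.2 - (line_through (p, 0) (slope_dir (slope d))).2) <= `|p - xcut d|.
Proof.
move=> Wd b0; have n1 := directed_dot Wd; rewrite line_through_xcut//= foot_offset//.
have {1}-> : offset d = xcut d * d.1.2 by rewrite divfK// gt_eqF.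
have b1 : d.1.2 <= 1.
  rewrite -(@ler_pXn2r _ 2) ?nnegrE ?(ltW b0)// expr1n -n1 -!expr2 lerDr.
  exact: sqr_ge0.
rewrite -scalerBl enorm_normal// -mulrBl normrM distrC (gtr0_norm b0).
exact: ler_piMr.
Qed.

End LineCoordinates.

Section MeasurablePasses.
Context {d : measure_display} {T : measurableType d} {R : realType}.
Local Notation pt := (R * R)%type.

Lemma measurable_set_le (f h : T -> R) : measurable_fun setT f -> measurable_fun setT h ->
  measurable [set x | f x <= h x].
Proof.
move=> mf mh; have := measurable_fun_ler mf mh measurableT (Y := [set true]) I.
by rewrite setTI; apply.
Qed.

Lemma measurable_set_lt (f h : T -> R) : measurable_fun setT f -> measurable_fun setT h ->
  measurable [set x | f x < h x].
Proof.
move=> mf mh; have := measurable_fun_ltr mf mh measurableT (Y := [set true]) I.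
by rewrite setTI; apply.
Qed.

Lemma measurable_passes (g : R) (Nc J : nat) (L : seq pt) (f h : T -> R) :
  measurable_fun setT f -> measurable_fun setT h ->
  measurable [set x | passes g (f x) Nc J (h x) L].
Proof.
move=> mf; elim: L h => [|q L IH] h mh /=; first exact: measurableT.
pose z x := (h x + f x * q.2 - q.1) / g.
have mz : measurable_fun setT z.
  apply: measurable_funM => //; apply: measurable_funB => //; apply: measurable_funD => //.
  exact: measurable_funM.
have mh' : measurable_fun setT (fun x => h x + g * (1 + f x)).
  by apply: measurable_funD => //; apply: measurable_funM => //; exact: measurable_funD.
rewrite (_ : [set x | _] = (([set x | z x < 0] `|` [set x | Nc%:R + 1 < z x]) `&`
    [set x | passes g (f x) Nc J (h x) L]) `|`
  ((\bigcup_(k in [set k | (k.+1 < Nc)%N])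
     ([set x | J%:R^-1 <= z x - k%:R] `&` [set x | z x - k%:R <= 1 - J%:R^-1])) `&`
   [set x | passes g (f x) Nc J (h x + g * (1 + f x)) L])).
  apply: measurableU; apply: measurableI; [|exact: IH| |exact: IH].
    by apply: measurableU; apply: measurable_set_lt.
  apply: bigcup_measurable => k _; apply: measurableI; apply: measurable_set_le => //;
    exact: measurable_funB.
apply/seteqP; split=> x /=.
  move=> [[zo hp]|[k [f' [zE kN /andP[f1 f2] hp]]]]; [by left|right].
  by split=> //; exists k => //=; rewrite /z zE addrAC subrr add0r.
move=> [[zo hp]|[[k kN [/= z1 z2]] hp]]; [by left|right].
by exists k, (z x - k%:R); split=> //; [rewrite -/(z x); ring | rewrite z1 z2].
Qed.

End MeasurablePasses.

(** * Combs traversed from the other side *)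

Section Flip.
Context {R : realType}.
Local Notation pt := (R * R)%type.
Implicit Types (L : seq pt) (q : pt) (M : seq (pt * pt)).

Definition swap (m : pt * pt) : pt * pt := (m.2, m.1).

(** The rotation by [pi] exchanges the two endpoints of a tooth, so lists of mirrors are compared up
    to orientation. *)
Definition same_mirrors M M' :=
  (forall m, m \in M -> m \in M' \/ swap m \in M') /\
  (forall m, m \in M' -> m \in M \/ swap m \in M).

Lemma segment_swap m z : segment (swap m) z -> segment m z.
Proof.
move=> [s /=]; rewrite in_itv /= => s01 <-; exists (1 - s).
  by rewrite /= in_itv /=; apply/andP; split; lra.
by rewrite addrC subKr.
Qed.

Lemma specular_swap m u v : specular (swap m) u v -> specular m u v.
Proof.
rewrite /specular /swap /dot /= => -[h1 h2].
by split; lra.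
Qed.

Lemma transformation_same M M' d d' : same_mirrors M M' ->
  transformation M d d' -> transformation M' d d'.
Proof.
move=> [MM' M'M] [Wd Wd' [g [[cg pg rg] eg gT gT']]].
have ee x : endpoint M' x -> endpoint M x.
  move=> [m /M'M[mM|mM] mx]; first by exists m.
  by exists (swap m) => //; case: mx => ->; [right|left].
have ue x : mirror_union M x -> mirror_union M' x.
  move=> [m /MM'[mM|mM] mx]; first by exists m.
  by exists (swap m) => //; apply: segment_swap; case: m mx {mM}.
split=> //; exists g; split=> //; last by move=> t /ee; exact: eg.
split=> // t _; have [u [u' [hi ho hn hm]]] := rg t (eg t).
exists u, u'; split=> //; first by move=> nM; apply: hn => /ue.
move=> m /M'M[mM|mM] mt; first exact: hm.
apply: specular_swap; apply: hm => //.
by apply: segment_swap; case: m mt {mM}.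
Qed.

(* The rotation by [pi] maps the comb based at [q] to the one based at
   [flip_point g Nc q]. *)
Definition flip_point (g : R) (Nc : nat) q : pt := (- q.1 - Nc%:R * g, - q.2 - g).

(** The list is reversed to keep the heights increasing after the rotation. *)
Definition flip (g : R) (Nc : nat) L : seq pt := rev (map (flip_point g Nc) L).

Lemma mem_flip g Nc L q : q \in flip g Nc L ->
  exists2 q', q' \in L & q = flip_point g Nc q'.
Proof. by rewrite mem_rev => /mapP. Qed.

Lemma flip_mem g Nc L q : q \in L -> flip_point g Nc q \in flip g Nc L.
Proof. by move=> qL; rewrite mem_rev; apply/mapP; exists q. Qed.

Lemma tooth_flip g (Nc k : nat) q : (k < Nc)%N ->
  rotate2 pi (tooth g q k) =
  swap (tooth g (flip_point g Nc q) (Nc.-1 - k)).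
Proof.
move=> kN; have E : Nc%:R = (Nc.-1 - k)%:R + k%:R + 1 :> R.
  by rewrite -natrD natr1; congr (_%:R); lia.
rewrite /rotate2 /swap /tooth /flip_point E /=; congr pair; apply: pt_eq;
  rewrite /rotate /= cospi sinpi; ring.
Qed.

Lemma pairwise_rev (T : Type) (r : rel T) (s : seq T) :
  pairwise r (rev s) = pairwise (fun x y => r y x) s.
Proof. by elim: s => //= x s IH; rewrite rev_cons pairwise_rcons all_rev IH. Qed.

Lemma pairwise_flip g Nc (e : R) L : pairwise (fun q q' => q.2 + e < q'.2) L ->
  pairwise (fun q q' => q.2 + e < q'.2) (flip g Nc L).
Proof.
rewrite /flip pairwise_rev pairwise_map; apply: sub_pairwise => q q' /=.
by move=> h; lra.
Qed.

Lemma flip_shift g Nc (e : R) L : flip g Nc (shift e L) = shift (- e) (flip g Nc L).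
Proof.
rewrite /flip /shift map_rev -!map_comp; congr rev; apply: eq_map => q /=.
by rewrite /flip_point /=; congr pair; ring.
Qed.

(** The term [t] appears because the base of the rotated comb is the old top, at height [g] above
    the old base. *)
Lemma position_flip (g t p : R) Nc q : 0 < g ->
  position g t (- p) (flip_point g Nc q) = Nc%:R - t - position g t p q.
Proof. by move=> g0; rewrite /position /=; field; rewrite gt_eqF. Qed.

End Flip.

(** * Cones of directions and tangents *)

Section Trigonometry.
Context {R : realType}.
Local Notation pt := (R * R)%type.
Implicit Types (x y c : R).

Lemma sin_mul_le k y : 0 <= y -> k%:R * y <= pi -> sin (k%:R * y) <= k%:R * sin y.
Proof.
move=> y0; elim: k => [|k IH] ky; first by rewrite !mul0r sin0.
have ky' : k%:R * y <= pi by apply: le_trans ky; rewrite ler_wpM2r// ler_nat.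
have yk : y <= pi by apply: le_trans ky; rewrite ler_peMl// ler1n.
have s1 : 0 <= sin (k%:R * y) by apply: sin_ge0_pi; rewrite mulr_ge0.
have s2 : 0 <= sin y by apply: sin_ge0_pi; rewrite y0.
rewrite -natr1 !mulrDl !mul1r sinD lerD//.
  by apply: le_trans (IH ky'); rewrite ler_piMr// cos_le1.
by rewrite ler_piMl// cos_le1.
Qed.

(** With [x = m.-1 * y] and [x' = m * y] the quotient is [sin x * cos x' / sin y], and
    [sin (k * y) <= k * sin y] bounds it whatever [y] is. *)
Lemma tan_gap m y : (0 < m)%N -> 0 < y -> m%:R * y < pi / 2 ->
  [/\ 0 <= tan (m.-1%:R * y), tan (m.-1%:R * y) < tan (m%:R * y) &
      tan (m.-1%:R * y) / (tan (m%:R * y) - tan (m.-1%:R * y)) <= m%:R].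
Proof.
case: m => // k _ y0 ky /=; set x := k%:R * y; set x' := k.+1%:R * y in ky *.
have xx : x' = x + y by rewrite /x' -natr1 mulrDl mul1r.
have x0 : 0 <= x by rewrite mulr_ge0// ltW.
have pi0 : 0 < pi :> R := pi_gt0 R.
have c1 : 0 < cos x by apply: cos_gt0_pihalf; lra.
have c2 : 0 < cos x' by apply: cos_gt0_pihalf; lra.
have s0 : 0 <= sin x by apply: sin_ge0_pi; lra.
have sy : 0 < sin y by apply: sin_gt0_pi; lra.
have E : tan x' - tan x = sin y / (cos x' * cos x).
  have -> : sin y = sin x' * cos x - cos x' * sin x by rewrite -sinB xx addrAC subrr add0r.
  by rewrite /tan; field; rewrite !gt_eqF.
split; first by rewrite divr_ge0// ltW.
  by rewrite -subr_gt0 E divr_gt0// mulr_gt0.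
rewrite E; have -> : tan x / (sin y / (cos x' * cos x)) = sin x * cos x' / sin y.
  by rewrite /tan; field; rewrite !gt_eqF.
rewrite ler_pdivrMr//; apply: (@le_trans _ _ (sin x)).
  by rewrite ler_piMr// cos_le1.
apply: (@le_trans _ _ (k%:R * sin y)).
  by apply: sin_mul_le; [exact: ltW|rewrite -/x; lra].
by rewrite ler_pM2r// ler_nat.
Qed.

Lemma tan_small c : 0 < c -> exists n : nat, [/\ (1 < n)%N, tan (pi / (2 * n%:R)) <= c &
  pi / (2 * n%:R) <= pi / 4 :> R].
Proof.
move=> c0; have := @continuous_tan R 0; rewrite cos0 oner_neq0 => /(_ isT).
move=> /cvgrPdist_le /(_ c c0) [e /= e0 He].
have pi0 : 0 < pi :> R := pi_gt0 R.
pose n := (Num.trunc (pi / e)).+2; exists n.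
have n0 : 0 < n%:R :> R by rewrite ltr0n.
have ne : pi / (2 * n%:R) < e.
  rewrite ltr_pdivrMr ?mulr_gt0// mulrCA; apply: (@lt_le_trans _ _ (n%:R * e)).
    rewrite -ltr_pdivrMr//; apply: lt_trans (truncnS_gt _) _.
    by rewrite ltr_nat.
  by rewrite mulrC; have : 0 < e * n%:R by [rewrite mulr_gt0]; lra.
split=> //.
  have h : `|0 - pi / (2 * n%:R)| < e.
    by rewrite sub0r normrN gtr0_norm// divr_gt0// mulr_gt0.
  by have := He _ h; rewrite tan0 sub0r normrN; apply: le_trans; exact: ler_norm.
rewrite ler_pM2l// lef_pV2 ?posrE ?mulr_gt0//.
have : 2 <= n%:R :> R by rewrite ler_nat.
lra.
Qed.

Lemma abs_tan_ge x c : 0 < x < pi / 2 -> x <= c <= pi - x -> tan x * `|cos c| <= `|sin c|.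
Proof.
move=> /andP[x0 xp] /andP[c1 c2]; have pi0 : 0 < pi :> R := pi_gt0 R.
have cx : 0 < cos x by apply: cos_gt0_pihalf; lra.
have sc : 0 <= sin c by apply: sin_ge0_pi; lra.
have s1 : 0 <= sin (c - x) by apply: sin_ge0_pi; lra.
have s2 : 0 <= sin (c + x) by apply: sin_ge0_pi; lra.
rewrite sinB in s1; rewrite sinD in s2.
rewrite (ger0_norm sc) /tan mulrAC ler_pdivrMr//.
have [cc|cc] := leP 0 (cos c); first by rewrite ger0_norm//; lra.
by rewrite ltr0_norm//; lra.
Qed.

Lemma abs_tan_le x c : 0 <= x < pi / 2 -> `|c| <= x -> `|sin c| <= tan x * `|cos c|.
Proof.
move=> /andP[x0 xp]; rewrite ler_norml => /andP[c1 c2]; have pi0 : 0 < pi :> R := pi_gt0 R.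
have cx : 0 < cos x by apply: cos_gt0_pihalf; lra.
have s1 : 0 <= sin (x - c) by apply: sin_ge0_pi; lra.
have s2 : 0 <= sin (x + c) by apply: sin_ge0_pi; lra.
have cc : 0 <= cos c by apply: cos_ge0_pihalf; lra.
rewrite sinB in s1; rewrite sinD in s2.
rewrite (ger0_norm cc) /tan mulrAC ler_pdivlMr// -{1}(gtr0_norm cx) -normrM.
by rewrite ler_norml; apply/andP; split; lra.
Qed.

(** For [c >= 0], both [c + x] and [c - x] are at distance at least [x] from the multiples of [pi],
    whence [|u.1 * cos e| <= |u.2| * sin e] for these two values of [e]. The claim is a comparison
    of squares whose difference factors accordingly. *)
Lemma rotate_cone x c (u : pt) : 0 < x < pi / 2 -> 2 * x <= `|c| <= pi - 2 * x ->
  `|u.1| <= tan x * `|u.2| -> tan x * `|(rotate c u).2| <= `|(rotate c u).1|.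
Proof.
move=> xp; wlog c0 : c u / 0 <= c.
  move=> H cp ua; have [|c0] := leP 0 c; first by move=> c0; apply: H.
  have := H (- c) (- u.1, u.2); rewrite normrN oppr_ge0 (ltW c0) /= normrN => /(_ isT cp ua).
  rewrite ?rotateE /= cosN sinN.
  have -> : - u.1 * cos c - u.2 * - sin c = - (u.1 * cos c - u.2 * sin c) by ring.
  have -> : - u.1 * - sin c + u.2 * cos c = u.1 * sin c + u.2 * cos c by ring.
  by rewrite normrN.
rewrite (ger0_norm c0) => /andP[c1 c2] ua; have pi0 : 0 < pi :> R := pi_gt0 R.
have /andP[x0 xp2] := xp.
have cx : 0 < cos x by apply: cos_gt0_pihalf; lra.
have sx : 0 < sin x by apply: sin_gt0_pi; lra.
have key e : x <= e <= pi - x -> `|u.1 * cos e| <= `|u.2| * sin e.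
  move=> /andP[e1 e2]; have se : 0 <= sin e by apply: sin_ge0_pi; lra.
  have h : tan x * `|cos e| <= `|sin e| by apply: abs_tan_ge => //; rewrite e1 e2.
  rewrite normrM; apply: (@le_trans _ _ (tan x * `|u.2| * `|cos e|)).
    by rewrite ler_wpM2r.
  by rewrite mulrAC mulrC ler_wpM2l// -[leRHS](ger0_norm se).
have kP := key (c + x) ltac:(apply/andP; split; lra).
have kQ := key (c - x) ltac:(apply/andP; split; lra).
rewrite !rotateE; set p := (X in _ <= `|X|); set q := (X in _ * `|X| <= _).
have PE : p * cos x - q * sin x = u.1 * cos (c + x) - u.2 * sin (c + x).
  by rewrite /p /q cosD sinD; ring.
have QE : p * cos x + q * sin x = u.1 * cos (c - x) - u.2 * sin (c - x).
  by rewrite /p /q cosB sinB; ring.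
(* [(p cos x)^2 - (q sin x)^2] is the product of two numbers of the same sign. *)
rewrite /tan mulrAC ler_pdivrMr// -{1}(gtr0_norm sx) -{1}(gtr0_norm cx) -!normrM.
rewrite -ler_sqr ?nnegrE// !real_normK ?num_real// -subr_ge0.
have -> : (p * cos x) ^+ 2 - (sin x * q) ^+ 2 =
  (p * cos x - q * sin x) * (p * cos x + q * sin x) by ring.
rewrite PE QE; move: kP kQ; rewrite !ler_norml => /andP[P1 P2] /andP[Q1 Q2].
have [u2|u2] := leP 0 u.2.
  move: P1 P2 Q1 Q2; rewrite ger0_norm// => P1 P2 Q1 Q2.
  by apply: mulr_le0; rewrite subr_le0.
move: P1 P2 Q1 Q2; rewrite ltr0_norm// !mulNr !opprK => P1 P2 Q1 Q2.
by apply: mulr_ge0; rewrite subr_ge0.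
Qed.

End Trigonometry.

(** * Superposition of rotated stacks of combs *)

Section Gadgets.
Context {R : realType}.
Local Notation pt := (R * R)%type.
Implicit Types (d : pt * pt) (v z : pt) (M : seq (pt * pt)).

Lemma line_rotate b d z : line (rotate2 (- b) d) z -> line d (rotate b z).
Proof.
move=> [s _ <-]; exists s => //; rewrite /Gamma rotateD rotateZ !rotate_rotate subrr.
by rewrite !rotate0.
Qed.

Lemma rotate2K b d : rotate2 b (rotate2 (- b) d) = d.
Proof. by rewrite /rotate2 /= !rotate_rotate subrr !rotate0 -surjective_pairing. Qed.

Lemma same_mirrors_union M M' z : same_mirrors M M' -> mirror_union M z -> mirror_union M' z.
Proof.
move=> [MM' _] [m /MM'[mM|mM] mz]; first by exists m.
by exists (swap m) => //; apply: segment_swap; case: m mz {mM}.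
Qed.

Lemma dot_intercept d z : directed_lines d -> 0 < d.1.2 ->
  dot z (normal d.1) - offset d = (intercept (slope d) z - xcut d) * d.1.2.
Proof.
move=> Wd b0; rewrite mulrBl divfK ?gt_eqF//; congr (_ - _).
rewrite /intercept /slope /dot /normal /=; field; by rewrite gt_eqF.
Qed.

Lemma rotate_subpi b z : rotate (b - pi) z = - rotate b z.
Proof.
have E : rotate (b - pi + pi) z = - rotate (b - pi) z.
  by apply: pt_eq; rewrite !rotateE cosDpi sinDpi; ring.
by rewrite -[b in RHS](subrK pi) E opprK.
Qed.

Lemma flip_pointK g Nc q : flip_point g Nc (flip_point g Nc q) = q :> pt.
Proof. by apply: pt_eq; rewrite /flip_point /=; ring. Qed.

Lemma rotate2_addpi g Nc k (q : pt) b : (k < Nc)%N -> rotate2 (b + pi) (tooth g q k) =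
  swap (rotate2 b (tooth g (flip_point g Nc q) (Nc.-1 - k))).
Proof.
move=> kN; transitivity (rotate2 b (rotate2 pi (tooth g q k))).
  by rewrite /rotate2 /= !rotate_rotate.
by rewrite (tooth_flip _ _ kN).
Qed.

Variables (n : nat) (alpha : nat -> R) (g : R) (Nc J : nat) (L : seq pt).
Hypothesis g0 : 0 < g.
Hypothesis J0 : (0 < J)%N.

(* The rotated copies may overlap. *)
Definition gadgets : seq (pt * pt) :=
  [seq rotate2 (alpha i) m | i <- iota 0 n, m <- comb g Nc L].

Definition frame i d : pt * pt := rotate2 (- alpha i) d.

Let others j b := [seq rotate2 (alpha i - b) m | i <- [seq i <- iota 0 n | i != j],
                                              m <- comb g Nc L].

Let rotate2_rotate2 a b (m : pt * pt) : rotate2 a (rotate2 b m) = rotate2 (a + b) m.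
Proof. by rewrite /rotate2 /= !rotate_rotate. Qed.

Let same_frame j b L' : (j < n)%N ->
  same_mirrors (map (rotate2 b) (comb g Nc L')) (map (rotate2 (alpha j)) (comb g Nc L)) ->
  same_mirrors (map (rotate2 b) (comb g Nc L' ++ others j b)) gadgets.
Proof.
move=> jn [S1 S2]; split=> m.
  rewrite map_cat mem_cat => /orP[/S1[/mapP[m' m'L ->]|/mapP[m' m'L mE]]|].
  - by left; apply/allpairsP; exists (j, m'); rewrite mem_iota.
  - by right; apply/allpairsP; exists (j, m'); rewrite mem_iota.
  move=> /mapP[_ /allpairsP[[i m'] /= [+ m'L ->]] ->].
  rewrite mem_filter => /andP[_ iN]; left; apply/allpairsP; exists (i, m'); split=> //=.
  by rewrite rotate2_rotate2 addrC subrK.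
move=> /allpairsP[[i m'] /= [iN m'L ->]]; have [<-|ij] := eqVneq j i.
  have : rotate2 (alpha j) m' \in map (rotate2 (alpha j)) (comb g Nc L) by exact: map_f.
  by move=> /S2[h|h]; [left|right]; rewrite map_cat mem_cat h.
left; rewrite map_cat mem_cat; apply/orP; right; apply/mapP.
exists (rotate2 (alpha i - b) m'); last by rewrite rotate2_rotate2 addrC subrK.
by apply/allpairsP; exists (i, m'); rewrite mem_filter eq_sym ij.
Qed.

(** After rotation by [- b] the copy [j] becomes the comb of [L']. For a point of another copy, the
    distance to the line is the difference of intercepts times a coordinate of a unit vector, so a
    lower bound on distances passes to intercepts. [b] and [L'] are left free to serve both
    orientations of the line. *)
Let rotated_ray j b L' d : (j < n)%N -> directed_lines d ->
  same_mirrors (map (rotate2 b) (comb g Nc L')) (map (rotate2 (alpha j)) (comb g Nc L)) ->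
  size L' = size L -> pairwise (fun q q' => q.2 + 4 * g < q'.2) L' ->
  let d' := rotate2 (- b) d in
  0 < d'.1.2 -> 2 * `|slope d'| * J%:R < 1 ->
  passes g (slope d') Nc J (xcut d') L' ->
  (forall i z, (i < n)%N -> i != j -> mirror_union (comb g Nc L) z ->
     2 * g * (size L)%:R < `|dot z (normal (frame i d).1) - offset d|) ->
  (exists2 w, transformation gadgets d (d.1, w) & enorm (d.2 - w) <= 2 * g * (size L)%:R) /\
  ((exists2 q, q \in L' & 0 <= position g (slope d') (xcut d') q <= Nc%:R + 1) ->
     line d `&` mirror_union gadgets !=set0).
Proof.
move=> jn Wd S sL sep d' b0 tJ hp clear.
have Wd' : directed_lines d' by exact: directed_lines_rotate.
have dK : rotate2 b d' = d by exact: rotate2K.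
pose M' := comb g Nc L' ++ others j b.
have SM : same_mirrors (map (rotate2 b) M') gadgets by exact: same_frame.
have ML q k : q \in L' -> (k < Nc)%N -> tooth g q k \in M'.
  by move=> qL kN; rewrite mem_cat; apply/orP; left; apply/mem_comb; exists q, k.
have LM m : m \in M' -> (exists q k, [/\ q \in L', (k < Nc)%N & m = tooth g q k]) \/
    (forall z, segment m z ->
       2 * g * (size L')%:R < `|intercept (slope d') z - xcut d'|).
  rewrite mem_cat => /orP[/mem_comb|]; first by left.
  move=> /allpairsP[[i m'] /= [+ m'L ->]]; rewrite mem_filter mem_iota /= add0n.
  move=> /andP[ij iN]; right=> z mz.
  pose z0 := rotate (- (alpha i - b)) z.
  have zE : z = rotate (alpha i - b) z0 by rewrite rotate_rotate subrr rotate0.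
  have z0m : mirror_union (comb g Nc L) z0.
    by exists m' => //; apply/(@segment_rotate R (alpha i - b)); rewrite -zE.
  rewrite sL; apply: lt_le_trans (clear i z0 iN ij z0m) _.
  have -> : dot z0 (normal (frame i d).1) - offset d =
      (intercept (slope d') z - xcut d') * d'.1.2.
    rewrite -dot_intercept// offset_rotate; congr (_ - _).
    rewrite zE /frame /= !normal_rotate -(dot_rotate (alpha i)) -[RHS](dot_rotate b) !rotate_rotate.
    by rewrite !subrr !rotate0 [b + _]addrC subrK.
  rewrite normrM ler_piMr// gtr0_norm//.
  have := directed_dot Wd'; rewrite -!expr2 => n1.
  rewrite -(@ler_pXn2r _ 2) ?nnegrE ?(ltW b0)// expr1n -n1 lerDr.
  exact: sqr_ge0.
have pp : `|xcut d' - xcut d'| + 2 * g * (size L')%:R <= 2 * g * (size L')%:R.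
  by rewrite subrr normr0 add0r.
split.
  have [p' Tp pp'] := comb_path g0 J0 tJ sep ML LM pp hp.
  rewrite -line_of_slope// in Tp.
  have Td := transformation_same SM (transformation_rotate b Tp).
  rewrite dK line_through_xcut// in Td.
  exists (rotate b ((p' * d'.1.2) *: normal d'.1)).
    by move: Td; rewrite /rotate2 /= rotate_rotate subrr rotate0.
  have -> : d.2 = rotate b d'.2 by rewrite /d' /= rotate_rotate subrr rotate0.
  rewrite -rotateN -rotateD enorm_rotate.
  apply: le_trans (le_trans _ pp') _; last by rewrite sL.
  by have := xcut_move p' Wd' b0; rewrite line_through_xcut.
move=> cr; have [z [dz zM]] := crossed_comb_hit g0 J0 tJ ML (fun q qL => qL) hp cr.
rewrite -line_of_slope// in dz; exists (rotate b z); split; first exact: line_rotate.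
by apply: same_mirrors_union SM _; apply/mirror_union_rotate.
Qed.

(* [frame j d] may traverse the combs in either direction; in the second case
   it is rotated by [pi], together with the combs. *)
Lemma gadget_ray j d : (j < n)%N -> directed_lines d ->
  pairwise (fun q q' => q.2 + 4 * g < q'.2) L ->
  let d' := frame j d in
  d'.1.2 != 0 -> 2 * `|slope d'| * J%:R < 1 ->
  (0 < d'.1.2 -> passes g (slope d') Nc J (xcut d') L) ->
  (d'.1.2 < 0 -> passes g (slope d') Nc J (- xcut d') (flip g Nc L)) ->
  (forall i z, (i < n)%N -> i != j -> mirror_union (comb g Nc L) z ->
     2 * g * (size L)%:R < `|dot z (normal (frame i d).1) - offset d|) ->
  (exists2 w, transformation gadgets d (d.1, w) & enorm (d.2 - w) <= 2 * g * (size L)%:R) /\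
  ((exists2 q, q \in L & 1 <= position g (slope d') (xcut d') q <= Nc%:R - 1) ->
     line d `&` mirror_union gadgets !=set0).
Proof.
move=> jn Wd sep d' b0 tJ hp hm clear; move: b0; rewrite neq_lt => /orP[b0|b0].
  have flE : same_mirrors (map (rotate2 (alpha j + pi)) (comb g Nc (flip g Nc L)))
                          (map (rotate2 (alpha j)) (comb g Nc L)).
    split=> m /mapP[m0 /mem_comb[q [k [qL kN ->]]] ->]; right; apply/mapP.
      have [q' q'L ->] := mem_flip qL.
      exists (tooth g q' (Nc.-1 - k)).
        by apply/mem_comb; exists q', (Nc.-1 - k)%N; split=> //; lia.
      by rewrite (@rotate2_addpi g Nc k _ _ kN) flip_pointK.
    exists (tooth g (flip_point g Nc q) (Nc.-1 - k)).
      apply/mem_comb; exists (flip_point g Nc q), (Nc.-1 - k)%N.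
      by split=> //; [exact: flip_mem|lia].
    have kN' : (Nc.-1 - k < Nc)%N by lia.
    rewrite (@rotate2_addpi g Nc _ _ _ kN').
    by rewrite flip_pointK; congr (swap (rotate2 _ (tooth _ _ _))); lia.
  have dE : rotate2 (- (alpha j + pi)) d = (- d'.1, - d'.2).
    by rewrite /rotate2 opprD !rotate_subpi.
  have slE : slope (- d'.1, - d'.2) = slope d' by rewrite /slope /= invrN mulrNN.
  have xE : xcut (- d'.1, - d'.2) = - xcut d'.
    rewrite /xcut /= invrN mulrN; congr (- (_ / _)).
    by rewrite /offset /dot /normal /=; ring.
  have sep' := pairwise_flip g Nc sep.
  have := @rotated_ray j (alpha j + pi) (flip g Nc L) d jn Wd flE _ sep'.
  rewrite dE /= slE xE size_rev size_map => /(_ erefl).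
  rewrite oppr_gt0 => /(_ b0 tJ (hm b0) clear) [h1 h2]; split=> // -[q qL /andP[z1 z2]].
  apply: h2; exists (flip_point g Nc q); first exact: flip_mem.
  have t1 : `|slope d'| <= 1.
    have J1 : 1 <= J%:R :> R by rewrite ler1n.
    have : 2 * `|slope d'| * 1 <= 2 * `|slope d'| * J%:R.
      by apply: ler_wpM2l => //; rewrite mulr_ge0.
    by move: tJ; lra.
  (* The margin of one unit at both ends absorbs the slope term. *)
  rewrite position_flip//; move: t1; rewrite ler_norml => /andP[t1 t2].
  by apply/andP; split; lra.
have [] := @rotated_ray j (alpha j) L d jn Wd _ erefl sep b0 tJ (hp b0) clear.
  by split=> m mM; left.
move=> h1 h2; split=> // -[q qL /andP[z1 z2]]; apply: h2; exists q => //.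
by apply/andP; split; lra.
Qed.

End Gadgets.

(** * Measurability in the rotated frames; the rim and the foreign slats *)

Section MeasurableLines.
Context {R : realType}.
Local Notation pt := (R * R)%type.
Implicit Types (d : pt * pt) (f : pt * pt -> R).

Lemma measurable_coord : [/\ measurable_fun [set: pt * pt] (fun d => d.1.1),
  measurable_fun [set: pt * pt] (fun d => d.1.2),
  measurable_fun [set: pt * pt] (fun d => d.2.1) &
  measurable_fun [set: pt * pt] (fun d => d.2.2)].
Proof.
by split; apply: (measurableT_comp (f := _) (g := _));
  [exact: measurable_fst|exact: measurable_fst|exact: measurable_snd|exact: measurable_fst
  |exact: measurable_fst|exact: measurable_snd|exact: measurable_snd|exact: measurable_snd].
Qed.

Lemma measurable_frame (alpha : nat -> R) i :
  [/\ measurable_fun [set: pt * pt] (fun d => (frame alpha i d).1.1),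
  measurable_fun [set: pt * pt] (fun d => (frame alpha i d).1.2) &
  measurable_fun [set: pt * pt] (@offset R)].
Proof.
have [m1 m2 m3 m4] := measurable_coord; split.
- by apply: measurable_funB; apply: measurable_funM.
- by apply: measurable_funD; apply: measurable_funM.
- rewrite /offset /dot /normal /=.
  by apply: measurable_funD; apply: measurable_funM => //; exact: measurableT_comp.
Qed.

Lemma measurable_slope_xcut (alpha : nat -> R) i :
  measurable_fun [set: pt * pt] (fun d => slope (frame alpha i d)) /\
  measurable_fun [set: pt * pt] (fun d => xcut (frame alpha i d)).
Proof.
have [m1 m2 m3] := measurable_frame alpha i.
have mi : measurable_fun [set: pt * pt] (fun d => (frame alpha i d).1.2^-1).
  exact: (measurableT_comp measurable_inv).
split; first exact: measurable_funM.
rewrite (_ : (fun d => _) = (fun d => offset d * (frame alpha i d).1.2^-1)).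
  exact: measurable_funM.
by apply/funext => d; rewrite /xcut offset_rotate.
Qed.

Lemma measurable_set_eq f (c : R) : measurable_fun setT f -> measurable [set d | f d = c].
Proof. by move=> mf; have := mf measurableT [set c] (measurable_set1 c); rewrite setTI. Qed.

Lemma measurable_directed_lines : measurable (@directed_lines R).
Proof.
have [m1 m2 m3 m4] := measurable_coord.
rewrite (_ : directed_lines = [set d | dot d.1 d.2 = 0] `&` [set d | dot d.1 d.1 = 1]).
  by apply: measurableI; apply: measurable_set_eq; apply: measurable_funD;
    apply: measurable_funM.
apply/seteqP; split=> d [h1 h2]; split=> //; first exact: directed_dot.
by move: h2; rewrite /= /enorm => ->; rewrite sqrtr1.
Qed.

Lemma measurable_disc_lines : measurable (@disc_lines R).
Proof.
have [m1 m2 m3 m4] := measurable_coord.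
rewrite (_ : disc_lines = directed_lines `&` [set d | dot d.2 d.2 <= 1]).
  apply: measurableI; first exact: measurable_directed_lines.
  by apply: measurable_set_le => //; apply: measurable_funD; apply: measurable_funM.
apply/seteqP; split=> d [h1 h2]; split=> //; move: h2; rewrite /= /disc /= /enorm.
  by rewrite -{1}sqrtr1 ler_psqrt ?nnegrE// /dot -!expr2 addr_ge0 ?sqr_ge0.
by rewrite -{2}sqrtr1 ler_psqrt ?nnegrE// /dot -!expr2 addr_ge0 ?sqr_ge0.
Qed.

Lemma directed_linesN (v w : pt) : directed_lines (v, w) -> directed_lines (- v, w).
Proof.
have nE (a b : pt) : dot (- a) b = - dot a b by rewrite /dot /=; ring.
have nE' (a b : pt) : dot a (- b) = - dot a b by rewrite /dot /=; ring.
by move=> [/= h1 h2]; split; rewrite /= ?nE ?h1 ?oppr0// /enorm nE nE' opprK.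
Qed.

Lemma offsetN (v w : pt) : offset (- v, w) = - offset (v, w).
Proof. by rewrite /offset /dot /normal /=; ring. Qed.

Lemma frameN (alpha : nat -> R) i (v w : pt) :
  (frame alpha i (- v, w)).1 = - (frame alpha i (v, w)).1.
Proof. by rewrite /frame /= rotateN. Qed.

Lemma slopeN (alpha : nat -> R) i (v w : pt) :
  slope (frame alpha i (- v, w)) = slope (frame alpha i (v, w)).
Proof. by rewrite /slope frameN /= invrN mulrNN. Qed.

Lemma xcutN (alpha : nat -> R) i (v w : pt) :
  xcut (frame alpha i (- v, w)) = xcut (frame alpha i (v, w)).
Proof. by rewrite /xcut frameN !offset_rotate offsetN /= invrN mulrNN. Qed.

Lemma offset_ccw (a r : R) : offset (ccw_line (a, r)) = r.
Proof.
rewrite ccw_lineE /offset /dot /normal /= -[RHS]mulr1 -(cos2Dsin2 a); ring.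
Qed.

Lemma frame_ccw (alpha : nat -> R) i (a r : R) :
  (frame alpha i (ccw_line (a, r))).1 = (- sin (a - alpha i), cos (a - alpha i)).
Proof.
rewrite ccw_lineE /frame /rotate2 /rotate /=; apply: pt_eq => /=.
  by rewrite sinB cosN sinN; ring.
by rewrite cosB cosN sinN; ring.
Qed.

Lemma disc_offset d : disc_lines d -> `|offset d| <= 1.
Proof.
move=> [Wd]; rewrite /disc /= {1}foot_offset// enorm_normal//.
exact: directed_dot.
Qed.

Lemma frame_le1 (alpha : nat -> R) i d : directed_lines d ->
  `|(frame alpha i d).1.1| <= 1 /\ `|(frame alpha i d).1.2| <= 1.
Proof.
move=> Wd; have := directed_dot (directed_lines_rotate (- alpha i) Wd).
rewrite -!expr2 => n1.
by split; rewrite -(@ler_pXn2r _ 2) ?nnegrE// expr1n real_normK ?num_real//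
  -n1 ?lerDl ?lerDr sqr_ge0.
Qed.

Lemma near_pi (a : R) : 0 <= a < pi *+ 2 -> near_points [:: pi] pi a.
Proof.
move=> /andP[a0 a2]; exists pi; rewrite ?mem_head// ler_norml.
by rewrite mulr2n in a2; apply/andP; split; lra.
Qed.

(** The initial slats stop short of the circle so that their combs stay in the disc; the lines near
    the rim are given up in return. *)
Lemma rim_measure (c : R) : 0 <= c <= 1 ->
  let E := [set d : pt * pt | disc_lines d /\ 1 - c < `|offset d|] in
  measurable E /\ (Lambda E <= (4 * pi * c)%:E)%E.
Proof.
move=> /andP[c0 c1] E; have [_ _ mo] := measurable_frame (fun=> 0) 0.
have mE : measurable E.
  apply: measurableI; first exact: measurable_disc_lines.
  by apply: measurable_set_lt => //; apply: measurableT_comp.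
split=> //; apply: le_trans (@Lambda_strip _ _ [:: pi] pi c mE _ _ c0 _ _) _.
- move=> v w [[Wd dw] h]; rewrite /E /= offsetN normrN; split=> //; split=> //.
  exact: directed_linesN.
- exact: pi_ge0.
- by move=> a r a2 _ _; exact: near_pi.
- move=> a _; exists (near_points [:: 1 - c / 2] (c / 2)).
    split; first exact: measurable_near_points.
    apply: le_trans (measure_near_points _ _) _; first by rewrite divr_ge0.
    by rewrite lee_fin /=; lra.
  move=> r r0 [dd]; have := disc_offset dd; rewrite offset_ccw ger0_norm// => h1 h2.
  by exists (1 - c / 2); rewrite ?mem_head// ler_norml; apply/andP; split; lra.
- by rewrite lee_fin /=; lra.
Qed.

(** These lines come near the slats of copy [i] from outside its cone. At a fixed angle their radii
    belong to the shadow of [B] in a fixed direction, which the sundial makes small; it remains to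
    integrate over all angles. *)
Lemma kill_measure (alpha : nat -> R) i (T rho eta : R) (B : seq pt) : 0 <= eta ->
  (forall v : pt, `|v.1| <= 1 -> `|v.2| <= 1 -> T * `|v.1| <= `|v.2| ->
     (@lebesgue_measure R (shadow B rho v) <= eta%:E)%E) ->
  let E := [set d | [/\ directed_lines d,
    T * `|(frame alpha i d).1.2| <= `|(frame alpha i d).1.1| &
    exists2 b, b \in B & `|dot b (normal (frame alpha i d).1) - offset d| <= rho]] in
  measurable E /\ (Lambda E <= (4 * pi * eta)%:E)%E.
Proof.
move=> eta0 Bk E; have [m1 m2 m3] := measurable_frame alpha i.
have mE : measurable E.
  rewrite (_ : E = directed_lines `&` ([set d | T * `|(frame alpha i d).1.2| <=
      `|(frame alpha i d).1.1|] `&` \bigcup_(b in [set` B])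
      [set d | `|dot b (normal (frame alpha i d).1) - offset d| <= rho])).
    apply: measurableI; first exact: measurable_directed_lines.
    apply: measurableI.
      apply: measurable_set_le; last exact: measurableT_comp.
      by apply: measurable_funM => //; apply: measurableT_comp.
    rewrite bigcup_seq; apply: bigsetU_measurable => b _; apply: measurable_set_le => //.
    apply: measurableT_comp => //; apply: measurable_funB => //.
    by apply: measurable_funD; apply: measurable_funM => //; exact: measurable_funN m1.
  apply/seteqP; split=> d; first by move=> [h1 h2 [b bB hb]]; split=> //; split=> //; exists b.
  by move=> [h1 [h2 [b bB hb]]]; split=> //; exists b.
split=> //; apply: le_trans (@Lambda_strip _ _ [:: pi] pi eta mE _ _ eta0 _ _) _.
- move=> v w [h1 h2 [b bB hb]]; split; first exact: directed_linesN.
    by rewrite frameN /= !normrN.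
  exists b => //; rewrite frameN offsetN -normrN; move: hb; congr (`|_| <= _).
  by rewrite /dot /normal /=; ring.
- exact: pi_ge0.
- by move=> a r a2 _ _; exact: near_pi.
- move=> a _; pose d0 := ccw_line (a, 0 : R).
  have fE r : (frame alpha i (ccw_line (a, r))).1 = (frame alpha i d0).1 by rewrite !frame_ccw.
  have [n1 n2] := frame_le1 alpha i (directed_lines_ccw (a, 0)).
  have [h|h] := boolP (T * `|(frame alpha i d0).1.2| <= `|(frame alpha i d0).1.1|).
    exists (shadow B rho (normal (frame alpha i d0).1)).
      split; first exact: measurable_near_points.
      by apply: Bk; rewrite /= ?normrN.
    move=> r r0 [_ _ [b bB]]; rewrite fE offset_ccw => hb.
    by exists (dot b (normal (frame alpha i d0).1)) => //; apply/mapP; exists b.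
  exists set0; first by rewrite measure0 lee_fin.
  by move=> r r0 [_]; rewrite fE (negbTE h).
- by rewrite lee_fin /=; lra.
Qed.

End MeasurableLines.

(** * The exceptional lines *)

Section Windows.
Context {R : realType}.
Local Notation pt := (R * R)%type.
Variables (n : nat) (x delta : R).
Hypothesis x0 : 0 < x.
Hypothesis nx : 2 * n%:R * x = pi.
Hypothesis xpi : x < pi / 2.
Hypothesis deltaT : delta < tan x.

Definition axis (i : nat) : R := (2 * i%:R + 1) * x.

(* The lines that the copy number [j] is meant to block. *)
Definition core j (d : pt * pt) : Prop :=
  `|(frame axis j d).1.1| <= delta * `|(frame axis j d).1.2|.

Let pi0 : 0 < pi :> R := pi_gt0 R.

Let axis_itv j : (j < n)%N -> x <= axis j <= pi - x.
Proof.
move=> jn; rewrite /axis -nx; have : j.+1%:R <= n%:R :> R by rewrite ler_nat.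
rewrite -natr1 => h; have h1 : 0 <= j%:R * x by rewrite mulr_ge0// ltW.
have h2 : (j%:R + 1) * x <= n%:R * x by rewrite ler_pM2r.
by apply/andP; split; lra.
Qed.

Let steep (c : R) : x <= c <= pi - x -> `|sin c| <= delta * `|cos c| -> False.
Proof.
move=> cx h; have h1 : tan x * `|cos c| <= `|sin c| by apply: abs_tan_ge => //; rewrite x0.
have c0 : `|cos c| = 0.
  apply/eqP; rewrite eq_le normr_ge0 andbT -(pmulr_rle0 _ (_ : 0 < tan x - delta)) ?subr_gt0//.
  by rewrite mulrBl subr_le0; exact: le_trans h.
have s0 : `|sin c| = 0 by apply/eqP; rewrite eq_le normr_ge0 andbT (le_trans h)// c0 mulr0.
have := cos2Dsin2 c; rewrite (normr0_eq0 c0) (normr0_eq0 s0) expr0n /= addr0 => /eqP.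
by rewrite eq_sym oner_eq0.
Qed.

(** Outside the two windows the angle to axis [j] is at least [x] modulo [pi], so its tangent is at
    least [tan x > delta] in absolute value, against [core]. *)
Lemma core_window j a r : (j < n)%N -> 0 <= a < pi *+ 2 -> core j (ccw_line (a, r)) ->
  near_points [:: axis j; axis j + pi] x a.
Proof.
move=> jn /andP[a0 a2]; rewrite mulr2n in a2; have /andP[j1 j2] := axis_itv jn.
rewrite /core frame_ccw /= normrN; set c := a - axis j => hc.
have cE : a = axis j + c by rewrite /c; ring.
have hp : `|sin (c + pi)| <= delta * `|cos (c + pi)| by rewrite sinDpi cosDpi !normrN.
have hm : `|sin (c - pi)| <= delta * `|cos (c - pi)|.
  by rewrite -[c in `|sin c|](subrK pi) -[c in `|cos c|](subrK pi) sinDpi cosDpi !normrN in hc.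
have [h1|h1] := leP c (- x).
  by case: (@steep (c + pi)) => //; apply/andP; split; lra.
have [h2|h2] := leP c x.
  by exists (axis j); rewrite ?mem_head// cE opprD addrA subrr sub0r normrN ler_norml ltW.
have [h3|h3] := leP c (pi - x).
  by case: (@steep c) => //; apply/andP; split=> //; exact: ltW.
have [h4|h4] := leP c (pi + x).
  exists (axis j + pi); first by rewrite !inE eqxx orbT.
  by rewrite cE ler_norml; apply/andP; split; lra.
by case: (@steep (c - pi)) => //; apply/andP; split; lra.
Qed.

Lemma core_slope j d : 0 <= delta -> directed_lines d -> core j d ->
  (frame axis j d).1.2 != 0 /\ `|slope (frame axis j d)| <= delta.
Proof.
move=> delta0 Wd; rewrite /core => hc; set d' := frame axis j d in hc *.
have := directed_dot (directed_lines_rotate (- axis j) Wd); rewrite -/(frame axis j d) -/d' => n1.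
have b0 : d'.1.2 != 0.
  apply/eqP => b0; move: hc n1; rewrite b0 normr0 mulr0 normr_le0 => /eqP->.
  by rewrite mulr0 addr0 => /esym/eqP; rewrite oner_eq0.
split=> //; rewrite /slope normrM normrV ?unitfE// ler_pdivrMr//.
by rewrite normr_gt0.
Qed.

(** The angles lie in two windows of width [2 * x]. At a fixed angle, multiplying by the second
    coordinate of the direction, of size at most 1, confines the radius to an interval of length
    [2 * lam]. *)
Lemma slab_measure j (X Y lam : R) : (j < n)%N -> 0 <= delta -> 0 <= lam ->
  let E := [set d | [/\ directed_lines d, core j d &
    `|xcut (frame axis j d) + slope (frame axis j d) * Y - X| <= lam]] in
  measurable E /\ (Lambda E <= (16 * x * lam)%:E)%E.
Proof.
move=> jn delta0 lam0 E.
have [m1 m2 m3] := measurable_frame axis j; have [ms mx] := measurable_slope_xcut axis j.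
have mE : measurable E.
  rewrite (_ : E = directed_lines `&` ([set d | core j d] `&` [set d |
     `|xcut (frame axis j d) + slope (frame axis j d) * Y - X| <= lam])).
    apply: measurableI; first exact: measurable_directed_lines.
    apply: measurableI.
      apply: measurable_set_le; first exact: measurableT_comp.
      by apply: measurable_funM => //; apply: measurableT_comp.
    apply: measurable_set_le => //; apply: measurableT_comp => //.
    by apply: measurable_funB => //; apply: measurable_funD => //; exact: measurable_funM.
  by apply/seteqP; split=> d [h1 h2]; [split|case: h2].
split=> //; have lam2 : 0 <= 2 * lam by rewrite mulr_ge0.
apply: le_trans (@Lambda_strip _ _ [:: axis j; axis j + pi] x (2 * lam) mE _ (ltW x0) lam2 _ _) _.
- move=> v w [h1 h2 h3]; split; first exact: directed_linesN.
    by rewrite /core frameN /= !normrN.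
  by rewrite xcutN slopeN.
- by move=> a r a2 _ [_ h _]; exact: core_window h.
- move=> a _; pose d0 := (frame axis j (ccw_line (a, 0 : R))).1.
  exists (near_points [:: d0.2 * X - d0.1 * Y] lam).
    split; first exact: measurable_near_points.
    by apply: le_trans (measure_near_points _ _) _ => //; rewrite lee_fin /= mulr1.
  move=> r r0 [Wd hc]; have [b0 _] := core_slope delta0 Wd hc.
  have dE : (frame axis j (ccw_line (a, r))).1 = d0 by rewrite /d0 !frame_ccw.
  have [_ b1] := frame_le1 axis j Wd.
  rewrite /xcut /slope offset_rotate offset_ccw dE in b0 b1 * => h.
  exists (d0.2 * X - d0.1 * Y); rewrite ?mem_head//.
  have -> : d0.2 * X - d0.1 * Y - r = - (d0.2 * (r / d0.2 + d0.1 / d0.2 * Y - X)).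
    by field.
  rewrite normrN normrM; apply: le_trans h.
  by rewrite ler_piMl.
- by rewrite lee_fin /= -natr1; lra.
Qed.

Lemma direction_measure (y : R) : 0 < y <= x ->
  (forall c, `|c| <= x - y -> `|sin c| <= delta * `|cos c|) ->
  let E := [set d | disc_lines d /\ forall j, (j < n)%N -> ~ core j d] in
  measurable E /\ (Lambda E <= (4 * y * (2 * n%:R + 1))%:E)%E.
Proof.
move=> /andP[y0 yx] hy E.
have mE : measurable E.
  rewrite (_ : E = disc_lines `&` \bigcap_(j in [set j | (j < n)%N]) ~` [set d | core j d]).
    apply: measurableI; first exact: measurable_disc_lines.
    apply: bigcap_measurableType => j _; have [m1 m2 m3] := measurable_frame axis j.
    apply: measurableC; apply: measurable_set_le; first exact: measurableT_comp.
    by apply: measurable_funM => //; apply: measurableT_comp.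
  by apply/seteqP; split=> d [h1 h2].
(* The directions left over lie near the borders between neighbouring cones, which are the even
   multiples of [x]. *)
pose C := [seq 2 * i%:R * x | i <- iota 0 (2 * n + 1)].
split=> //; apply: le_trans (@Lambda_strip _ _ C y 1 mE _ (ltW y0) ler01 _ _) _.
- move=> v w [[Wd dw] h]; split; first by split=> //; exact: directed_linesN.
  by move=> j jn; rewrite /core frameN /= !normrN; exact: h.
- move=> a r /andP[a0 a2] _ [_ h]; rewrite mulr2n in a2.
  have ax : 0 <= a / (2 * x) by rewrite divr_ge0// mulr_ge0// ltW.
  have /andP[k1 k2] := truncn_itv ax; set k := Num.trunc _ in k1 k2.
  rewrite ler_pdivlMr ?mulr_gt0// in k1; rewrite ltr_pdivrMr ?mulr_gt0// in k2.
  have k3 : (k < 2 * n)%N.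
    rewrite -(ltr_nat R) natrM -(ltr_pM2r (_ : 0 < 2 * x)) ?mulr_gt0//.
    by apply: le_lt_trans k1 _; move: nx; lra.
  have near i : (i <= 2 * n)%N -> `|2 * i%:R * x - a| <= y -> near_points C y a.
    by move=> iN hi; exists (2 * i%:R * x) => //; apply/mapP; exists i; rewrite // mem_iota addn1.
  pose c := a - axis k.
  have [h1|h1] := ltP c (- (x - y)).
    apply: (near k); first exact: ltnW.
    by rewrite ler_norml; move: h1; rewrite /c /axis => h1; apply/andP; split; lra.
  have [h2|h2] := ltP (x - y) c.
    apply: (near k.+1) => //; rewrite -natr1 ler_norml.
    move: h2 k2; rewrite -natr1 /c /axis => h2 k2.
    by apply/andP; split; lra.
  have hc : `|sin c| <= delta * `|cos c| by apply: hy; rewrite ler_norml h1 h2.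
  have [kn|kn] := ltnP k n.
    by case: (h k kn); rewrite /core frame_ccw /= normrN.
  (* In the second half turn the cone is that of copy [k - n], traversed backwards, since
     [axis (k - n) = axis k - pi]. *)
  have kn' : (k - n < n)%N by rewrite ltn_subLR // addnn -mul2n.
  case: (h _ kn'); rewrite /core frame_ccw /= normrN.
  have -> : a - axis (k - n) = c + pi.
    by rewrite /c /axis natrB// -nx; ring.
  by rewrite sinDpi cosDpi !normrN.
- move=> a _; exists (near_points [:: 1 / 2] (1 / 2)).
    split; first exact: measurable_near_points.
    by apply: le_trans (measure_near_points _ _) _ => //; rewrite lee_fin /=; lra.
  move=> r r0 [dd _]; have := disc_offset dd; rewrite offset_ccw ger0_norm// => h1.
  by exists (1 / 2); rewrite ?mem_head// ler_norml; apply/andP; split; lra.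
- rewrite lee_fin size_map size_iota natrD natrM; lra.
Qed.

Lemma core_exclusive j i d : (j < n)%N -> (i < n)%N -> i != j -> core j d ->
  tan x * `|(frame axis i d).1.2| <= `|(frame axis i d).1.1|.
Proof.
move=> jn iN ij hc.
have -> : (frame axis i d).1 = rotate (axis j - axis i) (frame axis j d).1.
  by rewrite /frame /= rotate_rotate addrAC subrr add0r.
apply: rotate_cone; first by rewrite x0.
  have -> : axis j - axis i = (j%:R - i%:R) * (2 * x) by rewrite /axis; ring.
  rewrite normrM (gtr0_norm (_ : 0 < 2 * x)) ?mulr_gt0//.
  have h1 : 1 <= `|j%:R - i%:R| :> R.
    have [ji|ji|ji] := ltngtP i j; last by rewrite ji eqxx in ij.
      by rewrite -natrB ?(ltnW ji)// normr_nat ler1n subn_gt0.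
    by rewrite distrC -natrB ?(ltnW ji)// normr_nat ler1n subn_gt0.
  have h2 : `|j%:R - i%:R| <= n%:R - 1 :> R.
    have : j.+1%:R <= n%:R :> R by rewrite ler_nat.
    have : i.+1%:R <= n%:R :> R by rewrite ler_nat.
    have : 0 <= j%:R :> R by []. have : 0 <= i%:R :> R by [].
    rewrite -!natr1 ler_norml => ? ? ? ?; apply/andP; split; lra.
  have x2 : 0 <= 2 * x by rewrite mulr_ge0// ltW.
  rewrite -nx; apply/andP; split; first exact: ler_peMl.
  apply: (@le_trans _ _ ((n%:R - 1) * (2 * x))); last lra.
  by rewrite ler_wpM2r.
by apply: le_trans hc _; rewrite ler_wpM2r// ltW.
Qed.

End Windows.

(** * Averages, and the loss in each phase *)

Section Averaging.
Context {R : realType}.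

Lemma sum_gt (I : Type) (s : seq I) (f : I -> \bar R) (c : R) : (0 < size s)%N ->
  (forall i, (c%:E < f i)%E) -> ((c * (size s)%:R)%:E < \sum_(i <- s) f i)%E.
Proof.
move=> s0 cf; elim: s s0 => // i [|i' s] IH _.
  by rewrite big_seq1 mulr1.
rewrite big_cons [size _]/= -natr1 mulrDr mulr1 addrC EFinD.
by apply: lteD => //; exact: IH.
Qed.

Lemma sum_le (I : eqType) (s : seq I) (f : I -> \bar R) (c : R) :
  (forall i, i \in s -> (f i <= c%:E)%E) -> (\sum_(i <- s) f i <= (c * (size s)%:R)%:E)%E.
Proof.
elim: s => [|i s IH] h; first by rewrite big_nil mulr0.
have -> : c * (size (i :: s))%:R = c + c * (size s)%:R by rewrite /= -natr1; ring.
rewrite big_cons EFinD; apply: leeD; first by apply: h; rewrite mem_head.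
by apply: IH => k ks; apply: h; rewrite in_cons ks orbT.
Qed.

Lemma exists_le_average (I : eqType) (s : seq I) (f : I -> \bar R) (c : R) : (0 < size s)%N ->
  (\sum_(i <- s) f i <= (c * (size s)%:R)%:E)%E -> exists2 i, i \in s & (f i <= c%:E)%E.
Proof.
move=> s0 hs; apply: contrapT => no.
(* Infinite off the list, since [sum_gt] asks for a lower bound at every index. *)
pose f' i := if i \in s then f i else +oo%E.
have : ((c * (size s)%:R)%:E < \sum_(i <- s) f' i)%E.
  apply: sum_gt => // i; rewrite /f'; case: ifP => // iS; last exact: ltry.
  by rewrite ltNge; apply/negP => h; apply: no; exists i.
rewrite (_ : \sum_(i <- s) f' i = \sum_(i <- s) f i)%E; last first.
  by rewrite big_seq [RHS]big_seq; apply: eq_bigr => i iS; rewrite /f' iS.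
by move=> /lt_le_trans/(_ hs); rewrite ltxx.
Qed.

End Averaging.

Section Phases.
Context {R : realType}.
Local Notation pt := (R * R)%type.
Variables (n : nat) (x delta : R).
Hypothesis x0 : 0 < x.
Hypothesis nx : 2 * n%:R * x = pi.
Hypothesis xpi : x < pi / 2.
Hypothesis deltaT : delta < tan x.
Hypothesis delta01 : 0 <= delta <= 1.
Variables (g mm : R) (Nc J : nat) (L : seq pt).
Hypothesis g0 : 0 < g.
Hypothesis J0 : (0 < J)%N.
(** [count_bad_shifts] uses a margin of [2 * size L + 2]; one more unit covers the slope term of
    [position_flip] for reversed lines. *)
Hypothesis mmL : 2 * (size L)%:R + 3 <= mm.

Local Notation axis := (axis x).
Local Notation core := (core x delta).

Definition crossing j (d : pt * pt) q : R :=
  position g (slope (frame axis j d)) (xcut (frame axis j d)) q.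

Definition clear_ends j d : Prop :=
  forall q, q \in L -> mm < `|crossing j d q| /\ mm < `|crossing j d q - Nc%:R|.

Definition good_phase j (L' : seq pt) (d : pt * pt) : Prop :=
  let d' := frame axis j d in
  (0 < d'.1.2 -> passes g (slope d') Nc J (xcut d') L') /\
  (d'.1.2 < 0 -> passes g (slope d') Nc J (- xcut d') (flip g Nc L')).

Definition phase (k : nat) : R := k%:R / J%:R * g.

Lemma measurable_crossing j q :
  measurable_fun [set: pt * pt] (fun d => crossing j d q).
Proof.
have [ms mx] := measurable_slope_xcut axis j.
apply: measurable_funM => //; apply: measurable_funB => //; apply: measurable_funD => //.
exact: measurable_funM.
Qed.

Lemma measurable_forall_seq (I : choiceType) (s : seq I) (F : I -> set (pt * pt)) :
  (forall i, measurable (F i)) -> measurable [set d | forall i, i \in s -> F i d].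
Proof.
move=> mF; rewrite (_ : [set d | _] = ~` \bigcup_(i in [set` s]) ~` F i).
  apply: measurableC; rewrite bigcup_seq; apply: bigsetU_measurable => i _.
  exact: measurableC.
rewrite setC_bigcup; apply/seteqP; split=> d /= h i iS; first by rewrite setCK; exact: h.
by have := h i iS; rewrite setCK.
Qed.

Lemma measurable_good_phase j L' : measurable [set d | good_phase j L' d].
Proof.
have [_ mb _] := measurable_frame axis j; have [ms mx] := measurable_slope_xcut axis j.
rewrite (_ : [set d | _] =
  ([set d | (frame axis j d).1.2 <= 0] `|`
   [set d | passes g (slope (frame axis j d)) Nc J (xcut (frame axis j d)) L']) `&`
  ([set d | 0 <= (frame axis j d).1.2] `|`
   [set d | passes g (slope (frame axis j d)) Nc J (- xcut (frame axis j d)) (flip g Nc L')])).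
  apply: measurableI; apply: measurableU; [exact: measurable_set_le|exact: measurable_passes
    |exact: measurable_set_le|].
  by apply: measurable_passes => //; exact: measurableT_comp.
apply/seteqP; split=> d /=.
  move=> [h1 h2]; split; [case: (ltP 0 (frame axis j d).1.2)|case: (ltP (frame axis j d).1.2 0)];
    by [move=> /h1; right|move=> /h2; right|left].
by move=> [h1 h2]; split=> b0; [case: h1|case: h2]; rewrite // leNgt b0.
Qed.

Lemma measurable_core j : measurable [set d | core j d].
Proof.
have [ma mb _] := measurable_frame axis j.
apply: measurable_set_le; first exact: measurableT_comp.
by apply: measurable_funM => //; apply: measurableT_comp.
Qed.

Definition end_set j q : set (pt * pt) := [set d | [/\ directed_lines d, core j d &
  `|crossing j d q| <= mm \/ `|crossing j d q - Nc%:R| <= mm]].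

Let g_div (a b e : R) : `|a / g - b| <= e <-> `|a - b * g| <= e * g.
Proof.
have -> : a - b * g = (a / g - b) * g by rewrite mulrBl divfK ?gt_eqF.
by rewrite normrM (gtr0_norm g0) ler_pM2r.
Qed.

Lemma end_set_measure j q : (j < n)%N ->
  measurable (end_set j q) /\ (Lambda (end_set j q) <= (32 * x * (mm * g))%:E)%E.
Proof.
move=> jn; have /andP[d0 _] := delta01.
have mm0 : 0 <= mm * g.
  by rewrite mulr_ge0 ?(ltW g0)//; apply: le_trans mmL; rewrite addr_ge0// mulr_ge0.
have mE : measurable (end_set j q).
  rewrite (_ : end_set j q = directed_lines `&` ([set d | core j d] `&`
    ([set d | `|crossing j d q| <= mm] `|` [set d | `|crossing j d q - Nc%:R| <= mm]))).
    apply: measurableI; first exact: measurable_directed_lines.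
    apply: measurableI; first exact: measurable_core.
    apply: measurableU; apply: measurable_set_le => //; apply: measurableT_comp => //.
      exact: measurable_crossing.
    by apply: measurable_funB => //; exact: measurable_crossing.
  by apply/seteqP; split=> d [h1 h2]; [split|case: h2].
split=> //.
have [mS1 S1] := slab_measure x0 nx xpi deltaT q.1 q.2 jn d0 mm0.
have [mS2 S2] := slab_measure x0 nx xpi deltaT (q.1 + Nc%:R * g) q.2 jn d0 mm0.
have -> : 32 * x * (mm * g) = 16 * x * (mm * g) + 16 * x * (mm * g) by ring.
rewrite EFinD; apply: le_trans (leeD S1 S2); apply: le_trans (measureU2 _ mS1 mS2).
apply: le_measure; rewrite ?inE//; first exact: measurableU.
move=> d [Wd hc [h|h]]; [left|right]; split=> //; move: h; rewrite /crossing /position.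
  by rewrite -[X in `|X|]subr0 => /g_div; rewrite mul0r subr0.
by move=> /g_div; rewrite opprD addrA.
Qed.

Definition cross_set j q : set (pt * pt) := [set d | [/\ directed_lines d, core j d &
  0 <= crossing j d q <= Nc%:R]].

Lemma cross_set_measure j q : (j < n)%N ->
  measurable (cross_set j q) /\ (Lambda (cross_set j q) <= (8 * x * (Nc%:R * g))%:E)%E.
Proof.
move=> jn; have /andP[d0 _] := delta01.
have mm0 : 0 <= Nc%:R / 2 * g by rewrite mulr_ge0 ?(ltW g0)// divr_ge0.
have mE : measurable (cross_set j q).
  rewrite (_ : cross_set j q = directed_lines `&` ([set d | core j d] `&`
    ([set d | 0 <= crossing j d q] `&` [set d | crossing j d q <= Nc%:R]))).
    apply: measurableI; first exact: measurable_directed_lines.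
    apply: measurableI; first exact: measurable_core.
    by apply: measurableI; apply: measurable_set_le => //; exact: measurable_crossing.
  apply/seteqP; split=> d; first by move=> [h1 h2 /andP[h3 h4]].
  by move=> [h1 [h2 [/= h3 h4]]]; split=> //; rewrite h3.
split=> //.
have [mS S] := slab_measure x0 nx xpi deltaT (q.1 + Nc%:R / 2 * g) q.2 jn d0 mm0.
have -> : 8 * x * (Nc%:R * g) = 16 * x * (Nc%:R / 2 * g) by field.
apply: le_trans S; apply: le_measure; rewrite ?inE//.
move=> d [Wd hc /andP[h1 h2]]; split=> //.
suff : `|crossing j d q - Nc%:R / 2| <= Nc%:R / 2.
  by rewrite /crossing /position => /g_div; rewrite opprD addrA.
by rewrite ler_norml; apply/andP; split; lra.
Qed.

(* The lines that meet some tooth too close to its ends when the combs are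
   shifted by [phase k]. *)
Definition phase_set j k : set (pt * pt) := [set d | [/\ directed_lines d, core j d,
  clear_ends j d & ~ good_phase j (shift (phase k) L) d]].

Lemma measurable_phase_set j k : measurable (phase_set j k).
Proof.
rewrite (_ : phase_set j k = directed_lines `&` ([set d | core j d] `&`
  ([set d | forall q, q \in L -> ([set d | mm < `|crossing j d q|] `&`
       [set d | mm < `|crossing j d q - Nc%:R|]) d] `&`
   ~` [set d | good_phase j (shift (phase k) L) d]))).
  apply: measurableI; first exact: measurable_directed_lines.
  apply: measurableI; first exact: measurable_core.
  apply: measurableI; last by apply: measurableC; exact: measurable_good_phase.
  apply: measurable_forall_seq => q; apply: measurableI; apply: measurable_set_lt => //;
    apply: measurableT_comp => //; first exact: measurable_crossing.
  by apply: measurable_funB => //; exact: measurable_crossing.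
by apply/seteqP; split=> d; [move=> [h1 h2 h3 h4]|move=> [h1 [h2 [h3 h4]]]].
Qed.

(** A reversed line meets the flipped combs, whose shift has the opposite sign: hence the parameter
    [sgn] of [count_bad_shifts]. A comb is crossed if and only if its flip is, because the margins
    dominate the slope term. *)
Let count_phase_sets j d :
  (count (fun k => `[<phase_set j k d>]) (iota 0 J) <=
   2 * count (fun q => `[<cross_set j q d>]) L)%N.
Proof.
have [[Wd hc ce]|no] := pselect [/\ directed_lines d, core j d & clear_ends j d]; last first.
  rewrite (@eq_count _ _ pred0) ?count_pred0// => k.
  by apply/asboolP => -[h1 h2 h3 _]; apply: no.
have /andP[d0 d1] := delta01.
have [b0 t0] := core_slope d0 Wd hc.
have t1 : `|slope (frame axis j d)| <= 1 by exact: le_trans t0 d1.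
set t := slope _ in t0 t1; set p := xcut (frame axis j d).
have crossE : count (fun q => `[<cross_set j q d>]) L =
    count (fun q => 0 <= position g t p q <= Nc%:R) L.
  by apply: eq_count => q; apply/asboolP/idP => [[]|h] //.
rewrite crossE; move: b0; rewrite neq_lt => /orP[b0|b0]; last first.
  apply: leq_trans (@count_bad_shifts R g t p Nc J 1 L g0 t1 J0 (or_introl erefl) _).
    apply: sub_count => k /asboolP[_ _ _ no]; apply/asboolPn => hp; apply: no.
    by split=> [_|]; [rewrite mul1r in hp|rewrite ltNge (ltW b0)].
  by move=> q qL; have [h1 h2] := ce q qL; split; [move: h1|move: h2]; apply: le_lt_trans;
    move: mmL; lra.
have flE q : position g t (- p) (flip_point g Nc q) = Nc%:R - t - position g t p q.
  exact: position_flip.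
move: t1; rewrite ler_norml => /andP[t1 t2].
have big q : q \in L -> 2 * (size L)%:R + 3 < `|position g t p q| /\
    2 * (size L)%:R + 3 < `|position g t p q - Nc%:R|.
  by move=> qL; have [h1 h2] := ce q qL; split; exact: le_lt_trans mmL _.
have sL : 0 <= (size L)%:R :> R by [].
have countE : count (fun q => 0 <= position g t (- p) q <= Nc%:R) (flip g Nc L) =
    count (fun q => 0 <= position g t p q <= Nc%:R) L.
  rewrite count_rev count_map; apply: eq_in_count => q qL; rewrite /= flE.
  have [h1 h2] := big q qL; set z := position _ _ _ _ in h1 h2 *.
  move: h1 h2; have [e1|e1] := leP 0 z; have [e2|e2] := leP z Nc%:R => /=.
  - rewrite ger0_norm// ler0_norm ?subr_le0// => h1 h2.
    by apply/andP; split; lra.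
  - rewrite (ger0_norm e1) gtr0_norm ?subr_gt0// => h1 h2.
    by apply/negbTE; rewrite negb_and -!ltNge; apply/orP; left; lra.
  - rewrite ltr0_norm// => h1 h2.
    by apply/negbTE; rewrite negb_and -!ltNge; apply/orP; right; lra.
  - rewrite ltr0_norm// => h1 h2.
    by apply/negbTE; rewrite negb_and -!ltNge; apply/orP; right; lra.
rewrite -countE.
have t1' : `|t| <= 1 by rewrite ler_norml t1 t2.
apply: leq_trans (@count_bad_shifts R g t (- p) Nc J (-1) (flip g Nc L) g0 t1' J0
  (or_intror erefl) _).
  apply: sub_count => k /asboolP[_ _ _ no]; apply/asboolPn => hp; apply: no.
  split=> [|_]; first by rewrite ltNge (ltW b0).
  by move: hp; rewrite flip_shift /phase mulNr mul1r mulNr.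
move=> q /mem_flip[q' q'L ->]; rewrite flE /flip size_rev size_map.
have [h1 h2] := big q' q'L; set z := position _ _ _ _ in h1 h2 *.
have n3 : `|t| <= 1 by [].
split.
  have n1 := ler_normD (Nc%:R - t - z) t; rewrite (_ : _ + t = - (z - Nc%:R)) in n1; last by ring.
  by rewrite normrN in n1; lra.
have n1 := ler_normD (Nc%:R - t - z - Nc%:R) t; rewrite (_ : _ + t = - z) in n1; last by ring.
by rewrite normrN in n1; lra.
Qed.

(** The bound does not involve [J] although the sum has [J] terms: this is where a factor [1 / J] is
    gained on average. *)
Lemma phase_measure j : (j < n)%N ->
  (\sum_(k <- iota 0 J) Lambda (phase_set j k) <=
   (16 * x * (Nc%:R * g) * (size L)%:R)%:E)%E.
Proof.
move=> jn; apply: le_trans (measure_multicover _ _ _ (count_phase_sets j)) _.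
- by move=> k; exact: measurable_phase_set.
- by move=> q; have [] := @cross_set_measure j q jn.
have -> : 16 * x * (Nc%:R * g) * (size L)%:R = 2 * (8 * x * (Nc%:R * g) * (size L)%:R) by ring.
rewrite EFinM; apply: lee_wpmul2l => //.
by apply: sum_le => q _; have [] := @cross_set_measure j q jn.
Qed.

End Phases.

(** * The complete set of mirrors, for given parameters *)

Section Blinds.
Context {R : realType}.
Local Notation pt := (R * R)%type.

Lemma enorm_le_norm1 (z : pt) : enorm z <= norm1 z.
Proof.
rewrite /enorm -(ger0_norm (norm1_ge0 z)) -sqrtr_sqr ler_psqrt ?nnegrE ?sqr_ge0//; last first.
  by rewrite /dot -!expr2 addr_ge0 ?sqr_ge0.
rewrite /norm1 sqrrD !real_normK ?num_real// /dot -!expr2.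
by rewrite addrAC lerDl mulrn_wge0// mulr_ge0.
Qed.

Variables (n N J Nc : nat) (x delta kappa eta W rho g gap : R) (B Q : seq pt).
Hypothesis x0 : 0 < x.
Hypothesis nx : 2 * n%:R * x = pi.
Hypothesis xpi4 : x <= pi / 4.
Hypothesis deltaT : delta < tan x.
Hypothesis delta01 : 0 <= delta <= 1.
Hypothesis delta2 : delta ^+ 2 <= kappa / 2.
Hypothesis J0 : (0 < J)%N.
Hypothesis deltaJ : 2 * delta * J%:R < 1.
Hypothesis kappa01 : 0 < kappa <= 1.
Hypothesis directions : forall c, `|c| <= x - kappa * x -> `|sin c| <= delta * `|cos c|.
Hypothesis N0 : (0 < N)%N.
Hypothesis sizeB : size B = N.
Hypothesis W0 : 0 < W.
Hypothesis Wrho : W <= rho / 20.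
Hypothesis B_near : forall b, b \in B ->
  exists2 a, `|a| <= (2 - kappa) / 2 & norm1 (b - (a, 0)) + rho <= kappa / 8.
Hypothesis B_cover : forall t c, `|t| <= delta -> `|c| <= (2 - kappa) / 2 ->
  exists2 b, b \in B & intercept t b <= c <= intercept t b + W.
Hypothesis eta0 : 0 <= eta.
Hypothesis B_shadow : forall v : pt, `|v.1| <= 1 -> `|v.2| <= 1 -> tan x * `|v.1| <= `|v.2| ->
  (@lebesgue_measure R (shadow B rho v) <= eta%:E)%E.
Hypothesis sizeQ : size Q = size B.
Hypothesis Qgap : pairwise (fun q q' => q.2 + gap < q'.2) Q.
Hypothesis BQ : forall b, b \in B -> exists2 q, q \in Q & q.1 = b.1 /\ `|q.2 - b.2| <= W / 2.
Hypothesis QB : forall q, q \in Q -> exists2 b, b \in B & q.1 = b.1 /\ `|q.2 - b.2| <= W / 2.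
Hypothesis g0 : 0 < g.
Hypothesis Ncg : Nc%:R * g = 3 * W.
Hypothesis ggap : 4 * g <= gap.
Hypothesis gW : 8 * g <= W.
Hypothesis grho : 10 * N%:R * g <= rho.

Let xpi : x < pi / 2.
Proof. by have := pi_gt0 R; have := xpi4; lra. Qed.

Let axis := axis x.
Let core := core x delta.
Let mm : R := 2 * N%:R + 4.
(** A comb is [3 * W] wide and starts, up to the phase, [W] to the left of its slat of width [W].
    The excess on both sides makes up for the change of height, the phase and the unit margins of
    [gadget_ray]. *)
Let L0 : seq pt := shift (- W) Q.
Let L k := shift (phase g J k) L0.

Let sizeL0 : size L0 = N. Proof. by rewrite size_map sizeQ sizeB. Qed.
Let sizeL k : size (L k) = N. Proof. by rewrite size_map sizeL0. Qed.

Let phase_itv k : (k < J)%N -> 0 <= phase g J k <= g.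
Proof.
move=> kJ; rewrite /phase; have J1 : 0 < J%:R :> R by rewrite ltr0n.
rewrite mulr_ge0 ?divr_ge0 ?(ltW g0)//= ler_piMl ?(ltW g0)//.
by rewrite ler_pdivrMr// mul1r ler_nat ltnW.
Qed.

Let mem_L k q : q \in L k -> exists2 q', q' \in Q & q = (q'.1 - W + phase g J k, q'.2).
Proof. by move=> /mapP[_ /mapP[q' q'Q ->] ->]; exists q'. Qed.

(** Horizontally a comb stays within [3 * W] of the start of its slat, vertically within [W]. As
    [W <= rho / 20], it lies well inside the neighbourhood of size [rho] which the shadows
    control. *)
Let near_plate k z : (k < J)%N -> mirror_union (comb g Nc (L k)) z ->
  exists2 b, b \in B & norm1 (z - b) <= 4 * W.
Proof.
move=> kJ [m /mem_comb[q [i [qL iN ->]]]] /segment_tooth[s /andP[s0 s1] ->].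
have [q' q'Q ->] := mem_L qL; have [b bB [b1]] := QB q'Q.
rewrite ler_norml => /andP[b2 b3]; exists b => //.
have /andP[p0 p1] := phase_itv kJ.
have ig : 0 <= (i%:R + s) * g <= 3 * W.
  rewrite mulr_ge0 ?(ltW g0)// ?addr_ge0//= -Ncg ler_pM2r//.
  have : i.+1%:R <= Nc%:R :> R by rewrite ler_nat.
  by rewrite -natr1; lra.
have sg : 0 <= s * g <= g by rewrite mulr_ge0 ?(ltW g0)//= ler_piMl// ltW.
case/andP: ig => i0 i1; case/andP: sg => sg0 sg1.
rewrite /norm1 !coordE /= b1.
have -> : 4 * W = 3 * W + W by ring.
have := g0; have := gW; have := W0 => W0' gW' g0'.
by apply: lerD; rewrite ler_norml; apply/andP; split; lra.
Qed.

Let M k := gadgets n axis g Nc (L k).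

Lemma blinds_disc k : (k < J)%N -> mirror_union (M k) `<=` disc.
Proof.
move=> kJ z [_ /allpairsP[[i m] /= [iN mL ->]]] zm.
have [z0 z0m ->] : exists2 z0, segment m z0 & z = rotate (axis i) z0.
  have zE : z = rotate (axis i) (rotate (- axis i) z) by rewrite rotate_rotate subrr rotate0.
  by exists (rotate (- axis i) z) => //; apply/(@segment_rotate R (axis i)); rewrite -zE.
have [|b bB zb] := @near_plate k z0 kJ; first by exists m.
have [a] := B_near bB; rewrite ler_norml => /andP[a1 a2] hb.
rewrite /disc /= enorm_rotate (le_trans (enorm_le_norm1 _))//.
have h1 := norm1D (z0 - b) b; rewrite subrK in h1.
have h2 := norm1D (b - (a, 0)) (a, 0); rewrite subrK in h2.
have h3 : norm1 (a, 0) <= (2 - kappa) / 2.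
  by rewrite /norm1 /= normr0 addr0 ler_norml a1.
have h4 := norm1_ge0 (b - (a, 0)); have := Wrho; have := W0; have /andP[] := kappa01.
lra.
Qed.

Lemma blinds_nondegenerate k m : m \in M k -> m.1 <> m.2.
Proof.
move=> /allpairsP[[i m0] /= [iN /mem_comb[q [l [qL lN ->]]] ->]].
move=> /(can_inj (rotateK _)) /(congr1 snd) /= /eqP; apply/negP.
by rewrite lt_eqF// ltrDl.
Qed.

(** The five causes of loss: the rim, the borders between cones, the slats of a foreign copy, the
    ends of a comb, and the ends of a tooth. Only the last one depends on the phase. *)
Let bad k : set (pt * pt) :=
  [set d | disc_lines d /\ 1 - kappa < `|offset d|] `|`
  ([set d | disc_lines d /\ forall j, (j < n)%N -> ~ core j d] `|`
  (\bigcup_(i in [set` iota 0 n]) [set d | [/\ directed_lines d,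
    tan x * `|(frame axis i d).1.2| <= `|(frame axis i d).1.1| &
    exists2 b, b \in B & `|dot b (normal (frame axis i d).1) - offset d| <= rho]] `|`
  (\bigcup_(jq in [set` [seq (j, q) | j <- iota 0 n, q <- L0]])
     end_set x delta g mm Nc jq.1 jq.2 `|`
   \bigcup_(j in [set` iota 0 n]) phase_set x delta g mm Nc J L0 j k))).

Let mmL : 2 * (size L0)%:R + 3 <= mm.
Proof. by rewrite sizeL0 /mm lerD2l; lra. Qed.

Let mem_iota0 j : j \in iota 0 n = (j < n)%N.
Proof. by rewrite mem_iota. Qed.

Lemma bad_measure : exists2 k, (k < J)%N & measurable (bad k) /\
  (Lambda (bad k) <= (4 * pi * kappa + (5 * pi * kappa + (4 * pi * n%:R * eta +
     (16 * pi * N%:R * (mm * g) + 24 * pi * N%:R * W / J%:R))))%:E)%E.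
Proof.
have Jp : 0 < J%:R :> R by rewrite ltr0n.
have pm j : (j < n)%N -> (\sum_(k <- iota 0 J) Lambda (phase_set x delta g mm Nc J L0 j k) <=
   (16 * x * (Nc%:R * g) * (size L0)%:R)%:E)%E.
  by move=> jn; apply: (phase_measure x0 nx xpi).
(* Over all phases, each of the [n] copies loses at most [16 * x * (3 * W) * N], which makes
   [24 * pi * N * W] since [2 * n * x = pi]: the number of copies has cancelled. *)
have [||k] := @exists_le_average R _ (iota 0 J)
  (fun k => \sum_(j <- iota 0 n) Lambda (phase_set x delta g mm Nc J L0 j k))%E
  (24 * pi * N%:R * W / J%:R).
- by rewrite size_iota.
- rewrite exchange_big /=; apply: le_trans (sum_le (c := 16 * x * (3 * W) * N%:R) _) _.
    by move=> j; rewrite mem_iota0 => jn; have := pm j jn; rewrite Ncg sizeL0.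
  rewrite !size_iota lee_fin divfK ?gt_eqF//.
  by rewrite -nx; lra.
rewrite mem_iota => /andP[_ kJ] hk; exists k => //.
have kap : 0 <= kappa <= 1 by case/andP: kappa01 => /ltW -> ->.
have [mE1 E1] := @rim_measure R kappa kap.
have kx : 0 < kappa * x <= x by case/andP: kappa01 => k0 k1; rewrite mulr_gt0// ler_piMl// ltW.
have [mE2 E2] := direction_measure x0 nx kx directions.
have [|mE3 E3] := @measure_bigcup_seq _ _ _ (@Lambda R) _ (iota 0 n) (fun i =>
   [set d | [/\ directed_lines d,
    tan x * `|(frame axis i d).1.2| <= `|(frame axis i d).1.1| &
    exists2 b, b \in B & `|dot b (normal (frame axis i d).1) - offset d| <= rho]]).
  by move=> i _; have [] := @kill_measure R axis i _ rho _ B eta0 B_shadow.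
have [|mE4 E4] := @measure_bigcup_seq _ _ _ (@Lambda R) _
   [seq (j, q) | j <- iota 0 n, q <- L0] (fun jq => end_set x delta g mm Nc jq.1 jq.2).
  move=> _ /allpairsP[[j q] /= [+ _ ->]]; rewrite mem_iota0 => jn.
  by have [] := end_set_measure x0 nx xpi deltaT delta01 Nc g0 mmL q jn.
have [|mE5 E5] := @measure_bigcup_seq _ _ _ (@Lambda R) _ (iota 0 n)
   (fun j => phase_set x delta g mm Nc J L0 j k).
  by move=> j _; exact: measurable_phase_set.
have mE45 := measurableU _ _ mE4 mE5.
have mE345 := measurableU _ _ mE3 mE45.
have mE2345 := measurableU _ _ mE2 mE345.
split; first exact: measurableU.
rewrite EFinD; apply: le_trans (measureU2 _ mE1 mE2345) _; apply: leeD => //.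
rewrite EFinD; apply: le_trans (measureU2 _ mE2 mE345) _; apply: leeD => //.
  apply: le_trans E2 _; rewrite lee_fin.
  have -> : 4 * (kappa * x) * (2 * n%:R + 1) = 4 * kappa * (2 * n%:R * x) + kappa * (4 * x) by ring.
  rewrite nx; have : kappa * (4 * x) <= kappa * pi.
    rewrite ler_pM2l; last by case/andP: kappa01.
    by have := xpi4; lra.
  lra.
rewrite EFinD; apply: le_trans (measureU2 _ mE3 mE45) _; apply: leeD => //.
  apply: le_trans E3 _; apply: le_trans (sum_le (c := 4 * pi * eta) _) _.
    by move=> i _; have [] := @kill_measure R axis i _ rho _ B eta0 B_shadow.
  by rewrite size_iota lee_fin; lra.
rewrite EFinD; apply: le_trans (measureU2 _ mE4 mE5) _; apply: leeD => //.
  apply: le_trans E4 _; apply: le_trans (sum_le (c := 32 * x * (mm * g)) _) _.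
    move=> _ /allpairsP[[j q] /= [+ _ ->]]; rewrite mem_iota0 => jn.
    by have [] := end_set_measure x0 nx xpi deltaT delta01 Nc g0 mmL q jn.
  rewrite size_allpairs size_iota sizeL0 lee_fin natrM -nx.
  by rewrite le_eqVlt; apply/orP; left; apply/eqP; ring.
exact: le_trans E5 hk.
Qed.

Lemma blinds_ray k d : (k < J)%N -> disc_lines d -> ~ bad k d ->
  line d `&` mirror_union (M k) !=set0 /\
  exists2 w, transformation (M k) d (d.1, w) & enorm (d.2 - w) <= 2 * g * N%:R.
Proof.
move=> kJ dd nbad; have [Wd _] := dd; have /andP[d0 d1] := delta01.
have /andP[k0 k1] := kappa01.
have off : `|offset d| <= 1 - kappa.
  by rewrite leNgt; apply/negP => h; apply: nbad; left.
have [j jn hc] : exists2 j, (j < n)%N & core j d.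
  apply: contrapT => no; apply: nbad; right; left; split=> // j jn hc.
  by apply: no; exists j.
have away i b : (i < n)%N -> i != j -> b \in B ->
    rho < `|dot b (normal (frame axis i d).1) - offset d|.
  move=> iN ij bB; rewrite ltNge; apply/negP => h; apply: nbad; right; right; left.
  exists i; rewrite /= ?mem_iota0//; split=> //; last by exists b.
  by apply: (core_exclusive x0 nx) ij hc.
have ce : clear_ends x g mm Nc L0 j d.
  move=> q qL; rewrite !ltNge; apply/andP; rewrite -negb_or; apply/negP => h.
  apply: nbad; right; right; right; left; exists (j, q).
    by apply/allpairsP; exists (j, q); rewrite mem_iota0.
  by split=> //; apply/orP.
have gp : good_phase x g Nc J j (L k) d.
  apply: contrapT => no; apply: nbad; right; right; right; right.
  by exists j; rewrite /= ?mem_iota0.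
have [b0 td] := core_slope d0 Wd hc.
set d' := frame axis j d in b0 td; pose t := slope d'; pose p := xcut d'.
have tJ : 2 * `|slope d'| * J%:R < 1.
  apply: le_lt_trans deltaJ; rewrite ler_wpM2r//; exact: ler_wpM2l.
have sep : pairwise (fun q q' : pt => q.2 + 4 * g < q'.2) (L k).
  rewrite !pairwise_map; apply: sub_pairwise Qgap => q q' /=; apply: le_lt_trans.
  by rewrite lerD2l.
have [gp1 gp2] := gp.
have clear i z : (i < n)%N -> i != j -> mirror_union (comb g Nc (L k)) z ->
    2 * g * (size (L k))%:R < `|dot z (normal (frame axis i d).1) - offset d|.
  (* The start of the slat is farther than [rho] from the line, the mirror within [4 * W <= rho / 5]
     of it, and the displacement at most [rho / 5]. *)
  move=> iN ij zM; have [b bB zb] := near_plate kJ zM; have h1 := away i b iN ij bB.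
  have [n1 n2] := frame_le1 axis i Wd.
  have h2 : `|dot (z - b) (normal (frame axis i d).1)| <= norm1 (z - b).
    by apply: dot_norm1; rewrite /= ?normrN.
  have h3 := ler_normB (dot z (normal (frame axis i d).1) - offset d)
     (dot (z - b) (normal (frame axis i d).1)).
  rewrite (_ : _ - _ - _ = dot b (normal (frame axis i d).1) - offset d) in h3; last first.
    by rewrite /dot !coordE; ring.
  rewrite sizeL; have -> : 2 * g * N%:R = 10 * N%:R * g / 5 by field.
  by have := W0; have := Wrho; have := grho; lra.
have [] := gadget_ray g0 J0 jn Wd sep b0 tJ gp1 gp2 clear.
rewrite sizeL => ray hit; split=> //; apply: hit.
have Wd' : directed_lines d' by exact: directed_lines_rotate.
(* In its frame the line is nearly parallel to the second axis. Having offset at most [1 - kappa],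
   it then cuts the first axis within [1 - kappa / 2] of the origin, that is, on the initial slat,
   because [(1 - kappa / 2) ^+ 2 >= 1 - kappa]. *)
have b1 : 1 - kappa / 2 <= `|d'.1.2|.
  have n1 := directed_dot Wd'.
  have a2 : d'.1.1 ^+ 2 <= delta ^+ 2 * d'.1.2 ^+ 2.
    rewrite -exprMn -(real_normK (num_real d'.1.1)) -[leRHS](real_normK (num_real _)).
    rewrite ler_pXn2r ?nnegrE//; apply: le_trans hc _.
    by rewrite normrM (ger0_norm d0).
  have b2 : d'.1.2 ^+ 2 <= 1 by rewrite -n1 -!expr2 lerDr sqr_ge0.
  have bb : `|d'.1.2| <= 1 by have [] := frame_le1 axis j Wd.
  have b3 : `|d'.1.2| ^+ 2 <= `|d'.1.2| by rewrite expr2 ler_piMl.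
  rewrite real_normK ?num_real// in b3.
  have a3 : delta ^+ 2 * d'.1.2 ^+ 2 <= kappa / 2 * 1.
    by apply: ler_pM; rewrite ?sqr_ge0.
  by move: n1; rewrite -!expr2 => n1; lra.
have bpos : 0 < `|d'.1.2| by rewrite normr_gt0.
have pb : `|p| <= (2 - kappa) / 2.
  rewrite /p /xcut offset_rotate normrM normrV ?unitfE// ler_pdivrMr//.
  apply: le_trans off _; apply: (@le_trans _ _ ((2 - kappa) / 2 * (1 - kappa / 2))).
    have : 0 <= kappa ^+ 2 by exact: sqr_ge0.
    by rewrite (_ : _ * _ = 1 - kappa + kappa ^+ 2 / 4); [lra|field].
  by rewrite ler_wpM2l//; lra.
have [b bB /andP[c1 c2]] := B_cover td pb.
have [q qQ [q1 q2]] := BQ bB.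
exists (q.1 - W + phase g J k, q.2).
  by apply/mapP; exists (q.1 - W, q.2) => //; apply/mapP; exists q.
have tq : `|t * (q.2 - b.2)| <= W / 2.
  rewrite normrM; apply: le_trans q2; rewrite ler_piMl//; exact: le_trans td d1.
have /andP[p0 p1] := phase_itv kJ.
rewrite /position /= -/t -/p q1.
(* The terms lie in [[0, W]], [[- W / 2, W / 2]] and [[W - g, W]], so that their sum is between [g]
   and [3 * W - g]. *)
have -> : p + t * q.2 - (b.1 - W + phase g J k) =
    (p - intercept t b) + t * (q.2 - b.2) + (W - phase g J k) by rewrite /intercept; ring.
move: tq; rewrite ler_norml => /andP[t1 t2].
have := g0; have := gW => gW' g0'.
rewrite ler_pdivlMr// ler_pdivrMr// mulrBl Ncg; apply/andP.
by move: c1 c2; rewrite -/t; split; lra.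
Qed.

End Blinds.

(** * Choice of the parameters *)

Lemma exists_nat_gt (R : realType) (a : R) : exists m : nat, [/\ (1 < m)%N & a < m%:R].
Proof.
exists (Num.trunc a).+2; split=> //; apply: lt_trans (truncnS_gt a) _.
by rewrite ltr_nat.
Qed.

Lemma exists_pos_le (R : realType) (s : seq R) : all (fun a => 0 < a) s ->
  exists2 c, 0 < c & forall a, a \in s -> c <= a.
Proof.
elim: s => [_|a s IH /= /andP[a0 /IH[c c0 cs]]]; first by exists 1.
exists (Num.min a c); first by rewrite lt_min a0.
move=> b /[!in_cons] /predU1P[->|/cs bs]; first by rewrite ge_min lexx.
by rewrite ge_min bs orbT.
Qed.

(** With [y = x / m] and [delta = tan (m.-1 * y)], [tan_gap] bounds the quotient uniformly in [n],
    while the part of each cone that is left out is the proportion [1 / m] of its angle. *)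
Lemma tan_fine (R : realType) (m : nat) (c : R) : (1 < m)%N -> 0 < c -> c <= 1 ->
  exists (n : nat) (x delta : R),
    [/\ (0 < n)%N, 0 < x <= pi / 4 & 2 * n%:R * x = pi] /\
    [/\ 0 < delta < tan x, delta <= c, delta / (tan x - delta) <= m%:R &
      forall a, `|a| <= x - m%:R^-1 * x -> `|sin a| <= delta * `|cos a|].
Proof.
move=> m1 c0 c1; have pi0 : 0 < pi :> R := pi_gt0 R.
have [n [n1 tc xp]] := tan_small c0; set x : R := pi / (2 * n%:R) in tc xp.
have n0 : 0 < n%:R :> R by rewrite ltr0n ltnW.
have m0 : 0 < m%:R :> R by rewrite ltr0n ltnW.
have x0 : 0 < x by rewrite divr_gt0// mulr_gt0.
pose y := x / m%:R; have y0 : 0 < y by rewrite divr_gt0.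
have my : m%:R * y = x by rewrite /y mulrC divfK// gt_eqF.
have mp : m%:R * y < pi / 2 by rewrite my; lra.
have [t0 t1 t2] := tan_gap (ltnW m1) y0 mp; rewrite my in t1 t2.
have zE : m.-1%:R * y = x - m%:R^-1 * x.
  have -> : m%:R^-1 * x = y by rewrite mulrC.
  by rewrite -[in RHS]my -[in RHS](prednK (ltnW m1)) -natr1; ring.
have z0 : 0 < m.-1%:R * y by rewrite mulr_gt0// ltr0n -subn1 subn_gt0.
have zx : m.-1%:R * y < x by rewrite zE ltrBlDr ltrDl mulr_gt0// invr_gt0.
exists n, x, (tan (m.-1%:R * y)); split; split=> //.
- exact: ltnW.
- by rewrite x0.
- by rewrite /x mulrC divfK// mulf_neq0// gt_eqF.
- rewrite t1 andbT divr_gt0//; first by apply: sin_gt0_pi; rewrite z0 /=; lra.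
  by apply: cos_gt0_pihalf; apply/andP; split; lra.
- by apply: le_trans tc; exact: ltW.
- move=> a; rewrite -zE => ha; apply: abs_tan_le => //.
  by apply/andP; split; lra.
Qed.

Theorem theorem1p1 (R : realType) (eps : R) (eps_gt0 : 0 < eps) :
  exists M : seq ((R * R) * (R * R)),
    [/\ forall m, m \in M -> m.1 <> m.2,
        mirror_union M `<=` disc &
        exists A : set ((R * R) * (R * R)),
          [/\ measurable A,
              A `<=` disc_lines,
              (Lambda (disc_lines `\` A) <= eps%:E)%E,
              (forall d, A d -> line d `&` mirror_union M !=set0) &
              (forall v w, A (v, w) ->
                 exists w1, transformation M (v, w) (v, w1) /\
                            enorm (w - w1) <= eps)]].
Proof.
have pi0 : 0 < pi :> R := pi_gt0 R.
(* The rim, the borders between cones and the foreign slats cost [4 * pi], [5 * pi] and [4 * pi]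
   times [kappa]; the ends of combs and of teeth cost at most [kappa] each. *)
have [m [m1 meps]] := exists_nat_gt ((13 * pi + 2) / eps).
have m0 : 0 < m%:R :> R by rewrite ltr0n ltnW.
pose kappa : R := m%:R^-1; have k0 : 0 < kappa by rewrite invr_gt0.
have k1 : kappa <= 1 by rewrite invf_le1// ler1n ltnW.
have keps : (13 * pi + 2) * kappa <= eps.
  by rewrite ler_pdivrMr// -ler_pdivrMl// mulrC ltW.
(* Bounds the total length [w] for every [n], the initial slat having length [2 - kappa] and the
   quotient being at most [m]. Hence [J] can be fixed before [n]. *)
pose C := slat_total 2 m%:R : R.
have [J [J1 JC]] := exists_nat_gt (24 * pi * C * m%:R).
have J0 : 0 < J%:R :> R by rewrite ltr0n ltnW.
(* The first term gives [2 * delta * J < 1], the second [delta ^+ 2 <= kappa / 2]. *)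
pose c0 := Num.min (1 / (4 * J%:R)) (kappa / 2).
have c00 : 0 < c0 by rewrite lt_min !divr_gt0// mulr_gt0.
have c0k : c0 <= kappa / 2 by rewrite ge_min lexx orbT.
have c01 : c0 <= 1 by lra.
have [n [x [delta [[n0 /andP[x0 x4] nx] [/andP[d0 dT] dc dm dir]]]]] := tan_fine m1 c00 c01.
have np : 0 < n%:R :> R by rewrite ltr0n.
have d1 : delta <= 1 by exact: le_trans c01.
have dJ : 2 * delta * J%:R < 1.
  have : delta <= 1 / (4 * J%:R) by apply: le_trans dc _; rewrite ge_min lexx.
  rewrite ler_pdivlMr ?mulr_gt0//; have : 0 < delta * J%:R by exact: mulr_gt0.
  by rewrite (_ : delta * (4 * J%:R) = 4 * (delta * J%:R)); [lra|ring].
have d2 : delta ^+ 2 <= kappa / 2.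
  by apply: le_trans (le_trans dc c0k); rewrite expr2 ler_piMl// ltW.
pose eta := kappa / n%:R; have eta0 : 0 < eta by rewrite divr_gt0.
have w00 : 0 < 2 - kappa by lra.
have r0 : 0 < kappa / 8 by rewrite divr_gt0.
have dT2 : 0 < delta < tan x by rewrite d0.
have [B [N [w [rho [N0 BN rho0 [/andP[w0 wC] Wrho Bnear Bcover Bshadow]]]]]] :=
  sundial dT2 d1 w00 eta0 r0.
have Np : 0 < N%:R :> R by rewrite ltr0n.
pose W := w / N%:R; have W0 : 0 < W by rewrite divr_gt0.
have wC' : w <= C.
  apply: le_trans wC _; rewrite /C /slat_total lerD2r.
  have rm0 : 0 <= delta / (tan x - delta).
    by rewrite divr_ge0 ?subr_ge0 ?(ltW dT) ?(ltW d0).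
  have h1 : 0 <= 1 + 2 * (delta / (tan x - delta)) by lra.
  have h2 : 1 + 2 * (delta / (tan x - delta)) <= 1 + 2 * m%:R by lra.
  apply: ler_pM => //; first by rewrite addr_ge0// mulr_ge0// ltW.
  by rewrite lerD2r; apply: ler_pM => //; lra.
have W20 : 0 < W / 2 by rewrite divr_gt0.
have [Q [QN Qsort BQ QB]] := distinct_heights B W20.
have [gap gap0 Qgap] := pairwise_gap Qsort.
pose mm : R := 2 * N%:R + 4; have mm0 : 0 < mm by rewrite addr_gt0// mulr_gt0.
(* In this order: the strips of different combs stay apart, teeth are small against a slat, the
   displacements are small against [rho] and at most [eps], and the ends of combs cost at most
   [kappa]. *)
have [G G0 Gle] := @exists_pos_le R [:: gap / 4; W / 8; rho / (10 * N%:R);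
   eps / (2 * N%:R); kappa / (16 * pi * N%:R * mm)] ltac:(by rewrite /= !divr_gt0 ?mulr_gt0).
(* The number of teeth is chosen first and [g] derived from it, so that [Nc * g] is exactly
   [3 * W]. *)
have [Nc [Nc1 NcG]] := exists_nat_gt (3 * W / G).
have Ncp : 0 < Nc%:R :> R by rewrite ltr0n ltnW.
pose g := 3 * W / Nc%:R; have g0 : 0 < g by rewrite divr_gt0// mulr_gt0.
have Ncg : Nc%:R * g = 3 * W by rewrite /g mulrC divfK // gt_eqF.
have gG : g <= G by rewrite /g ler_pdivrMr// (mulrC G) -ler_pdivrMr// ltW.
have [g1 g2 g3 g4 g5] : [/\ 4 * g <= gap, 8 * g <= W, 10 * N%:R * g <= rho,
    2 * g * N%:R <= eps & 16 * pi * N%:R * (mm * g) <= kappa].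
  split.
  - have : g <= gap / 4 by apply: le_trans gG (Gle _ _); rewrite !inE eqxx.
    lra.
  - have : g <= W / 8 by apply: le_trans gG (Gle _ _); rewrite !inE eqxx ?orbT.
    lra.
  - have : g <= rho / (10 * N%:R) by apply: le_trans gG (Gle _ _); rewrite !inE eqxx ?orbT.
    by rewrite ler_pdivlMr ?mulr_gt0// mulrC.
  - have : g <= eps / (2 * N%:R) by apply: le_trans gG (Gle _ _); rewrite !inE eqxx ?orbT.
    by rewrite ler_pdivlMr ?mulr_gt0// mulrCA mulrA.
  - have : g <= kappa / (16 * pi * N%:R * mm).
      by apply: le_trans gG (Gle _ _); rewrite !inE eqxx ?orbT.
    by rewrite ler_pdivlMr ?mulr_gt0// mulrC mulrA.
have k01 : 0 < kappa <= 1 by rewrite k0.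
have d01 : 0 <= delta <= 1 by rewrite d1 ltW.
have [k kJ [mbad Lbad]] := bad_measure x0 nx x4 dT d01 (ltnW J1) k01 dir BN (ltW eta0)
  Bshadow QN g0 Ncg.
exists (gadgets n (axis x) g Nc (shift (phase g J k) (shift (- W) Q))); split.
- by move=> m' /(blinds_nondegenerate g0).
- exact: (blinds_disc (ltnW J1) k01 W0 Wrho Bnear QB g0 Ncg g2 kJ).
set bad := (X in measurable X) in mbad Lbad.
have ray d : disc_lines d -> ~ bad d -> _ :=
  fun dd nb => blinds_ray x0 nx x4 dT d01 d2 (ltnW J1) dJ k01 BN W0 Wrho Bcover
    QN Qgap BQ QB g0 Ncg g1 g2 g3 kJ dd nb.
exists (disc_lines `\` bad); split.
- by apply: measurableD => //; exact: measurable_disc_lines.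
- exact: subDsetl.
- rewrite setDD; apply: (@le_trans _ _ (Lambda bad)).
    apply: le_measure; rewrite ?inE//.
    by apply: measurableI => //; exact: measurable_disc_lines.
  apply: le_trans Lbad _; rewrite lee_fin; apply: le_trans keps.
  have e1 : 4 * pi * n%:R * eta = 4 * pi * kappa by rewrite /eta; field; rewrite gt_eqF.
  have e2 : 24 * pi * N%:R * W / J%:R <= kappa.
    rewrite ler_pdivrMr// /kappa [leRHS]mulrC ler_pdivlMr//.
    have -> : 24 * pi * N%:R * W = 24 * pi * w by rewrite /W; field; rewrite gt_eqF.
    apply: le_trans (ltW JC); rewrite ler_pM2r// ler_pM2l// mulr_gt0//.
  rewrite e1; move: g5; rewrite -/mm; lra.
- by move=> d [dd nb]; have [] := ray d dd nb.
move=> v w' [dd nb]; have [_ [w1 T1 e1]] := ray _ dd nb.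
by exists w1; split=> //; exact: le_trans e1 g4.
Qed.
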